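(* Let $(\gamma,v_1,v_2):I\to H^3\times\Delta_5$ be a hyperbolic framed curve with $a^2+b^2\neq0$, $MA'-M'A\equiv0$, $M^2>A^2$ and $N\neq0$ on $I$ (so $\sigma_F<0$), and let $p_0=(t_0,\theta_0)$ be a singular point of $F^d_{\mathcal{E}^d}$. Then (a) $p_0$ is a cuspidal edge; (b) $p_0$ is never a cuspidal cross cap.
   Context: $\mathbb{R}^4_1$ denotes $\mathbb{R}^4$ with $\langle x,y\rangle=-x_0y_0+x_1y_1+x_2y_2+x_3y_3$; $H^3=\{x:\langle x,x\rangle=-1\}$, $S^3_1=\{x:\langle x,x\rangle=1\}$. For $x^1,x^2,x^3\in\mathbb{R}^4_1$, $x^1\wedge x^2\wedge x^3$ is the vector given by the formal determinant with first row $(-e_0,e_1,e_2,e_3)$ and the components of $x^1,x^2,x^3$ as remaining rows. Let $\Delta_5=\{(v_1,v_2)\in S^3_1\times S^3_1:\langle v_1,v_2\rangle=0\}$. A hyperbolic framed curve is a smooth map $(\gamma,v_1,v_2):I\to H^3\times\Delta_5$ with $\langle\gamma,v_i\rangle=\langle\gamma',v_i\rangle=0$. Put $\mu=\gamma\wedge v_1\wedge v_2$; then $\gamma'=m\mu$, $v_1'=nv_2+a\mu$, $v_2'=-nv_1+b\mu$, $\mu'=m\gamma-av_1-bv_2$ with $m=\langle\gamma',\mu\rangle$, $n=\langle v_1',v_2\rangle$, $a=\langle v_1',\mu\rangle$, $b=\langle v_2',\mu\rangle$. Put $f=ab'-a'b+n(a^2+b^2)$. With $a^2+b^2\neq0$,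 the Frenet type frame is $n_1=(av_1+bv_2)/\sqrt{a^2+b^2}$, $n_2=(-bv_1+av_2)/\sqrt{a^2+b^2}$, giving $\gamma'=M\mu$, $n_1'=Nn_2+A\mu$, $n_2'=-Nn_1$, $\mu'=M\gamma-An_1$ with $M=m$, $N=f/(a^2+b^2)$, $A=\sqrt{a^2+b^2}$; $\sigma_F=A^2N^2(A^2-M^2)-(MA'-M'A)^2$. De Sitter evolute: $\mathcal{E}^d_\gamma=\frac{1}{\sqrt{-\sigma_F}}(A^2N\gamma-MAN\,n_1+(MA'-M'A)\,n_2)$. Its $\Delta_5$-dual surface: $F^d_{\mathcal{E}^d}(t,\theta)=\cosh\theta\,\mu(t)+\sinh\theta\,\frac{-M\gamma+An_1}{\sqrt{M^2-A^2}}(t)$, $(t,\theta)\in I\times\mathbb{R}$, with singular set $\{\theta=0\}$. Cuspidal edge: germ $\mathcal{A}$-equivalent to $(u,v)\mapsto(u,v^2,v^3)$; cuspidal cross cap: $(u,v)\mapsto(u,v^2,uv^3)$. *)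

(* Defs.v *)
From HB Require Import structures.
From mathcomp Require Import all_boot all_order all_algebra.
From mathcomp Require Import all_classical all_reals all_analysis.
Set Implicit Arguments. Unset Strict Implicit. Unset Printing Implicit Defensive.
Import Order.TTheory GRing.Theory Num.Theory.
Import numFieldNormedType.Exports.
Local Open Scope classical_set_scope.
Local Open Scope ring_scope.

Section Defs.
Variable R : realType.

Definition coord4 (x : 'rV[R]_4) (i : nat) : R := x ord0 (inord i).

Definition lor (x y : 'rV[R]_4) : R :=
  - (coord4 x 0 * coord4 y 0) + coord4 x 1 * coord4 y 1
  + coord4 x 2 * coord4 y 2 + coord4 x 3 * coord4 y 3.

(** x1 /\ x2 /\ x3 : formal determinant with first row (-e0, e1, e2, e3).
    Component j is (the coefficient of row 1) times the (0,j) cofactor, and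
    the (0,j) cofactor is the determinant with first row replaced by delta_j. *)
Definition wedge3 (x y z : 'rV[R]_4) : 'rV[R]_4 :=
  \row_(j < 4)
    ((if val j == 0%N then -1 else 1) *
     \det (\matrix_(i < 4, k < 4)
             (match val i with
              | 0%N => (j == k)%:R
              | 1%N => x ord0 k
              | 2%N => y ord0 k
              | _ => z ord0 k
              end) : 'M[R]_4)).

Definition coshR (x : R) : R := (expR x + expR (- x)) / 2.
Definition sinhR (x : R) : R := (expR x - expR (- x)) / 2.

Fixpoint Ck {V W : normedModType R} (k : nat) (U : set V) (f : V -> W)
  : Prop :=
  match k with
  | 0%N => forall x, U x -> {for x, continuous f}
  | k'.+1 => (forall x, U x -> differentiable f x) /\
             (forall v : V, Ck k' U (fun x => 'd f x v))
  end.

Definition smooth_on {V W : normedModType R} (U : set V) (f : V -> W) :=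
  forall k, Ck k U f.

Fixpoint iter_deriv {V : normedModType R} (n : nat) (f : R -> V) : R -> V :=
  match n with 0%N => f | n'.+1 => (derive1 (iter_deriv n' f)) end.

Definition smooth_curve {V : normedModType R} (I : set R) (f : R -> V) :=
  forall n x, I x -> derivable (iter_deriv n f) x 1.

Definition diffeo_on {n : nat} (U : set 'rV[R]_n) (phi : 'rV[R]_n -> 'rV[R]_n) :=
  open U /\ smooth_on U phi /\ open (phi @` U) /\
  exists psi : 'rV[R]_n -> 'rV[R]_n,
    smooth_on (phi @` U) psi /\ (forall x, U x -> psi (phi x) = x).

Definition A_equiv {m : nat} (D : set 'rV[R]_2)
  (f : 'rV[R]_2 -> 'rV[R]_m) (p : 'rV[R]_2)
  (g : 'rV[R]_2 -> 'rV[R]_m) (q : 'rV[R]_2) : Prop :=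
  exists (U : set 'rV[R]_2) (phi : 'rV[R]_2 -> 'rV[R]_2)
         (W : set 'rV[R]_m) (Psi : 'rV[R]_m -> 'rV[R]_m),
    [/\ U q /\ diffeo_on U phi /\ phi q = p,
        W (f p) /\ diffeo_on W Psi /\ Psi (f p) = g q &
        forall x, U x -> [/\ D (phi x), W (f (phi x)) & Psi (f (phi x)) = g x]].

Definition rv2 (u v : R) : 'rV[R]_2 :=
  \row_(i < 2) (if val i == 0%N then u else v).
Definition rv4 (a b c d : R) : 'rV[R]_4 :=
  \row_(i < 4) (match val i with 0%N => a | 1%N => b | 2%N => c | _ => d end).
Definition cu (x : 'rV[R]_2) : R := x ord0 ord0.
Definition cv (x : 'rV[R]_2) : R := x ord0 (inord 1).

(** Normal forms, embedded in R^4 = R^3 x {0}. *)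
Definition cuspidal_edge_nf (x : 'rV[R]_2) : 'rV[R]_4 :=
  rv4 (cu x) (cv x ^+ 2) (cv x ^+ 3) 0.
Definition cuspidal_crosscap_nf (x : 'rV[R]_2) : 'rV[R]_4 :=
  rv4 (cu x) (cv x ^+ 2) (cu x * cv x ^+ 3) 0.

Definition is_cuspidal_edge (D : set 'rV[R]_2) (f : 'rV[R]_2 -> 'rV[R]_4) p :=
  A_equiv D f p cuspidal_edge_nf 0.
Definition is_cuspidal_crosscap (D : set 'rV[R]_2) (f : 'rV[R]_2 -> 'rV[R]_4) p :=
  A_equiv D f p cuspidal_crosscap_nf 0.

Definition singular_point {m : nat} (f : 'rV[R]_2 -> 'rV[R]_m) (p : 'rV[R]_2) :=
  differentiable f p /\ exists v : 'rV[R]_2, v != 0 /\ 'd f p v = 0.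

Definition hyperbolic_framed_curve (I : set R) (g v1 v2 : R -> 'rV[R]_4) :=
  [/\ smooth_curve I g, smooth_curve I v1, smooth_curve I v2 &
   forall t, I t ->
     [/\ lor (g t) (g t) = -1, lor (v1 t) (v1 t) = 1, lor (v2 t) (v2 t) = 1,
         lor (v1 t) (v2 t) = 0 &
         [/\ lor (g t) (v1 t) = 0, lor (g t) (v2 t) = 0,
             lor ((derive1 g) t) (v1 t) = 0 & lor ((derive1 g) t) (v2 t) = 0]]].

Section Frame.
Variables (g v1 v2 : R -> 'rV[R]_4).
Definition mu_of t := wedge3 (g t) (v1 t) (v2 t).
Definition m_of t := lor ((derive1 g) t) (mu_of t).
Definition n_of t := lor ((derive1 v1) t) (v2 t).
Definition a_of t := lor ((derive1 v1) t) (mu_of t).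
Definition b_of t := lor ((derive1 v2) t) (mu_of t).
Definition f_of t := a_of t * ((derive1 b_of) t) - ((derive1 a_of) t) * b_of t
                     + n_of t * (a_of t ^+ 2 + b_of t ^+ 2).
Definition M_of t := m_of t.
Definition A_of t := Num.sqrt (a_of t ^+ 2 + b_of t ^+ 2).
Definition N_of t := f_of t / (a_of t ^+ 2 + b_of t ^+ 2).
Definition n1_of t := (A_of t)^-1 *: (a_of t *: v1 t + b_of t *: v2 t).
Definition n2_of t := (A_of t)^-1 *: (- b_of t *: v1 t + a_of t *: v2 t).
(** Delta_5-dual surface of the de Sitter evolute. *)
Definition Fd (t theta : R) : 'rV[R]_4 :=
  coshR theta *: mu_of t +
  sinhR theta *: ((Num.sqrt (M_of t ^+ 2 - A_of t ^+ 2))^-1 *: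
                  (- M_of t *: g t + A_of t *: n1_of t)).
Definition Fd2 (x : 'rV[R]_2) : 'rV[R]_4 := Fd (cu x) (cv x).
End Frame.

End Defs.

(* Main.v *)
(** In the orthonormal frame (mu, nu, n2) with nu = (- M g + A n1) / kappa and
    kappa = sqrt (M^2 - A^2), the condition M A' = M' A gives mu' = - kappa nu and
    nu' = rho n2 - kappa mu with rho <> 0.  Hence F = cosh th mu + sinh th nu satisfies
    F_t + kappa F_th = rho sinh th n2, so F is singular exactly at th = 0.
    Central projection from the origin turns F into the tangent developable
    (u, p(u+r) - r p'(u+r), q(u+r) - r q'(u+r)) of a curve (u, p, q) with p''(0) <> 0,
    q''(0) = 0 and q'''(0) <> 0.  A Hadamard quotient and the inverse function theorem
    make the second coordinate v^2 up to a function of u; the third one splits as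
    alpha(u, v^2) + v^3 beta(u, v^2) with beta <> 0 (a Borel sum realises the even and
    the odd part of its jet, and the remainder is flat along v = 0), and target
    coordinates remove alpha and beta, leaving (u, v^2, v^3).
    A cuspidal edge germ is injective whereas a cross cap identifies (0, v)
    with (0, - v), so a cuspidal edge is not a cross cap. *)
Require Import Defs.
From HB Require Import structures.
From mathcomp Require Import all_boot all_order all_algebra.
From mathcomp Require Import all_classical all_reals all_analysis.
From mathcomp Require Import ring lra.
Import Order.TTheory GRing.Theory Num.Theory.
Import numFieldNormedType.Exports.
Set Implicit Arguments. Unset Strict Implicit. Unset Printing Implicit Defensive.
Local Open Scope classical_set_scope.
Local Open Scope ring_scope.

(** * Smooth germs *)

(** The germ is brought to normal form by explicit coordinate changes rather than by a recognition
    criterion, so the work lies in showing that functions given piecewise, implicitly or as series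
    are smooth. As [Ck] speaks of iterated directional derivatives, such a function is placed in a
    family of formulas stable under partial derivatives ([smooth_coind]), and a line where the
    formula changes is crossed by [has_partials_glue]. The main obstacle is to write an even
    function of v as a smooth function of v^2: substituting a square root fails, since the root is
    not smooth at 0. It is harmless inside a function flat along the axis, which is why the jet is
    removed beforehand. The equivalence lives in R^4 whereas the surface lies in the quadric of
    vectors of norm 1; a target coordinate that vanishes on that quadric accounts for the last zero
    of the normal form. The jet conditions have geometric sources: p'' is nonzero because [rho] is,
    q'' vanishes at the base point because [n2] is orthogonal to the evolute, and q''' is nonzero
    because the component of [n2'] along the evolute is a nonzero multiple of M N. *)

Section CkCalculus.
Variable R : realType.
Implicit Types V W : normedModType R.

Lemma Ck_subset V W k (U U' : set V) (f : V -> W) :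
  U' `<=` U -> Ck k U f -> Ck k U' f.
Proof.
move=> sU; elim: k f => [|k IH] f /=; first by move=> cf x /sU /cf.
by move=> [df ddf]; split=> [x /sU /df //|v]; apply: IH.
Qed.

(** The candidate [L] is supplied in advance, so differentiability becomes an epsilon estimate and
    uniqueness of the differential identifies it. *)
Lemma diff_of_bound V W (f : V -> W) (L : {linear V -> W}) x : continuous L ->
  (forall e, 0 < e -> \forall y \near (0 : V), `|f (y + x) - (f x + L y)| <= e * `|y|) ->
  differentiable f x /\ ('d f x = L :> (V -> W)).
Proof.
move=> cL H; have h : f \o shift x = cst (f x) + L +o_ 0 id.
  by apply/eqaddoP => e e0; exact: H.
have e := @diff_unique _ _ _ f L x cL h.
split; last exact: e.
by apply/diff_locallyP; rewrite e; split.
Qed.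

Lemma diff_bound V W (f : V -> W) x : differentiable f x ->
  forall e, 0 < e -> \forall y \near (0 : V), `|f (y + x) - (f x + 'd f x y)| <= e * `|y|.
Proof.
move=> df e e0.
by have [_ /eqaddoP/(_ e e0)] := (iffLR (diff_locallyP x f)) df.
Qed.

Lemma diff_near_eq V W (f g : V -> W) x :
  (\near x, f x = g x) -> differentiable f x ->
  differentiable g x /\ ('d g x = 'd f x :> (V -> W)).
Proof.
move=> fg df.
have h : g \o shift x = cst (g x) + 'd f x +o_ 0 id.
  apply/eqaddoP => e e0.
  have [_ /eqaddoP/(_ e e0)] := (iffLR (diff_locallyP x f)) df.
  have gx : f x = g x by exact: nbhs_singleton fg.
  have fg' : \forall y \near (0 : V), f (y + x) = g (y + x).
    by move: fg; rewrite (near_shift 0 x) /= subr0.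
  move=> h; apply: filterS2 h fg' => y /=; rewrite !fctE /= => hy e1.
  by rewrite -e1 -gx.
have dfc := diff_continuous df.
have e := @diff_unique _ _ _ g ('d f x) x dfc h.
split; last exact: e.
by apply/diff_locallyP; rewrite e; split.
Qed.

(** Openness of [U] turns equality on [U] into equality near each of its points, hence into equality
    of differentials. *)
Lemma Ck_ext V W k (U : set V) (f g : V -> W) : open U ->
  (forall x, U x -> f x = g x) -> Ck k U f -> Ck k U g.
Proof.
move=> oU; elim: k f g => [|k IH] f g fg /=.
  move=> cf x Ux; have nfg : \near x, f x = g x.
    by near=> y; apply: fg; near: y; exact: open_nbhs_nbhs.
  have cfx : f @ x --> f x := cf x Ux.
  change (g @ x --> g x); rewrite -(fg x Ux).
  by apply: cvg_trans cfx; apply: near_eq_cvg.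
move=> [df ddf].
have nfg x : U x -> \near x, f x = g x.
  by move=> Ux; near=> y; apply: fg; near: y; exact: open_nbhs_nbhs.
split=> [x Ux|v]; first by case: (diff_near_eq (nfg x Ux) (df x Ux)).
apply: (IH (fun x => 'd f x v) (fun x => 'd g x v) _ (ddf v)) => x Ux.
have [_ e] := diff_near_eq (nfg x Ux) (df x Ux).
exact: (esym (congr1 (fun h => h v) e)).
Unshelve. all: by end_near. Qed.

Lemma CkS V W k (U : set V) (f : V -> W) : Ck k.+1 U f -> Ck k U f.
Proof.
elim: k f => [|k IH] f.
  by move=> [df _] x /df; exact: differentiable_continuous.
by move=> [df ddf]; split=> // v; apply: IH; apply: ddf.
Qed.

Lemma Ck_cst V W k (U : set V) (c : W) : Ck k U (fun=> c).
Proof.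
elim: k c => [|k IH] c; first by move=> x _; exact: cst_continuous.
split=> [x _|v]; first exact: differentiable_cst.
rewrite (_ : (fun x => _) = (fun=> 0)) //.
by apply/funext => x; rewrite (diff_cst c x).
Qed.

Lemma Ck_linear V W k (U : set V) (f : {linear V -> W}) :
  continuous f -> Ck k U f.
Proof.
move=> cf; case: k => [|k]; first by move=> x _; exact: cf.
split=> [x _|v]; first exact: linear_differentiable.
rewrite (_ : (fun x => _) = (fun=> f v)); first exact: Ck_cst.
by apply/funext => x; rewrite diff_lin.
Qed.

Lemma CkD V W k (U : set V) (f g : V -> W) : open U ->
  Ck k U f -> Ck k U g -> Ck k U (fun x => f x + g x).
Proof.
move=> oU; elim: k f g => [|k IH] f g.
  by move=> cf cg x Ux; apply: (@continuousD _ _ _ f g); [exact: cf|exact: cg].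
move=> [df ddf] [dg ddg]; split=> [x Ux|v].
  by apply: (@differentiableD _ _ _ f g); [exact: df|exact: dg].
apply: (@Ck_ext _ _ _ _ (fun x => 'd f x v + 'd g x v) _ oU _
  (IH _ _ (ddf v) (ddg v))) => x Ux.
exact: (esym (congr1 (fun h => h v) (@diffD _ _ _ f g x (df x Ux) (dg x Ux)))).
Qed.

Lemma CkM V k (U : set V) (f g : V -> R) : open U ->
  Ck k U f -> Ck k U g -> Ck k U (fun x => f x * g x).
Proof.
move=> oU; elim: k f g => [|k IH] f g.
  by move=> cf cg x Ux; apply: (@continuousM _ _ f g); [exact: cf|exact: cg].
move=> hf hg; have [df ddf] := hf; have [dg ddg] := hg; split=> [x Ux|v].
  by apply: (@differentiableM _ _ f g); [exact: df|exact: dg].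
apply: (@Ck_ext _ _ _ _
  (fun x => f x * 'd g x v + g x * 'd f x v)) => // [x Ux|].
  exact: (esym (congr1 (fun h => h v) (@diffM _ _ f g x (df x Ux) (dg x Ux)))).
apply: (@CkD _ _ _ _ (fun x => f x * 'd g x v) (fun x => g x * 'd f x v)) => //.
  exact: (IH _ _ (CkS hf) (ddg v)).
exact: (IH _ _ (CkS hg) (ddf v)).
Qed.

Lemma Ck_sum V n k (U : set V) (f : 'I_n -> V -> R) : open U ->
  (forall i, Ck k U (f i)) -> Ck k U (fun x => \sum_i f i x).
Proof.
move=> oU; elim: n f => [|n IH] f hf.
  by rewrite (_ : (fun x => _) = (fun=> 0)); [exact: Ck_cst|
    apply/funext => x; rewrite big_ord0].
rewrite (_ : (fun x => _) =
   (fun x => (\sum_(i < n) f (widen_ord (leqnSn n) i) x) + f ord_max x)).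
  by apply: CkD => //; apply: IH.
by apply/funext => x; rewrite big_ord_recr.
Qed.

(* The coordinates of a finite-dimensional source turn the chain rule into a
   finite sum of products. *)
Definition has_coords V := exists n (c : 'I_n -> {linear V -> R}) (e : 'I_n -> V),
  (forall i, continuous (c i)) /\ forall v, v = \sum_i c i v *: e i.

Lemma has_coords_R : has_coords R.
Proof.
exists 1%N, (fun=> idfun), (fun=> 1); split=> [i x|v].
  exact: cvg_id.
by rewrite big_ord1 /= [_ *: _]mulr1.
Qed.

Lemma has_coords_rV n : has_coords 'rV[R]_n.
Proof.
pose c (i : 'I_n) (v : 'rV[R]_n) : R := v ord0 i.
have lc i : linear (c i) by move=> a u v; rewrite /c !mxE.
pose cm i := GRing.isLinear.Build _ _ _ _ _ (lc i).
pose cl i : {linear _ -> _} := HB.pack (c i) (cm i).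
exists n, cl, (fun i => delta_mx 0 i); split=> [i x|v].
  exact: coord_continuous.
by rewrite [LHS]row_sum_delta.
Qed.

Lemma Ck_linear_comp (V V' W : normedModType R) k (U : set V)
    (c : {linear V' -> W}) (f : V -> V') : continuous c -> open U ->
  Ck k U f -> Ck k U (fun x => c (f x)).
Proof.
move=> cc oU; elim: k f => [|k IH] f.
  by move=> cf x Ux; apply: continuous_comp; [exact: cf|exact: cc].
move=> [df ddf]; split=> [x Ux|v].
  by apply: differentiable_comp; [exact: df|exact: linear_differentiable].
apply: (@Ck_ext _ _ _ _ (fun x => c ('d f x v)) _ oU _ (IH _ (ddf v))) => x Ux.
have dc : differentiable c (f x) by exact: linear_differentiable.
have e := congr1 (fun h => h v) (@diff_comp _ _ _ _ f c x (df x Ux) dc).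
have e2 := congr1 (fun h => h ('d f x v)) (@diff_lin _ _ _ c (f x) cc).
exact: (esym (etrans e e2)).
Qed.

Lemma Ck_comp (V V' : normedModType R) k (U : set V) (U' : set V')
    (f : V -> V') (g : V' -> R) : has_coords V' -> open U ->
  (forall x, U x -> U' (f x)) -> Ck k U f -> Ck k U' g ->
  Ck k U (fun x => g (f x)).
Proof.
move=> [n [c [e [cc dec]]]] oU fU.
elim: k g => [|k IH] g hf hg.
  by move=> x Ux; apply: continuous_comp; [exact: hf|exact/hg/fU].
have [df ddf] := hf; have [dg ddg] := hg; split=> [x Ux|v].
  by apply: differentiable_comp; [exact: df|exact/dg/fU].
(* Regularity of ['d g] is known only in constant directions, so the moving direction ['d f x v] is
   expanded over the [e i]. *)
apply: (@Ck_ext _ _ _ _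
  (fun x => \sum_i c i ('d f x v) * 'd g (f x) (e i))) => // [x Ux|].
  have e1 := congr1 (fun h => h v)
    (@diff_comp _ _ _ _ f g x (df x Ux) (dg _ (fU x Ux))).
  apply: (etrans _ (esym e1)) => /=.
  rewrite [X in _ = 'd g (f x) X]dec linear_sum; apply: eq_bigr => i _.
  by rewrite linearZ.
apply: Ck_sum => // i.
apply: (@CkM _ _ _ (fun x => c i ('d f x v)) (fun x => 'd g (f x) (e i))) => //.
  exact: (@Ck_linear_comp _ _ _ k U (c i) (fun x => 'd f x v) (cc i) oU (ddf v)).
exact: (IH _ (CkS hf) (ddg (e i))).
Qed.

Lemma Ck_rV V n k (U : set V) (f : V -> 'rV[R]_n) : open U ->
  (forall i, Ck k U (fun x => f x ord0 i)) <-> Ck k U f.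
Proof.
move=> oU.
pose c (i : 'I_n) (v : 'rV[R]_n) : R := v ord0 i.
have lc i : linear (c i) by move=> a u v; rewrite /c !mxE.
pose cm i := GRing.isLinear.Build _ _ _ _ _ (lc i).
pose cl i : {linear _ -> _} := HB.pack (c i) (cm i).
have cc i : continuous (cl i) by exact: coord_continuous.
pose d (i : 'I_n) (a : R) : 'rV[R]_n := a *: delta_mx 0 i.
have ld i : linear (d i) by move=> a u v; rewrite /d scalerDl scalerA.
pose dm i := GRing.isLinear.Build _ _ _ _ _ (ld i).
pose dl i : {linear R -> 'rV[R]_n} := HB.pack (d i) (dm i).
have cd i : continuous (dl i) by exact: scalel_continuous.
split=> [h|h i]; last exact: (Ck_linear_comp (c := cl i)).
have S m (g : 'I_m -> V -> 'rV[R]_n) : (forall i, Ck k U (g i)) ->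
    Ck k U (fun x => \sum_i g i x).
  elim: m g => [|m IH] g hg.
    by rewrite (_ : (fun x => _) = (fun=> 0)); [exact: Ck_cst|
      apply/funext => x; rewrite big_ord0].
  rewrite (_ : (fun x => _) =
     (fun x => (\sum_(i < m) g (widen_ord (leqnSn m) i) x) + g ord_max x)).
    by apply: CkD => //; apply: IH.
  by apply/funext => x; rewrite big_ord_recr.
rewrite (_ : f = fun x => \sum_i dl i (f x ord0 i)).
  by apply: S => i; apply: (Ck_linear_comp (c := dl i)).
by apply/funext => x; rewrite [LHS]row_sum_delta.
Qed.

End CkCalculus.

(** * Germs of smooth functions and the elementary functions *)

Section SmoothGerms.
Variable R : realType.
Implicit Types V W : normedModType R.

(** A single neighbourhood serves all orders of differentiability. *)
Definition smat V W (x : V) (f : V -> W) := exists2 U, open U /\ U x & smooth_on U f.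

Lemma smooth_on_smat V W (U : set V) (f : V -> W) x :
  open U -> smooth_on U f -> U x -> smat x f.
Proof. by move=> oU sf Ux; exists U. Qed.

Lemma smat_near V W (f : V -> W) x : smat x f -> \forall y \near x, smat y f.
Proof.
move=> [U [oU Ux] sf]; near=> y; exists U => //; split=> //.
by near: y; exact: open_nbhs_nbhs.
Unshelve. all: by end_near. Qed.

Lemma smat_ext V W (f g : V -> W) x : (\near x, f x = g x) -> smat x f -> smat x g.
Proof.
move=> fg [U [oU Ux] sf]; exists (U `&` [set y | f y = g y]^°).
  by split; [apply: openI => //; exact: open_interior|split].
move=> k; apply: (@Ck_ext _ _ _ k _ f).
- by apply: openI => //; exact: open_interior.
- by move=> y [_ /interior_subset].
- by apply: (Ck_subset _ (sf k)) => y [].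
Qed.

Lemma smat_differentiable V W (f : V -> W) x : smat x f -> differentiable f x.
Proof. by move=> [U [oU Ux] /(_ 1%N)[df _]]; exact: df. Qed.

Lemma smat_continuous V W (f : V -> W) x : smat x f -> {for x, continuous f}.
Proof. by move=> /smat_differentiable; exact: differentiable_continuous. Qed.

Lemma smat_diff V W (f : V -> W) x v : smat x f -> smat x (fun y => 'd f y v).
Proof. by move=> [U oU sf]; exists U => // k; have [_] := sf k.+1; exact. Qed.

Lemma smat_cst V W (c : W) (x : V) : smat x (fun=> c).
Proof. by exists setT; [split => //; exact: openT|move=> k; exact: Ck_cst]. Qed.

Lemma smat_linear V W (f : {linear V -> W}) x : continuous f -> smat x f.
Proof.
by move=> cf; exists setT; [split => //; exact: openT|move=> k; exact: Ck_linear].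
Qed.

Lemma smatD V W (f g : V -> W) x : smat x f -> smat x g ->
  smat x (fun y => f y + g y).
Proof.
move=> [U [oU Ux] sf] [U' [oU' Ux'] sg]; have oI := openI oU oU'.
exists (U `&` U') => // k.
apply: (@CkD _ _ _ _ _ f g) => //.
- by apply: (Ck_subset _ (sf k)) => y [].
- by apply: (Ck_subset _ (sg k)) => y [].
Qed.

Lemma smatM V (f g : V -> R) x : smat x f -> smat x g ->
  smat x (fun y => f y * g y).
Proof.
move=> [U [oU Ux] sf] [U' [oU' Ux'] sg]; have oI := openI oU oU'.
exists (U `&` U') => // k.
apply: (@CkM _ _ _ _ f g) => //.
- by apply: (Ck_subset _ (sf k)) => y [].
- by apply: (Ck_subset _ (sg k)) => y [].
Qed.

Lemma smat_comp V V' (f : V -> V') (g : V' -> R) x : has_coords V' ->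
  smat x f -> smat (f x) g -> smat x (fun y => g (f y)).
Proof.
move=> cV sf' [U' [oU' Ux'] sg]; have cf := smat_continuous sf'.
have [U [oU Ux] sf] := sf'.
have nU : nbhs x (f @^-1` U') by apply: cf; exact: open_nbhs_nbhs.
exists (U `&` (f @^-1` U')^°).
  by split; [apply: openI => //; exact: open_interior|split].
move=> k; apply: (@Ck_comp _ _ _ _ _ U' f g) => //.
- by apply: openI => //; exact: open_interior.
- by move=> y [_ /interior_subset].
- by apply: (Ck_subset _ (sf k)) => y [].
Qed.

Lemma smatN V (f : V -> R) x : smat x f -> smat x (fun y => - f y).
Proof.
move=> sf; apply: (@smat_ext _ _ (fun y => -1 * f y)).
  by apply: nearW => y; rewrite mulN1r.
by apply: smatM => //; exact: smat_cst.
Qed.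

Lemma smatB V (f g : V -> R) x : smat x f -> smat x g ->
  smat x (fun y => f y - g y).
Proof. by move=> sf sg; apply: (@smatD _ _ f (fun y => - g y)) => //; exact: smatN. Qed.

Lemma smatX V (f : V -> R) n x : smat x f -> smat x (fun y => f y ^+ n).
Proof.
move=> sf; elim: n => [|n IH].
  apply: (@smat_ext V R (fun=> 1) _ x _ (@smat_cst V R 1 x)).
  by apply: nearW => y; rewrite expr0.
apply: (@smat_ext V R (fun y => f y * f y ^+ n) _ x _ (smatM sf IH)).
by apply: nearW => y; rewrite exprS.
Qed.

Lemma smat_rV V n (f : V -> 'rV[R]_n) x :
  smat x f <-> forall i, smat x (fun y => f y ord0 i).
Proof.
split=> [[U [oU Ux] sf] i|h].
  by exists U => // k; apply: (iffRL (Ck_rV k f oU)); exact: sf.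
pose U := [set y | forall i, smat y (fun y => f y ord0 i)]^°.
have oU : open U by exact: open_interior.
have Ux : U x.
  have : \forall y \near x, forall i, smat y (fun y => f y ord0 i).
    apply: (@filter_forall _ _ _ (nbhs x) _) => i; exact: smat_near.
  by [].
exists U => // k; apply/Ck_rV => // i.
have hU y : U y -> smat y (fun y => f y ord0 i) by move=> /interior_subset; exact.
elim: k (fun y => f y ord0 i) hU => [|k IH] g hg.
  by move=> y Uy; exact/smat_continuous/hg.
split=> [y Uy|v]; first exact/smat_differentiable/hg.
by apply: IH => y Uy; apply: smat_diff; exact: hg.
Qed.

Lemma smat_smooth_on V W (U : set V) (f : V -> W) :
  (forall x, U x -> smat x f) -> smooth_on U f.
Proof.
move=> hU k; elim: k f hU => [|k IH] g hg.
  by move=> y Uy; exact/smat_continuous/hg.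
split=> [y Uy|v]; first exact/smat_differentiable/hg.
by apply: IH => y Uy; apply: smat_diff; exact: hg.
Qed.

Lemma smat_comp_rV V V' n (f : V -> V') (g : V' -> 'rV[R]_n) x : has_coords V' ->
  smat x f -> smat (f x) g -> smat x (fun y => g (f y)).
Proof.
move=> cV sf /smat_rV sg; apply/smat_rV => i.
exact: (smat_comp (g := fun y => g y ord0 i)).
Qed.

Lemma smat_coord n (i : 'I_n) (x : 'rV[R]_n) : smat x (fun y : 'rV[R]_n => y ord0 i).
Proof.
have lc : linear (fun y : 'rV[R]_n => y ord0 i) by move=> a u v; rewrite !mxE.
pose cm := GRing.isLinear.Build _ _ _ _ _ lc.
pose cl : {linear _ -> _} := HB.pack (fun y : 'rV[R]_n => y ord0 i) cm.
by apply: (@smat_linear _ _ cl); exact: coord_continuous.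
Qed.

Lemma smat_id (x : R) : smat x (fun y : R => y).
Proof. by apply: (@smat_linear _ _ idfun) => y; exact: cvg_id. Qed.

Lemma diff_scale1 V (f : R -> V) x v : differentiable f x -> 'd f x v = v *: derive1 f x.
Proof. by move=> df; exact: (congr1 (fun h => h v) (diff1E df)). Qed.

Lemma Ck_scale V W (U : set V) k c (f : V -> W) : open U -> Ck k U f -> Ck k U (fun x => c *: f x).
Proof.
move=> oU cf; apply: (@Ck_linear_comp _ _ _ _ _ _ ( *:%R c) f) => //.
exact: scaler_continuous.
Qed.

Lemma Ck_derive1 V k (U : set R) (f : R -> V) : open U ->
  (forall x, U x -> derivable f x 1) -> Ck k U (derive1 f) -> Ck k.+1 U f.
Proof.
move=> oU df cf; split=> [x /df /derivable1_diffP //|v].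
apply: (@Ck_ext _ _ _ _ _ (fun x => v *: derive1 f x)) => // [x Ux|].
  by rewrite diff_scale1 //; apply/derivable1_diffP/df.
exact: Ck_scale.
Qed.

(** The induction treats all iterated derivatives at once, since class k+1 of the n-th one rests on
    class k of the next. *)
Lemma smooth_curve_on V (I : set R) (f : R -> V) : open I -> smooth_curve I f ->
  smooth_on I f.
Proof.
move=> oI sf k.
suff : forall n, Ck k I (iter_deriv n f) by move=> /(_ 0%N).
elim: k => [|k IH] n.
  move=> x Ix; apply/differentiable_continuous/derivable1_diffP; exact: sf.
apply: Ck_derive1 => //; first by move=> x /sf.
exact: (IH n.+1).
Qed.

Lemma smat_is_derive V (f : R -> V) x : smat x f -> is_derive x 1 f (derive1 f x).
Proof.
move=> /smat_differentiable /derivable1_diffP df; rewrite derive1E.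
exact: derivableP.
Qed.

Lemma smat_derive1 V (f : R -> V) x : smat x f -> smat x (derive1 f).
Proof.
move=> sf; apply: (@smat_ext R V (fun y => 'd f y 1) (derive1 f) x _ (@smat_diff R V f x 1 sf)).
apply: filterS (smat_near sf) => y sy.
by rewrite diff_scale1 ?scale1r //; exact: smat_differentiable.
Qed.

(** Bootstrapping as for a first-order differential equation: when the derivative is at least as
    regular as the function, every order yields the next. *)
Lemma smooth_on_derive1 (U : set R) (f df : R -> R) : open U ->
  (forall x, U x -> is_derive x 1 f (df x)) ->
  (forall k, Ck k U f -> Ck k U df) -> smooth_on U f.
Proof.
move=> oU hd ind; elim=> [|k IH].
  by move=> x /hd dfx; apply/differentiable_continuous/derivable1_diffP.
apply: Ck_derive1 => // [x /hd //|].
apply: (Ck_ext oU _ (ind k IH)) => x /hd h.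
by rewrite derive1E (@derive_val _ _ _ _ _ _ _ h).
Qed.

Lemma smooth_inv : smooth_on [set x : R | x != 0] (fun x => x^-1).
Proof.
have oU : open [set x : R | x != 0].
  have := @open_neq R 0; by [].
apply: (@smooth_on_derive1 _ _ (fun x => - (x^-1 * x^-1))) => // [x x0|k ck].
  have := @is_deriveV R id x 1 1 x0 _.
  move=> /(_ _); rewrite /=.
  move=> h; apply: is_derive_eq; rewrite [_ *: _]mulr1; congr (- _).
  by rewrite expr2 invfM.
apply: (@Ck_ext R R R k _ (fun x => (-1 : R) *: (x^-1 * x^-1))) => // [x _|].
  by rewrite [_ *: _]mulN1r.
apply: (@Ck_scale R R _ k (-1) (fun x : R => x^-1 * x^-1)) => //.
exact: (@CkM R R _ _ (fun x : R => x^-1) (fun x => x^-1)).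
Qed.

Lemma smatV V (f : V -> R) x : smat x f -> f x != 0 -> smat x (fun y => (f y)^-1).
Proof.
move=> sf fx; apply: (@smat_comp V R f (fun y => y^-1)) => //.
  exact: has_coords_R.
have o0 : open [set x : R | x != 0] by have := @open_neq R 0.
exact: (@smooth_on_smat R R [set x : R | x != 0] _ _ o0 smooth_inv).
Qed.

Lemma smat_div V (f g : V -> R) x : smat x f -> smat x g -> g x != 0 ->
  smat x (fun y => f y / g y).
Proof. by move=> sf sg gx; apply: (@smatM V f (fun y => (g y)^-1)) => //; exact: smatV. Qed.

Lemma smooth_expR : smooth_on setT (@expR R).
Proof.
exact: (@smooth_on_derive1 _ _ expR openT (fun x _ => is_derive_expR x) (fun _ h => h)).
Qed.

Lemma smooth_ln : smooth_on [set x : R | 0 < x] (@ln R).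
Proof.
have o0 : open [set x : R | 0 < x] by exact: (@open_gt R 0).
apply: (@smooth_on_derive1 _ _ (fun x => x^-1)) => // k _.
by apply: Ck_subset (smooth_inv k) => x /=; case: ltgtP.
Qed.

(** On the positive axis the root is [expR (ln x / 2)]. *)
Lemma smooth_sqrt : smooth_on [set x : R | 0 < x] (@Num.sqrt R).
Proof.
have o0 : open [set x : R | 0 < x] by exact: (@open_gt R 0).
have h (x : R) : 0 < x -> expR (ln x / 2) = Num.sqrt x.
  move=> x0; have e0 : 0 <= expR (ln x / 2) by exact: expR_ge0.
  rewrite -[LHS]ger0_norm // -sqrtr_sqr -expRM_natl.
  by congr Num.sqrt; rewrite mulrC divfK ?lnK // pnatr_eq0.
apply: smat_smooth_on => x x0.
apply: (@smat_ext R R (fun x => expR (ln x / 2)) _ x).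
  near=> y; apply: h; near: y; exact: open_nbhs_nbhs.
apply: (@smat_comp R R (fun x => ln x / 2) expR); first exact: has_coords_R.
  apply: (@smatM R (@ln R) (fun=> 2^-1)); last exact: smat_cst.
  exact: (smooth_on_smat o0 smooth_ln).
exact: (smooth_on_smat openT smooth_expR).
Unshelve. all: by end_near. Qed.

Lemma smat_sqrt V (f : V -> R) x : smat x f -> 0 < f x -> smat x (fun y => Num.sqrt (f y)).
Proof.
move=> sf fx; apply: (@smat_comp V R f Num.sqrt) => //; first exact: has_coords_R.
exact: (smooth_on_smat (@open_gt R 0) smooth_sqrt).
Qed.

Lemma smat_ln V (f : V -> R) x : smat x f -> 0 < f x -> smat x (fun y => ln (f y)).
Proof.
move=> sf fx; apply: (@smat_comp V R f (@ln R)) => //; first exact: has_coords_R.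
exact: (smooth_on_smat (@open_gt R 0) smooth_ln).
Qed.

Lemma smat_expR V (f : V -> R) x : smat x f -> smat x (fun y => expR (f y)).
Proof.
move=> sf; apply: (@smat_comp V R f (@expR R)) => //; first exact: has_coords_R.
exact: (smooth_on_smat openT smooth_expR).
Qed.

Lemma smat_sum V n (f : 'I_n -> V -> R) x : (forall i, smat x (f i)) ->
  smat x (fun y => \sum_i f i y).
Proof.
elim: n f => [|n IH] f hf.
  by rewrite (_ : (fun x => _) = (fun=> 0)); [exact: smat_cst|
    apply/funext => y; rewrite big_ord0].
rewrite (_ : (fun x => _) =
   (fun x => (\sum_(i < n) f (widen_ord (leqnSn n) i) x) + f ord_max x)).
  by apply: smatD => //; apply: IH.
by apply/funext => y; rewrite big_ord_recr.
Qed.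

End SmoothGerms.

(** * Functions of two variables *)

Section OneVariable.
Variable R : realType.

Lemma is_derive_bound (f : R -> R) (a L : R) :
  (forall e, 0 < e -> exists2 d, 0 < d & forall t, `|t - a| < d ->
     `|f t - f a - L * (t - a)| <= e * `|t - a|) ->
  is_derive a 1 f L.
Proof.
move=> H; have c : h^-1 *: (f (h *: 1 + a) - f a) @[h --> 0^'] --> L.
  apply/cvgrPdist_le => e e0; have [d d0 hd] := H e e0.
  near=> h; have h0 : h != 0 by near: h; exact: nbhs_dnbhs_neq.
  have hd' : `|h + a - a| < d.
    by rewrite addrK; near: h; exact: dnbhs0_lt.
  have := hd _ hd'; rewrite addrK => hh.
  rewrite [h *: 1]mulr1 [_ *: _]mulrC.
  have -> : L - (f (h + a) - f a) / h = - ((f (h + a) - f a - L * h) / h).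
    by field.
  by rewrite normrN normrM normfV ler_pdivrMr ?normr_gt0.
apply: DeriveDef; first by apply/cvg_ex; exists L.
exact: cvg_lim c.
Unshelve. all: by end_near. Qed.

(** At the endpoint [a] only continuity is required, not a derivative. This makes it possible to
    compute a derivative at [a] as a limit of derivatives. *)
Lemma mvt_ineq (f df : R -> R) (a b L e : R) :
  (forall t, 0 < `|t - a| -> `|t - a| < `|b - a| -> is_derive t 1 f (df t) /\ `|df t - L| <= e) ->
  (forall t, `|t - a| <= `|b - a| -> {for t, continuous f}) ->
  `|f b - f a - L * (b - a)| <= e * `|b - a|.
Proof.
move=> hd hc.
have [ab|ba|->] := ltgtP a b; last by rewrite !subrr mulr0 subr0 normr0 mulr0.
- have e0 : `|b - a| = b - a by rewrite gtr0_norm // subr_gt0.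
  have [||c] := @MVT R f df a b ab.
  + move=> t; rewrite in_itv /= => /andP[t1 t2].
    have et : `|t - a| = t - a by rewrite gtr0_norm // subr_gt0.
    by have [||//] := hd t; rewrite ?et ?e0; lra.
  + apply: continuous_in_subspaceT => t; rewrite inE /= in_itv /= => /andP[t1 t2].
    by apply: hc; rewrite e0 ger0_norm; lra.
  + rewrite in_itv /= => /andP[t1 t2] ->.
    have et : `|c - a| = c - a by rewrite gtr0_norm // subr_gt0.
    have [||_ h] := hd c; rewrite ?et ?e0; try lra.
    by rewrite -mulrBl normrM e0 ler_pM2r // subr_gt0.
- have e0 : `|b - a| = a - b by rewrite ltr0_norm; lra.
  have [||c] := @MVT R f df b a ba.
  + move=> t; rewrite in_itv /= => /andP[t1 t2].
    have et : `|t - a| = a - t by rewrite ltr0_norm; lra.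
    by have [||//] := hd t; rewrite ?et ?e0; lra.
  + apply: continuous_in_subspaceT => t; rewrite inE /= in_itv /= => /andP[t1 t2].
    by apply: hc; rewrite e0 ler0_norm; lra.
  + rewrite in_itv /= => /andP[t1 t2] ec.
    have et : `|c - a| = a - c by rewrite ltr0_norm; lra.
    have [||_ h] := hd c; rewrite ?et ?e0; try lra.
    have -> : f b - f a - L * (b - a) = - ((df c - L) * (a - b)) by rewrite mulrBl -ec; ring.
    rewrite normrN normrM [`|a - b|]gtr0_norm ?ler_pM2r // subr_gt0 //.
Qed.

End OneVariable.

(** * Differentiability from continuous partial derivatives *)

Section TwoVariables.
Variable R : realType.
Local Notation P := 'rV[R]_2.

Lemma cu_rv2 (u v : R) : cu (rv2 u v) = u.
Proof. by rewrite /cu mxE. Qed.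

Lemma cv_rv2 (u v : R) : cv (rv2 u v) = v.
Proof. by rewrite /cv mxE /= inordK. Qed.

Lemma rv2K (x : P) : rv2 (cu x) (cv x) = x.
Proof.
apply/rowP => i; rewrite mxE /cu /cv; case: (boolP (val i == 0%N)) => h.
  by congr (x _ _); apply: val_inj; rewrite /= (eqP h).
congr (x _ _); apply: val_inj; rewrite /= inordK //.
by case: i h => [[|[|]]].
Qed.

Lemma smat_cu x : smat x (@cu R).
Proof. exact: smat_coord. Qed.

Lemma smat_cv x : smat x (@cv R).
Proof. exact: smat_coord. Qed.

Lemma smat_rv2 (V : normedModType R) (f g : V -> R) x : smat x f -> smat x g ->
  smat x (fun y => rv2 (f y) (g y)).
Proof.
move=> sf sg; apply/smat_rV => i.
rewrite (_ : (fun y => _) = if val i == 0%N then f else g); first by case: ifP.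
by apply/funext => y; rewrite mxE; case: ifP.
Qed.

Lemma norm_rv2 (x : P) : `|x| = Num.max `|cu x| `|cv x|.
Proof.
rewrite [LHS]/Num.Def.normr /= mx_normrE; apply/eqP; rewrite eq_le; apply/andP; split.
  apply: bigmax_le => [|[i j] _ /=]; first by rewrite le_max normr_ge0.
  rewrite (ord1 i) -{1}(rv2K x) mxE le_max.
  by case: ifP => _; rewrite lexx ?orbT.
rewrite ge_max; apply/andP; split.
  exact: (@le_bigmax _ _ _ 0 (fun i => `|x i.1 i.2|) (ord0, ord0)).
exact: (@le_bigmax _ _ _ 0 (fun i => `|x i.1 i.2|) (ord0, inord 1)).
Qed.

Lemma nbhs2P (x : P) (A : set P) : nbhs x A <->
  exists2 e, 0 < e & forall y, `|cu y - cu x| < e -> `|cv y - cv x| < e -> A y.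
Proof.
have E (y : P) e : ball x e y <-> `|cu y - cu x| < e /\ `|cv y - cv x| < e.
  rewrite -ball_normE /ball_ /= norm_rv2 gt_max.
  rewrite (_ : cu (x - y) = cu x - cu y); last by rewrite /cu !mxE.
  rewrite (_ : cv (x - y) = cv x - cv y); last by rewrite /cv !mxE.
  by rewrite distrC [`|cv x - _|]distrC; split=> [/andP//|[-> ->]].
split=> [/nbhs_ballP[e e0 h]|[e e0 h]].
  by exists e => // y h1 h2; apply: h; apply/E.
by apply/nbhs_ballP; exists e => // y /E[]; exact: h.
Qed.

Lemma cvg2P (x : P) (f : P -> R) : {for x, continuous f} <->
  forall d, 0 < d -> exists2 e, 0 < e & forall y, `|cu y - cu x| < e -> `|cv y - cv x| < e ->
    `|f y - f x| <= d.
Proof.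
split=> [h d d0|h].
  have /cvgrPdist_le/(_ d d0)/nbhs2P[e e0 he] := h.
  by exists e => // y h1 h2; rewrite distrC; exact: he.
change (f @ x --> f x); apply/(@cvgrPdist_le _ _ _ (nbhs x)) => d d0; apply/nbhs2P.
by have [e e0 he] := h d d0; exists e => // y h1 h2; rewrite distrC; exact: he.
Qed.

(** One-variable derivatives along the two coordinate lines; differentiability in the plane is not
    presupposed, unlike for [pd0] and [pd1]. *)
Definition has_partials (f : P -> R) (x : P) (a b : R) :=
  is_derive (cu x) 1 (fun u => f (rv2 u (cv x))) a /\
  is_derive (cv x) 1 (fun v => f (rv2 (cu x) v)) b.

Definition pd0 (f : P -> R) (x : P) : R := 'd f x (rv2 1 0).
Definition pd1 (f : P -> R) (x : P) : R := 'd f x (rv2 0 1).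

Lemma is_derive_line (f : P -> R) (x v : P) (g : R -> P) (a : R) :
  (forall h, g (h + a) = h *: v + x) -> differentiable f x ->
  is_derive a 1 (fun t => f (g t)) ('d f x v).
Proof.
move=> hg df; have dv : derivable f x v by exact: diff_derivable.
have gx : g a = x by rewrite -[a]add0r hg scale0r add0r.
rewrite -(deriveE v df).
have E : (fun h : R => h^-1 *: (f (g (h *: 1 + a)) - f (g a))) =
         (fun h => h^-1 *: (f (h *: v + x) - f x)).
  by apply/funext => h; rewrite [h *: 1]mulr1 hg gx.
by apply: DeriveDef; rewrite ?/derivable ?/derive /= E.
Qed.

Lemma smat_partials (f : P -> R) x : smat x f -> has_partials f x (pd0 f x) (pd1 f x).
Proof.
move=> /smat_differentiable df; split; apply: is_derive_line => // h;
  rewrite -[X in _ = _ + X](rv2K x); apply/rowP => i; rewrite !mxE; case: ifP => _;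
  by rewrite ?mulr1 ?mulr0 ?add0r.
Qed.

(** The increment is split along a horizontal and a vertical segment; the mean value inequality on
    each leaves an error of at most half of [e] times the norm. *)
Lemma has_partials_differentiable (U : set P) (f g0 g1 : P -> R) : open U ->
  (forall x, U x -> has_partials f x (g0 x) (g1 x)) ->
  (forall x, U x -> {for x, continuous g0}) ->
  (forall x, U x -> {for x, continuous g1}) ->
  forall x, U x -> differentiable f x /\ forall v, 'd f x v = cu v * g0 x + cv v * g1 x.
Proof.
move=> oU hp c0 c1 x Ux.
pose L (v : P) : R := cu v * g0 x + cv v * g1 x.
have lL : linear L.
  move=> a u v; rewrite /L /cu /cv !mxE.
  rewrite -[a *: (_ + _)]/(a * (_ + _)); ring.
pose Lm := GRing.isLinear.Build _ _ _ _ _ lL.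
pose Ll : {linear P -> R} := HB.pack L Lm.
have cL : continuous Ll.
  move=> y; apply: (@smat_continuous R P R L).
  apply: (@smatD R P R (fun v => cu v * g0 x) (fun v => cv v * g1 x)).
    exact: (@smatM R P (@cu R) (fun=> g0 x) y (smat_cu y) (smat_cst _ _)).
  exact: (@smatM R P (@cv R) (fun=> g1 x) y (smat_cv y) (smat_cst _ _)).
have [] := @diff_of_bound R P R f Ll x cL; last first.
  by move=> df E; split=> // v; exact: (congr1 (fun k => k v) E).
  move=> e e0.
  have e2 : 0 < e / 2 by lra.
  have /nbhs2P[d1 d10 hd1] : nbhs x U by exact: open_nbhs_nbhs.
  have [d2 d20 hd2] := (iffLR (cvg2P x g0)) (c0 x Ux) _ e2.
  have [d3 d30 hd3] := (iffLR (cvg2P x g1)) (c1 x Ux) _ e2.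
  apply/nbhs2P; exists (Num.min d1 (Num.min d2 d3)).
    by rewrite !lt_min d10 d20 d30.
  have cu0 : cu (0 : P) = 0 by rewrite /cu mxE.
  have cv0 : cv (0 : P) = 0 by rewrite /cv mxE.
  move=> y; rewrite cu0 cv0 !subr0 !lt_min => /and3P[u1 u2 u3] /and3P[v1 v2 v3].
  rewrite /= /L.
  pose X := cu x; pose Y := cv x.
  have inU u v : `|u - X| < d1 -> `|v - Y| < d1 -> U (rv2 u v).
    by move=> *; apply: hd1; rewrite ?cu_rv2 ?cv_rv2.
  have d12 : `|f (rv2 (X + cu y) (Y + cv y)) - f (rv2 X (Y + cv y)) - g0 x * (X + cu y - X)|
     <= e / 2 * `|X + cu y - X|.
    apply: (@mvt_ineq _ (fun u => f (rv2 u (Y + cv y))) (fun u => g0 (rv2 u (Y + cv y)))).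
      move=> t _; rewrite addrAC subrr add0r => t1.
      have Ut : U (rv2 t (Y + cv y)).
        by apply: inU; [lra|rewrite addrAC subrr add0r].
      split; first by have [] := hp _ Ut; rewrite cu_rv2 cv_rv2.
      by apply: hd2; rewrite ?cu_rv2 ?cv_rv2; [lra|rewrite addrAC subrr add0r].
    move=> t; rewrite addrAC subrr add0r => t1.
    have Ut : U (rv2 t (Y + cv y)).
      by apply: inU; [lra|rewrite addrAC subrr add0r].
    apply/differentiable_continuous/derivable1_diffP.
    by have [[]] := hp _ Ut; rewrite cu_rv2 cv_rv2.
  have d13 : `|f (rv2 X (Y + cv y)) - f (rv2 X Y) - g1 x * (Y + cv y - Y)|
     <= e / 2 * `|Y + cv y - Y|.
    apply: (@mvt_ineq _ (fun v => f (rv2 X v)) (fun v => g1 (rv2 X v))).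
      move=> t _; rewrite addrAC subrr add0r => t1.
      have Ut : U (rv2 X t) by apply: inU; rewrite ?subrr ?normr0 //; lra.
      split; first by have [_] := hp _ Ut; rewrite cu_rv2 cv_rv2.
      by apply: hd3; rewrite ?cu_rv2 ?cv_rv2 ?subrr ?normr0 //; lra.
    move=> t; rewrite addrAC subrr add0r => t1.
    have Ut : U (rv2 X t) by apply: inU; rewrite ?subrr ?normr0 //; lra.
    apply/differentiable_continuous/derivable1_diffP.
    by have [_ []] := hp _ Ut; rewrite cu_rv2 cv_rv2.
  have -> : y + x = rv2 (X + cu y) (Y + cv y).
    by rewrite -[LHS]rv2K; congr rv2; rewrite /X /Y /cu /cv mxE addrC.
  have -> : f x = f (rv2 X Y) by rewrite rv2K.
  have eX : X + cu y - X = cu y by ring.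
  have eY : Y + cv y - Y = cv y by ring.
  rewrite eX in d12; rewrite eY in d13.
  have nu : `|cu y| <= `|y| by rewrite norm_rv2 le_max lexx.
  have nv : `|cv y| <= `|y| by rewrite norm_rv2 le_max lexx orbT.
  set A := f (rv2 (X + _) _) in d12 *; set B := f (rv2 X (Y + _)) in d12 d13.
  have -> : A - (f (rv2 X Y) + (cu y * g0 x + cv y * g1 x)) =
    (A - B - g0 x * cu y) + (B - f (rv2 X Y) - g1 x * cv y) by ring.
  apply: (le_trans (ler_normD _ _)); apply: (le_trans (lerD d12 d13)).
  have := ler_wpM2l (ltW e2) nu; have := ler_wpM2l (ltW e2) nv; lra.
Qed.

Lemma Ck_partials k (U : set P) (f g0 g1 : P -> R) : open U ->
  (forall x, U x -> has_partials f x (g0 x) (g1 x)) ->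
  Ck k U g0 -> Ck k U g1 -> Ck k.+1 U f.
Proof.
move=> oU hp C0 C1.
have Ck0 (g : P -> R) : Ck k U g -> forall x, U x -> {for x, continuous g}.
  by elim: (k) => [//|n IH] h; apply/IH/CkS.
have H := has_partials_differentiable oU hp (Ck0 _ C0) (Ck0 _ C1).
split=> [x /H[] //|v].
apply: (@Ck_ext R P R k U (fun x => cu v *: g0 x + cv v *: g1 x)) => //.
  by move=> x /H[_ ->].
apply: (@CkD R P R k U (fun x => cu v *: g0 x) (fun x => cv v *: g1 x)) => //;
exact: Ck_scale.
Qed.

(** One application of the closure property gains one order and leads back into the class, so no
    higher derivative has to be computed: it suffices to find a family of continuous formulas stable
    under both partial derivatives. *)
Lemma smooth_coind (U : set P) (C : (P -> R) -> Prop) : open U ->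
  (forall f, C f -> forall x, U x -> {for x, continuous f}) ->
  (forall f, C f -> exists g0 g1, [/\ C g0, C g1 &
     forall x, U x -> has_partials f x (g0 x) (g1 x)]) ->
  forall f, C f -> smooth_on U f.
Proof.
move=> oU cont step f Cf k; elim: k f Cf => [|k IH] f Cf; first exact: cont.
have [g0 [g1 [C0 C1 h]]] := step f Cf.
exact: (Ck_partials oU h (IH _ C0) (IH _ C1)).
Qed.

End TwoVariables.

(** * Partial derivatives across a line, and their symmetry *)

Section Glue.
Variable R : realType.
Local Notation P := 'rV[R]_2.

Lemma is_derive_boundP (f : R -> R) (a L : R) : is_derive a 1 f L ->
  forall e, 0 < e -> exists2 d, 0 < d & forall t, `|t - a| < d ->
     `|f t - f a - L * (t - a)| <= e * `|t - a|.
Proof.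
move=> df e e0; have [dfa dfL] := df.
have c : h^-1 *: (f (h *: 1 + a) - f a) @[h --> 0^'] --> L.
  by rewrite -dfL; exact: dfa.
have /cvgrPdist_le/(_ e e0) := c.
case/nbhs_ballP => d d0 hd; exists d => // t td.
have [->|ta] := eqVneq t a; first by rewrite !subrr mulr0 subr0 normr0 mulr0.
have ta0 : t - a != 0 by rewrite subr_eq0.
have := hd (t - a); rewrite /= /ball /= sub0r normrN => /(_ td ta0).
rewrite [_ *: 1]mulr1 [_ *: _]mulrC subrK => h.
have -> : f t - f a - L * (t - a) = - ((L - (f t - f a) / (t - a)) * (t - a)).
  by field.
by rewrite normrN normrM ler_wpM2r.
Qed.

Lemma smat_pd0 (f : P -> R) x : smat x f -> smat x (pd0 f).
Proof. exact: smat_diff. Qed.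

Lemma smat_pd1 (f : P -> R) x : smat x f -> smat x (pd1 f).
Proof. exact: smat_diff. Qed.

Lemma is_derive_pd0 (f : P -> R) u v : smat (rv2 u v) f ->
  is_derive u 1 (fun u => f (rv2 u v)) (pd0 f (rv2 u v)).
Proof. by move=> /smat_partials[]; rewrite cu_rv2 cv_rv2. Qed.

Lemma is_derive_pd1 (f : P -> R) u v : smat (rv2 u v) f ->
  is_derive v 1 (fun v => f (rv2 u v)) (pd1 f (rv2 u v)).
Proof. by move=> /smat_partials[]; rewrite cu_rv2 cv_rv2. Qed.

Lemma is_derive_continuous (f : R -> R) (a L : R) : is_derive a 1 f L -> {for a, continuous f}.
Proof. by move=> [df _]; apply/differentiable_continuous/derivable1_diffP. Qed.

Lemma is_derive_uniq (f : R -> R) (a L L' : R) :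
  is_derive a 1 f L -> is_derive a 1 f L' -> L = L'.
Proof. by move=> [_ <-] [_ <-]. Qed.

(* The line [cv x = b] is removable: partial derivatives off it that extend
   continuously are partial derivatives on it. *)
Lemma has_partials_glue (U : set P) (f g0 g1 : P -> R) (b : R) : open U ->
  (forall x, U x -> {for x, continuous f}) ->
  (forall x, U x -> {for x, continuous g0}) ->
  (forall x, U x -> {for x, continuous g1}) ->
  (forall x, U x -> cv x != b -> has_partials f x (g0 x) (g1 x)) ->
  forall x, U x -> has_partials f x (g0 x) (g1 x).
Proof.
move=> oU cf c0 c1 hp x Ux.
have [xb|] := eqVneq (cv x) b; last exact: hp.
have /nbhs2P[d1 d10 hd1] : nbhs x U by exact: open_nbhs_nbhs.
rewrite /has_partials; set X := cu x; rewrite xb.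
have Ex : x = rv2 X b by rewrite -xb rv2K.
have inU u v : `|u - X| < d1 -> `|v - b| < d1 -> U (rv2 u v).
  by move=> *; apply: hd1; rewrite ?cu_rv2 ?cv_rv2 ?xb.
split.
- apply: is_derive_bound => e e0.
  have [d2 d20 hd2] := (iffLR (cvg2P x g0)) (c0 x Ux) _ e0.
  exists (Num.min d1 d2); first by rewrite lt_min d10.
  move=> t; rewrite lt_min => /andP[t1 t2].
  (* No derivative is known on the line itself. The horizontal segment is moved to a nearby height
     [v] off the line, and continuity of [f] bounds the cost at both ends by the arbitrary [eta]. *)
  apply/ler_addgt0Pr => eta eta0.
  have eta2 : 0 < eta / 2 by lra.
  have Ut : U (rv2 t b) by apply: inU => //; rewrite subrr normr0.
  have [d3 d30 hd3] := (iffLR (cvg2P _ f)) (cf _ Ut) _ eta2.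
  have [d4 d40 hd4] := (iffLR (cvg2P _ f)) (cf _ Ux) _ eta2.
  pose d := Num.min (Num.min d1 d2) (Num.min d3 d4).
  have d0 : 0 < d by rewrite !lt_min d10 d20 d30.
  pose v := b + d / 2.
  have vb : `|v - b| < d by rewrite /v addrAC subrr add0r gtr0_norm; lra.
  have [[v1 v2] [v3 v4]] : (`|v - b| < d1 /\ `|v - b| < d2) /\ (`|v - b| < d3 /\ `|v - b| < d4).
    by move: vb; rewrite !lt_min => /andP[/andP[? ?] /andP[? ?]].
  have vn : v != b by rewrite /v; apply/eqP => ?; lra.
  have M : `|f (rv2 t v) - f (rv2 X v) - g0 x * (t - X)| <= e * `|t - X|.
    apply: (@mvt_ineq _ (fun u => f (rv2 u v)) (fun u => g0 (rv2 u v))).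
      move=> s _ s1; have Us : U (rv2 s v) by apply: inU => //; exact: lt_trans s1 t1.
      split; first by have [] := hp _ Us; rewrite ?cu_rv2 ?cv_rv2.
      by apply: hd2; rewrite ?cu_rv2 ?cv_rv2 ?xb //; exact: lt_trans s1 t2.
    move=> s s1; have Us : U (rv2 s v) by apply: inU => //; exact: le_lt_trans s1 t1.
    by apply: is_derive_continuous; have [] := hp _ Us; rewrite ?cu_rv2 ?cv_rv2.
  have h3 : `|f (rv2 t v) - f (rv2 t b)| <= eta / 2.
    by apply: hd3; rewrite ?cu_rv2 ?cv_rv2 // subrr normr0.
  have h4 : `|f (rv2 X v) - f (rv2 X b)| <= eta / 2.
    by rewrite -Ex; apply: hd4; rewrite ?cu_rv2 ?cv_rv2 ?xb // subrr normr0.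
  have -> : f (rv2 t b) - f (rv2 X b) - g0 x * (t - X) =
    (f (rv2 t v) - f (rv2 X v) - g0 x * (t - X)) - (f (rv2 t v) - f (rv2 t b)) +
      (f (rv2 X v) - f (rv2 X b)) by ring.
  apply: (le_trans (ler_normD _ _)); apply: (le_trans (lerD (ler_normB _ _) h4)).
  by lra.
- apply: is_derive_bound => e e0.
  have [d2 d20 hd2] := (iffLR (cvg2P x g1)) (c1 x Ux) _ e0.
  exists (Num.min d1 d2); first by rewrite lt_min d10.
  move=> t; rewrite lt_min => /andP[t1 t2].
  apply: (@mvt_ineq _ (fun v => f (rv2 X v)) (fun v => g1 (rv2 X v))).
    move=> s s0 s1; have Us : U (rv2 X s).
      by apply: inU; rewrite ?subrr ?normr0 //; lra.
    have sb : s != b by rewrite -subr_eq0 -normr_gt0.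
    split; first by have [] := hp _ Us; rewrite ?cu_rv2 ?cv_rv2.
    by apply: hd2; rewrite ?cu_rv2 ?cv_rv2 ?xb ?subrr ?normr0 //; lra.
  move=> s s1; have Us : U (rv2 X s).
    by apply: inU; rewrite ?subrr ?normr0 //; lra.
  have cl : {for s, continuous (fun v => rv2 X v)}.
    apply: (@smat_continuous R R P).
    by apply: smat_rv2; [exact: smat_cst|exact: smat_id].
  exact: (@continuous_comp _ _ _ (fun v => rv2 X v) f s cl (cf _ Us)).
Qed.

Lemma smat_box (f : P -> R) x : smat x f -> exists2 d, 0 < d &
  forall u v, `|u - cu x| < d -> `|v - cv x| < d -> smat (rv2 u v) f.
Proof.
move=> /smat_near/nbhs2P[d d0 hd]; exists d => // u v hu hv.
by apply: hd; rewrite ?cu_rv2 ?cv_rv2.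
Qed.

(** The second difference of [f] over a rectangle is estimated in two ways: by the mean value
    inequality in u and then in v it is close to [L] times the area, and by the definition of
    [pd1 f] on the two vertical sides it is close to a difference of values of [pd1 f] times the
    height. The height then tends to 0 for a fixed width. *)
Lemma pd_comm (f : P -> R) x : smat x f -> pd0 (pd1 f) x = pd1 (pd0 f) x.
Proof.
have id1 (a b c d p q l y z : R) : (p - q - l * z) * y =
   ((a - b) - (c - d) - l * y * z) - (a - b - p * y) + (c - d - q * y) by ring.
move=> sf; have [d1 d10 hd1] := smat_box sf.
set X := cu x in hd1 *; set Y := cv x in hd1 *.
have Ex : x = rv2 X Y by rewrite rv2K.
have sx : smat (rv2 X Y) f by rewrite -Ex.
have D1 : is_derive X 1 (fun u => pd1 f (rv2 u Y)) (pd0 (pd1 f) x).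
  by rewrite Ex; apply: is_derive_pd0; exact: smat_pd1.
apply: is_derive_uniq D1 _.
apply: is_derive_bound => e e0; set L := pd1 (pd0 f) x.
have [d2 d20 hd2] := (iffLR (cvg2P x _)) (smat_continuous (smat_pd1 (smat_pd0 sf))) _ e0.
exists (Num.min d1 d2); first by rewrite lt_min d10.
move=> t; rewrite lt_min => /andP[t1 t2].
apply/ler_addgt0Pr => eta eta0.
have eta2 : 0 < eta / 2 by lra.
have sY : `|Y - Y| < d1 by rewrite subrr normr0.
have sX : `|X - X| < d1 by rewrite subrr normr0.
have [d3 d30 hd3] := is_derive_boundP (is_derive_pd1 (hd1 t Y t1 sY)) eta2.
have [d4 d40 hd4] := is_derive_boundP (is_derive_pd1 sx) eta2.
pose d := Num.min (Num.min d1 d2) (Num.min d3 d4).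
have d0 : 0 < d by rewrite !lt_min d10 d20 d30.
pose v := Y + d / 2.
have evb : v - Y = d / 2 by rewrite /v addrAC subrr add0r.
have vb : `|v - Y| < d by rewrite evb gtr0_norm; lra.
have vn : `|v - Y| = d / 2 by rewrite evb gtr0_norm; lra.
have [[v1 v2] [v3 v4]] : (`|v - Y| < d1 /\ `|v - Y| < d2) /\ (`|v - Y| < d3 /\ `|v - Y| < d4).
  by move: vb; rewrite !lt_min => /andP[/andP[? ?] /andP[? ?]].
have M : `|(f (rv2 t v) - f (rv2 t Y)) - (f (rv2 X v) - f (rv2 X Y)) - L * (v - Y) * (t - X)|
     <= e * `|v - Y| * `|t - X|.
  apply: (@mvt_ineq _ (fun u => f (rv2 u v) - f (rv2 u Y))
     (fun u => pd0 f (rv2 u v) - pd0 f (rv2 u Y))).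
    move=> s _ s1; have ss : `|s - X| < d1 by exact: lt_trans s1 t1.
    split; first exact: is_deriveB (is_derive_pd0 (hd1 s v ss v1)) (is_derive_pd0 (hd1 s Y ss sY)).
    apply: (@mvt_ineq _ (fun w => pd0 f (rv2 s w)) (fun w => pd1 (pd0 f) (rv2 s w))).
      move=> w _ w1; split.
        by apply/is_derive_pd1/smat_pd0/hd1 => //; exact: lt_trans w1 v1.
      apply: hd2; rewrite ?cu_rv2 ?cv_rv2 // -/X -/Y; last exact: lt_trans w1 v2.
      exact: lt_trans s1 t2.
    move=> w w1; apply: (is_derive_continuous (L := pd1 (pd0 f) (rv2 s w))).
    by apply/is_derive_pd1/smat_pd0/hd1 => //; exact: le_lt_trans w1 v1.
  move=> s s1; have ss : `|s - X| < d1 by exact: le_lt_trans s1 t1.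
  apply: is_derive_continuous.
  exact: is_deriveB (is_derive_pd0 (hd1 s v ss v1)) (is_derive_pd0 (hd1 s Y ss sY)).
have {}hd3 := hd3 v v3; have {}hd4 := hd4 v v4.
have vp : 0 < `|v - Y| by rewrite vn divr_gt0.
rewrite -(ler_pM2r vp) -normrM.
set A := pd1 f (rv2 t Y) in hd3 *; set B := pd1 f (rv2 X Y) in hd4 *.
rewrite (id1 (f (rv2 t v)) (f (rv2 t Y)) (f (rv2 X v)) (f (rv2 X Y))).
have T3 (a b c : R) : `|a - b + c| <= `|a| + `|b| + `|c|.
  by apply: (le_trans (ler_normD _ _)); rewrite lerD2r ler_normB.
apply: (le_trans (T3 _ _ _)).
apply: (le_trans (lerD (lerD M hd3) hd4)).
have id2 (p y : R) : e * y * p + eta / 2 * y + eta / 2 * y = (e * p + eta) * y by field.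
by rewrite id2.
Qed.

End Glue.

(** * Rules for one-variable derivatives *)

Section DeriveRules.
Variable R : realType.
Implicit Types (f g : R -> R) (t a b c : R).

Lemma der_eq f t a b : is_derive t 1 f a -> a = b -> is_derive t 1 f b.
Proof. by move=> h <-. Qed.

Lemma derD f g t a b : is_derive t 1 f a -> is_derive t 1 g b ->
  is_derive t 1 (fun s => f s + g s) (a + b).
Proof. by move=> h1 h2; exact: is_deriveD. Qed.

Lemma derB f g t a b : is_derive t 1 f a -> is_derive t 1 g b ->
  is_derive t 1 (fun s => f s - g s) (a - b).
Proof. by move=> h1 h2; exact: is_deriveB. Qed.

Lemma derN f t a : is_derive t 1 f a -> is_derive t 1 (fun s => - f s) (- a).
Proof. by move=> h1; exact: is_deriveN. Qed.

Lemma derM f g t a b : is_derive t 1 f a -> is_derive t 1 g b ->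
  is_derive t 1 (fun s => f s * g s) (f t * b + g t * a).
Proof. by move=> h1 h2; exact: is_deriveM. Qed.

Lemma der_cst (c t : R) : is_derive t 1 (fun _ : R => c) 0.
Proof. exact: is_derive_cst. Qed.

Lemma der_id (t : R) : is_derive t 1 (fun s : R => s) 1.
Proof. exact: is_derive_id. Qed.

Lemma derZ c f t a : is_derive t 1 f a -> is_derive t 1 (fun s => c * f s) (c * a).
Proof. by move=> h; apply: der_eq (derM (der_cst c t) h) _; rewrite mulr0 addr0. Qed.

Lemma derX f n t a : is_derive t 1 f a ->
  is_derive t 1 (fun s => f s ^+ n.+1) (n.+1%:R * f t ^+ n * a).
Proof.
move=> h; elim: n => [|n IH].
  rewrite (_ : (fun _ => _) = f); first by apply: der_eq h _; rewrite expr0; ring.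
  by apply/funext => s; rewrite expr1.
rewrite (_ : (fun _ => _) = (fun s => f s * f s ^+ n.+1)).
  by apply: der_eq (derM h IH) _; rewrite exprS -[in RHS](natr1 n.+1); ring.
by apply/funext => s; rewrite exprS.
Qed.

Lemma der_comp f g t a b : is_derive t 1 f a -> is_derive (f t) 1 g b ->
  is_derive t 1 (fun s => g (f s)) (b * a).
Proof. by move=> h1 h2; exact: is_derive1_comp. Qed.

Lemma derV f t a : is_derive t 1 f a -> f t != 0 ->
  is_derive t 1 (fun s => (f s)^-1) (- a / f t ^+ 2).
Proof.
move=> h f0; have h' := @is_deriveV R f t a 1 f0 h.
apply: (@der_eq (fun s => (f s)^-1) _ _ _ h') _.
by rewrite /GRing.scale /=; field.
Qed.

Lemma der_div f g t a b : is_derive t 1 f a -> is_derive t 1 g b -> g t != 0 ->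
  is_derive t 1 (fun s => f s / g s) ((a * g t - f t * b) / g t ^+ 2).
Proof.
move=> h1 h2 g0; apply: der_eq (derM h1 (derV h2 g0)) _.
by field.
Qed.

Lemma der_sum n (h : 'I_n -> R -> R) (dh : 'I_n -> R) (t : R) :
  (forall i, is_derive t 1 (h i) (dh i)) ->
  is_derive t 1 (fun s => \sum_i h i s) (\sum_i dh i).
Proof.
elim: n h dh => [|n IH] h dh H.
  rewrite big_ord0 (_ : (fun _ => _) = fun=> 0); first exact: der_cst.
  by apply/funext => s; rewrite big_ord0.
rewrite big_ord_recr (_ : (fun _ => _) =
  (fun s => (\sum_(i < n) h (widen_ord (leqnSn n) i) s) + h ord_max s)).
  by apply: derD => //; exact: IH.
by apply/funext => s; rewrite big_ord_recr.
Qed.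

Lemma der_monomial i (t : R) :
  is_derive t 1 (fun s : R => s ^+ i.+1 / i.+1`!%:R) (t ^+ i / i`!%:R).
Proof.
have i0 : (i`!%:R : R) != 0 by rewrite pnatr_eq0 -lt0n fact_gt0.
have i1 : (i.+1%:R : R) != 0 by rewrite pnatr_eq0.
apply: der_eq (derM (derX i (der_id t)) (der_cst (i.+1`!%:R^-1) t)) _.
by rewrite factS natrM; field; rewrite i0 ?natr1 ?nat1r i1.
Qed.

Lemma der_near f g t a : (\forall s \near t, f s = g s) ->
  is_derive t 1 f a -> is_derive t 1 g a.
Proof. by move=> fg; exact: near_eq_is_derive. Qed.

End DeriveRules.

(** * Taylor estimates in one variable *)

Section Taylor.
Variable R : realType.

(** Differentiating the Taylor polynomial [T] gives that of the shifted family, so the induction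
    hypothesis bounds the derivative of the remainder and the mean value inequality integrates it.
    Taking [L] instead of [D n 0] as top coefficient later gives estimates uniform in a
    parameter. *)
Lemma taylor_bound (r e L : R) n (D : nat -> R -> R) :
  (forall j (t : R), (j < n)%N -> `|t| < r -> is_derive t 1 (D j) (D j.+1 t)) ->
  (forall t : R, `|t| < r -> `|D n t - L| <= e) ->
  forall t, `|t| < r ->
  `|D 0%N t - (\sum_(i < n) D i 0 * (t ^+ i / i`!%:R) + L * (t ^+ n / n`!%:R))|
     <= e * `|t| ^+ n.
Proof.
elim: n D => [|n IH] D hd hL t tr.
  by rewrite big_ord0 add0r fact0 expr0 divr1 !mulr1; exact: hL.
have e0 : 0 <= e by apply: le_trans (hL _ tr).
pose T n (E : nat -> R -> R) t := \sum_(i < n) E i 0 * (t ^+ i / i`!%:R) + L * (t ^+ n / n`!%:R).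
have dT (s : R) : is_derive s 1 (T n.+1 D) (T n (D \o S) s).
  rewrite /T (_ : (fun _ => _) = (fun s => D 0%N 0 +
     \sum_(i < n) D i.+1 0 * (s ^+ i.+1 / i.+1`!%:R) + L * (s ^+ n.+1 / n.+1`!%:R))).
    apply: derD; last exact/derZ/der_monomial.
    apply: der_eq (derD (der_cst _ _) (der_sum _)) _; last by rewrite add0r.
    by move=> i; exact/derZ/der_monomial.
  apply/funext => u; rewrite big_ord_recl /= expr0 fact0 divr1 mulr1.
  by under eq_bigr do rewrite /bump /= add1n.
have T0 : T n.+1 D 0 = D 0%N 0.
  rewrite /T big_ord_recl /= expr0 fact0 divr1 mulr1 expr0n /= mul0r mulr0 addr0.
  rewrite big1 ?addr0 // => i _; by rewrite expr0n /= mul0r mulr0.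
have K : `|(D 0%N t - T n.+1 D t) - (D 0%N 0 - T n.+1 D 0) - 0 * (t - 0)|
    <= e * `|t| ^+ n * `|t - 0|.
  apply: (@mvt_ineq R (fun s => D 0%N s - T n.+1 D s) (fun s => D 1%N s - T n (D \o S) s)).
    move=> s; rewrite !subr0 => s0 st; have sr : `|s| < r by exact: lt_trans st tr.
    split; first by apply: derB => //; exact: hd.
    apply: (le_trans (IH (D \o S) _ _ s sr)) => //.
      by move=> j u jn ur; exact: hd.
    by rewrite ler_wpM2l // lerXn2r ?nnegrE // ltW.
  move=> s; rewrite !subr0 => st; have sr : `|s| < r by exact: le_lt_trans st tr.
  by apply: is_derive_continuous; apply: derB => //; exact: hd.
rewrite -/(T n.+1 D t) exprSr mulrA.
by move: K; rewrite T0 subrr mul0r !subr0.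
Qed.

(** At the first order [j] not yet treated, the Taylor polynomial has the single term
    [D j 0 * t^j / j!]. Both the Taylor error and the bound of order [n > j] are at most
    [eta / 2 * t^j] for one small [t]. *)
Lemma jets_vanish (r C : R) n (D : nat -> R -> R) : 0 < r ->
  (forall j (t : R), (j <= n)%N -> `|t| < r -> is_derive t 1 (D j) (D j.+1 t)) ->
  (forall t : R, `|t| < r -> `|D 0%N t| <= C * `|t| ^+ n) ->
  forall j, (j < n)%N -> D j 0 = 0.
Proof.
move=> r0 hd hC j; elim/ltn_ind: j => j IH jn.
have f0 : 0 < (j`!%:R : R)^-1 by rewrite invr_gt0 ltr0n fact_gt0.
apply/eqP; rewrite -normr_le0 -(ler_pM2r f0) mul0r.
apply/ler_addgt0Pr => eta eta0; rewrite add0r.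
have eta2 : 0 < eta / 2 by rewrite divr_gt0.
have z0 : `|0 : R| < r by rewrite normr0.
have := is_derive_continuous (hd j 0 (ltnW jn) z0).
move=> /cvgrPdist_le/(_ _ eta2)/nbhs_ballP[d d0 hd'].
have C1 : 0 < 1 + `|C| by rewrite ltr_pwDl.
(* Below 1 to bound powers of [t] by 1, within [r] and [d] for the Taylor estimate, and small enough
   for [C * t] to stay below [eta / 2]; the summand 1 prevents a zero denominator. *)
pose t := Num.min (Num.min 1 (d / 2)) (Num.min (r / 2) (eta / 2 / (1 + `|C|))).
have t0 : 0 < t by rewrite !lt_min ltr01 !divr_gt0.
have [[t1 td] [tr te]] : (t <= 1 /\ t <= d / 2) /\ (t <= r / 2 /\ t <= eta / 2 / (1 + `|C|)).
  have : t <= t by []; rewrite {2}/t !le_min => /andP[/andP[? ?] /andP[? ?]]; done.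
clearbody t.
have tr' : `|t| < Num.min r d.
  rewrite gtr0_norm // lt_min; apply/andP; split; first by apply: (le_lt_trans tr); rewrite ltr_pdivrMr // ltr_pMr // ltr1n.
  by apply: (le_lt_trans td); rewrite ltr_pdivrMr // ltr_pMr // ltr1n.
have := @taylor_bound (Num.min r d) (eta / 2) (D j 0) j D.
move=> /(_ _ _ t tr'); rewrite big1; last first.
  by move=> i _; rewrite IH ?mul0r // (ltn_trans (ltn_ord i)).
rewrite add0r => H.
have {}H : `|D 0%N t - D j 0 * (t ^+ j / j`!%:R)| <= eta / 2 * `|t| ^+ j.
  apply: H.
    move=> i s ij; rewrite lt_min => /andP[sr _]; apply: hd => //.
    exact: leq_trans (ltnW ij) (ltnW jn).
  move=> s; rewrite lt_min => /andP[_ sd]; rewrite distrC; apply: hd'.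
  by rewrite /ball /= sub0r normrN.
have ht : `|t| = t by rewrite gtr0_norm.
have trr : `|t| < r by move: tr'; rewrite lt_min => /andP[].
have := hC t trr; rewrite ht in H *.
rewrite -(subnKC jn) exprD exprS => hCt.
have tp : 0 < t ^+ j by rewrite exprn_gt0.
have tn : 0 <= t ^+ (n - j.+1) <= 1 by rewrite exprn_ge0 ?exprn_ile1 // ltW.
have K : C * (t * t ^+ j * t ^+ (n - j.+1)) <= eta / 2 * t ^+ j.
  have -> : C * (t * t ^+ j * t ^+ (n - j.+1)) = (C * t * t ^+ (n - j.+1)) * t ^+ j by ring.
  rewrite ler_pM2r //; apply: (@le_trans _ _ (`|C| * t)).
    apply: (le_trans (ler_norm _)); rewrite !normrM ht -[leRHS]mulr1.
    apply: ler_wpM2l; first by rewrite mulr_ge0 // ltW.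
    by rewrite ger0_norm; case/andP: tn.
  move: te; rewrite ler_pdivlMr // mulrDr mulr1 mulrC; lra.
have : `|D j 0 * (t ^+ j / j`!%:R)| <= eta * t ^+ j.
  have -> : D j 0 * (t ^+ j / j`!%:R) = D 0%N t - (D 0%N t - D j 0 * (t ^+ j / j`!%:R)) by ring.
  apply: (le_trans (ler_normB _ _)); apply: (le_trans (lerD (le_trans hCt K) H)).
  by rewrite -mulrDl -splitr.
rewrite normrM [`|t ^+ j / _|]ger0_norm; last by rewrite mulr_ge0 // ltW.
by rewrite mulrCA mulrC ler_pM2r.
Qed.

End Taylor.

(** * Jets along the axis and Hadamard quotients *)

Section Jets.
Variable R : realType.
Local Notation P := 'rV[R]_2.
Implicit Types (f g : P -> R) (r u v e : R) (x y : P).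

Lemma cu0 : cu (0 : P) = 0. Proof. by rewrite /cu mxE. Qed.

Lemma cv0 : cv (0 : P) = 0. Proof. by rewrite /cv mxE. Qed.

Definition box r : set P := [set x | `|cu x| < r /\ `|cv x| < r].

Lemma open_box r : open (box r).
Proof.
rewrite openE => x [h1 h2]; apply/nbhs2P.
exists (Num.min (r - `|cu x|) (r - `|cv x|)); first by rewrite lt_min !subr_gt0 h1.
move=> y; rewrite !lt_min => /andP[a _] /andP[_ b]; split.
  by have := ler_normD (cu y - cu x) (cu x); rewrite subrK => ?; lra.
by have := ler_normD (cv y - cv x) (cv x); rewrite subrK => ?; lra.
Qed.

Arguments open_box : clear implicits.

Lemma box_rv2 r u v : `|u| < r -> `|v| < r -> box r (rv2 u v).
Proof. by move=> *; split; rewrite ?cu_rv2 ?cv_rv2. Qed.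

Definition smbox r f := forall x, box r x -> smat x f.

Lemma smbox_on r f : smooth_on (box r) f -> smbox r f.
Proof. by move=> h x bx; exact: (smooth_on_smat (open_box r) h bx). Qed.

Lemma smat_smbox f : smat 0 f -> exists2 r, 0 < r & smbox r f.
Proof.
move=> /smat_near/nbhs2P[r r0 h]; exists r => // x [h1 h2].
by apply: h; rewrite ?cu0 ?cv0 subr0.
Qed.

Lemma smbox_smat r f : 0 < r -> smbox r f -> smat 0 f.
Proof. by move=> r0 h; apply: h; split; rewrite ?cu0 ?cv0 normr0. Qed.

Lemma smbox_le r s f : s <= r -> smbox r f -> smbox s f.
Proof. by move=> sr h x [h1 h2]; apply: h; split; [exact: lt_le_trans h1 sr|exact: lt_le_trans h2 sr]. Qed.

Lemma pd_ext (U : set P) f g : open U -> (forall x, U x -> smat x f) ->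
  (forall x, U x -> f x = g x) ->
  forall x, U x -> pd0 f x = pd0 g x /\ pd1 f x = pd1 g x.
Proof.
move=> oU sf fg x Ux; have n : \near x, f x = g x.
  by near=> y; apply: fg; near: y; exact: open_nbhs_nbhs.
have [_ e] := @diff_near_eq R P R f g x n (smat_differentiable (sf x Ux)).
by split; [exact: (esym (congr1 (fun h => h (rv2 1 0)) e))|
  exact: (esym (congr1 (fun h => h (rv2 0 1)) e))].
Unshelve. all: by end_near. Qed.

Lemma pd1E f x d : smat x f -> is_derive (cv x) 1 (fun v => f (rv2 (cu x) v)) d -> pd1 f x = d.
Proof. by move=> /smat_partials[_ h1] h2; exact: is_derive_uniq h1 h2. Qed.

Lemma pd0E f x d : smat x f -> is_derive (cu x) 1 (fun u => f (rv2 u (cv x))) d -> pd0 f x = d.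
Proof. by move=> /smat_partials[h1 _] h2; exact: is_derive_uniq h1 h2. Qed.

Lemma smat_iter f x j : smat x f -> smat x (iter j (@pd1 R) f).
Proof. by move=> sf; elim: j => //= j; exact: smat_pd1. Qed.

Lemma pd0_iter (U : set P) f j : open U -> (forall x, U x -> smat x f) ->
  forall x, U x -> iter j (@pd1 R) (pd0 f) x = pd0 (iter j (@pd1 R) f) x.
Proof.
move=> oU sf; elim: j => [//|j IH] x Ux /=.
have [_ ->] := pd_ext oU (fun x Ux => smat_iter j (smat_pd0 (sf x Ux))) IH Ux.
by rewrite pd_comm //; exact/smat_iter/sf.
Qed.

Lemma is_derive_jet r f j u (t : R) : smbox r f -> `|u| < r -> `|t| < r ->
  is_derive t 1 (fun v => iter j (@pd1 R) f (rv2 u v)) (iter j.+1 (@pd1 R) f (rv2 u t)).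
Proof. by move=> sf ur tr; apply/is_derive_pd1/smat_iter/sf/box_rv2. Qed.

(** Vanishing to order n in v along the whole axis segment, the condition for divisibility by
    v^n. *)
Definition jets0 r n f := forall j u, (j < n)%N -> `|u| < r -> iter j (@pd1 R) f (rv2 u 0) = 0.

(** The leading coefficient is frozen at [u0] while [u] varies: this uniformity gives joint
    continuity of quotients at points of the axis. *)
Lemma jets0_bound r n f u0 e : smbox r f -> jets0 r n f -> `|u0| < r -> 0 < e ->
  exists2 d, 0 < d & forall u v, `|u - u0| < d -> `|v| < d ->
    `|f (rv2 u v) - iter n (@pd1 R) f (rv2 u0 0) * (v ^+ n / n`!%:R)| <= e * `|v| ^+ n.
Proof.
move=> sf j0 ur e0; have r0 : 0 < r by exact: le_lt_trans ur.
have z0 : `|0 : R| < r by rewrite normr0.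
have sn : smat (rv2 u0 0) (iter n (@pd1 R) f) by apply/smat_iter/sf/box_rv2.
have [d d0 hd] := (iffLR (cvg2P _ _)) (smat_continuous sn) _ e0.
exists (Num.min (r - `|u0|) (Num.min r d)); first by rewrite !lt_min subr_gt0 ur r0.
move=> u v; rewrite !lt_min => /and3P[u1 u2 u3] /and3P[v1 v2 v3].
have ur' : `|u| < r by have := ler_normD (u - u0) u0; rewrite subrK => ?; lra.
have := @taylor_bound R (Num.min r d) e (iter n (@pd1 R) f (rv2 u0 0)) n
  (fun j v => iter j (@pd1 R) f (rv2 u v)).
move=> /(_ _ _ v); rewrite big1 ?add0r; last first.
  by move=> i _; rewrite j0 ?mul0r.
apply; last by rewrite lt_min v2.
- move=> j t jn; rewrite lt_min => /andP[tr _]; exact: (is_derive_jet j sf ur' tr).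
- move=> t; rewrite lt_min => /andP[_ td].
  by apply: hd; rewrite ?cu_rv2 ?cv_rv2 ?subr0.
Qed.

Lemma O_jets0 r n f u C d : smbox r f -> `|u| < r -> 0 < d ->
  (forall v, `|v| < d -> `|f (rv2 u v)| <= C * `|v| ^+ n) ->
  forall j, (j < n)%N -> iter j (@pd1 R) f (rv2 u 0) = 0.
Proof.
move=> sf ur d0 H; have r0 : 0 < r by exact: le_lt_trans ur.
have m0 : 0 < Num.min r d by rewrite lt_min r0.
apply: (@jets_vanish R (Num.min r d) C n (fun j v => iter j (@pd1 R) f (rv2 u v)) m0).
- move=> j t jn; rewrite lt_min => /andP[tr _]; exact: (is_derive_jet j sf ur tr).
- by move=> t; rewrite lt_min => /andP[_]; exact: H.
Qed.

(** The numerator of a quotient rule: off the axis, the v-derivative of f / v^n is [euler n f] /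
    v^(n+1). *)
Definition euler n f y := cv y * pd1 f y - n%:R * f y.

Lemma smat_euler n f x : smat x f -> smat x (euler n f).
Proof.
move=> sf; apply: (@smatB R P (fun y => cv y * pd1 f y) (fun y => n%:R * f y)).
  exact: (smatM (smat_cv x) (smat_pd1 sf)).
exact: (@smatM R P (fun=> n%:R) f x (smat_cst _ _) sf).
Qed.

Lemma iter_euler (U : set P) n f j : open U -> (forall x, U x -> smat x f) ->
  forall x, U x -> iter j (@pd1 R) (euler n f) x =
    cv x * iter j.+1 (@pd1 R) f x + (j%:R - n%:R) * iter j (@pd1 R) f x.
Proof.
move=> oU sf; elim: j => [|j IH] x Ux; first by rewrite /= /euler sub0r mulNr.
have sF i := smat_iter i (sf x Ux).
rewrite iterS.
have [_ ->] := pd_ext oU (fun x Ux => smat_iter j (smat_euler n (sf x Ux))) IH Ux.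
apply: pd1E.
  apply: (@smatD R P R (fun x => cv x * iter j.+1 (@pd1 R) f x)
    (fun x => (j%:R - n%:R) * iter j (@pd1 R) f x)).
    exact: (smatM (smat_cv x) (sF _)).
  exact: (@smatM R P (fun=> _) _ x (smat_cst _ _) (sF _)).
have dF i := proj2 (smat_partials (sF i)).
rewrite (_ : (fun v => _) = (fun v => v * iter j.+1 (@pd1 R) f (rv2 (cu x) v) +
   (j%:R - n%:R) * iter j (@pd1 R) f (rv2 (cu x) v))).
  apply: der_eq (derD (derM (der_id _) (dF j.+1)) (derZ _ (dF j))) _.
  rewrite rv2K -[in RHS]natr1.
  have idn (a b c d e' : R) : a * b + c * 1 + (d - e') * c = a * b + (d + 1 - e') * c by ring.
  exact: idn.
by apply/funext => v; rewrite cv_rv2.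
Qed.

(** On the axis the j-th v-derivative of [euler n f] is (j - n) times that of [f]. The factor
    vanishes at j = n, the one new order, where [f] itself need not have a vanishing derivative. *)
Lemma jets0_euler r n f : smbox r f -> jets0 r n f -> jets0 r n.+1 (euler n f).
Proof.
move=> sf j0 j u jn ur; have r0 : `|0 : R| < r by rewrite normr0 (le_lt_trans _ ur).
rewrite (iter_euler _ _ (open_box r) sf); last exact: box_rv2.
rewrite cv_rv2 mul0r add0r; move: jn; rewrite ltnS leq_eqVlt => /predU1P[->|jn].
  by rewrite subrr mul0r.
by rewrite j0 // mulr0.
Qed.

Lemma jets0_pd0 r n f : smbox r f -> jets0 r n f -> jets0 r n (pd0 f).
Proof.
move=> sf j0 j u jn ur; have r0 : `|0 : R| < r by rewrite normr0 (le_lt_trans _ ur).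
have bu : box r (rv2 u 0) by exact: box_rv2.
rewrite (pd0_iter _ (open_box r) sf) //.
apply: pd0E; first exact/smat_iter/sf.
rewrite cu_rv2 cv_rv2.
apply: (@der_near R (fun=> 0) _ u 0 _ (der_cst 0 u)).
have : \forall w \near u, `|w| < r.
  apply/nbhs_ballP; exists (r - `|u|) => /=; first by rewrite subr_gt0.
  move=> w; rewrite /ball /= distrC => uw.
  by have := ler_normD (w - u) u; rewrite subrK => ?; lra.
by apply: filterS => w wr; rewrite j0.
Qed.

(* [f x / cv x ^+ n], extended by its limit on the axis [cv x = 0] when the
   jet of [f] vanishes there up to order [n]. *)
Definition quot n f x :=
  if cv x == 0 then iter n (@pd1 R) f x / n`!%:R else f x / cv x ^+ n.

Lemma cv_near0 x : cv x != 0 -> \forall y \near x, cv y != 0.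
Proof.
move=> x0; apply/nbhs2P; exists `|cv x|; first by rewrite normr_gt0.
move=> y _ h; apply/eqP => y0; move: h; rewrite y0 sub0r normrN; lra.
Qed.

Lemma smat_quot_off n f x : smat x f -> cv x != 0 -> smat x (quot n f).
Proof.
move=> sf x0; apply: (@smat_ext R P R (fun y => f y / cv y ^+ n)).
  by apply: filterS (cv_near0 x0) => y; rewrite /quot; case: eqP.
apply: (smat_div sf (smatX n (smat_cv x))).
by rewrite expf_neq0.
Qed.

Lemma quot_continuous r n f : smbox r f -> jets0 r n f ->
  forall x, box r x -> {for x, continuous (quot n f)}.
Proof.
move=> sf j0 x bx; have [x0|x0] := eqVneq (cv x) 0; last first.
  exact/smat_continuous/smat_quot_off/x0/sf.
have Ex : x = rv2 (cu x) 0 by rewrite -x0 rv2K.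
apply/cvg2P => e e0; have e2 : 0 < e / 2 by lra.
have [d1 d10 hd1] := jets0_bound sf j0 (proj1 bx) e2.
have [d2 d20 hd2] := (iffLR (cvg2P _ _)) (smat_continuous (smat_iter n (sf x bx))) _ e0.
exists (Num.min d1 d2); first by rewrite lt_min d10.
move=> y; rewrite !lt_min x0 subr0 => /andP[u1 u2] /andP[v1 v2].
have f1 : 1 <= (n`!%:R : R) by rewrite ler1n fact_gt0.
have f0 : 0 < (n`!%:R : R) by lra.
rewrite /quot x0 eqxx; case: eqVneq => y0.
  rewrite -mulrBl normrM normfV [`|_%:R|]gtr0_norm //.
  rewrite ler_pdivrMr //; apply: (le_trans (hd2 y u2 _)); first by rewrite x0 y0 subrr normr0.
  by rewrite ler_peMr // ltW.
have := hd1 (cu y) (cv y) u1 v1; rewrite rv2K -Ex => H.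
have vn : cv y ^+ n != 0 by rewrite expf_neq0.
have vp : 0 < `|cv y| ^+ n by rewrite exprn_gt0 // normr_gt0.
rewrite -(ler_pM2r vp) -normrX -normrM normrX mulrBl divfK //.
rewrite (_ : _ / _ * _ = iter n (@pd1 R) f x * (cv y ^+ n / n`!%:R)); last by field; rewrite gt_eqF.
by apply: (le_trans H); rewrite ler_pM2r //; lra.
Qed.

Lemma quot_partials_off n f x : smat x f -> cv x != 0 ->
  has_partials (quot n f) x (quot n (pd0 f) x) (quot n.+1 (euler n f) x).
Proof.
move=> sf x0; have [h0 h1] := smat_partials sf.
have E y : cv y != 0 -> quot n f y = f y / cv y ^+ n by rewrite /quot; case: eqP.
split.
  rewrite (_ : (fun u => _) = (fun u => (cv x ^+ n)^-1 * f (rv2 u (cv x)))); last first.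
    by apply/funext => u; rewrite E cv_rv2 // mulrC.
  apply: der_eq (derZ _ h0) _.
  by rewrite /quot (negPf x0) mulrC.
apply: (@der_near R (fun v => f (rv2 (cu x) v) / v ^+ n)).
  have : \forall v \near cv x, v != 0.
    by apply: open_nbhs_nbhs; split => //; exact: open_neq.
  by apply: filterS => v v0; rewrite E cv_rv2.
have xn : cv x ^+ n != 0 by rewrite expf_neq0.
rewrite /quot (negPf x0).
case: n {E} xn => [|n] xn.
  rewrite (_ : (fun v => _) = (fun v => f (rv2 (cu x) v))); last first.
    by apply/funext => v; rewrite expr0 divr1.
  by apply: der_eq h1 _; rewrite /euler expr1; field.
apply: der_eq (der_div h1 (derX n (der_id _)) xn) _.
rewrite rv2K /euler -[in LHS]/(cv x ^+ n.+1) !exprS -natr1; field.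
by rewrite expf_neq0 // x0.
Qed.

(** The quotients form a stable family: [pd0] maps [quot n f] to [quot n (pd0 f)] and [pd1] maps it
    to [quot n.+1 (euler n f)]. Off the axis this is calculus, and continuity of all three carries
    it over to the axis. *)
Lemma smooth_quot r n f : smbox r f -> jets0 r n f -> smbox r (quot n f).
Proof.
move=> sf j0; apply: smbox_on.
pose C q := exists n f, [/\ smbox r f, jets0 r n f & q = quot n f].
apply: (@smooth_coind R (box r) C (open_box r)); last by exists n, f.
  move=> q [m [g [sg jg ->]]] x bx; exact: quot_continuous bx.
move=> q [m [g [sg jg ->]]]; exists (quot m (pd0 g)), (quot m.+1 (euler m g)).
have s0 : smbox r (pd0 g) by move=> x /sg; exact: smat_pd0.
have s1 : smbox r (euler m g) by move=> x /sg; exact: smat_euler.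
have j00 := jets0_pd0 sg jg; have j1 := jets0_euler sg jg.
split; [by exists m, (pd0 g)|by exists m.+1, (euler m g)|].
apply: (@has_partials_glue R (box r) _ _ _ 0 (open_box r)).
- exact: quot_continuous.
- exact: quot_continuous.
- exact: quot_continuous.
- by move=> x bx x0; apply: quot_partials_off => //; exact: sg.
Qed.

Lemma quotK r n f x : jets0 r n f -> box r x -> f x = cv x ^+ n * quot n f x.
Proof.
move=> j0 [xu _]; rewrite /quot; case: eqVneq => x0; last by rewrite mulrC divfK // expf_neq0.
case: n j0 => [|n] j0; first by rewrite expr0 mul1r fact0 divr1.
by rewrite x0 expr0n mul0r -[x]rv2K x0; exact: (j0 0%N).
Qed.

End Jets.

Arguments open_box {R} r.

(** * Borel summation and the even-odd splitting *)

Section RootExtension.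
Variable R : realType.
Local Notation P := 'rV[R]_2.
Implicit Types (f g : P -> R) (r u v e : R) (x y : P).

Definition flat r f := forall n, jets0 r n f.

(** Vanishing of [f] to order n + j + 1 leaves a quotient of order j + 1 after division by v^n, and
    j is arbitrary. *)
Lemma flat_quot r n f : smbox r f -> flat r f -> flat r (quot n f).
Proof.
move=> sf ff m j u _ ur.
have sq := smooth_quot sf (ff n).
have [d d0 hd] := jets0_bound sf (ff (n + j.+1)%N) ur ltr01.
apply: (@O_jets0 R r j.+1 (quot n f) u 1 d sq ur d0) => // v vd.
rewrite /quot cv_rv2; case: eqVneq => v0.
  by rewrite v0 (ff n.+1 n u) // mul0r normr0 mulr_ge0 // exprn_ge0.
have := hd u v; rewrite subrr normr0 => /(_ d0 vd).
rewrite (ff (n + j.+1).+1 (n + j.+1)%N u) // mul0r subr0 => h.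
have vp : 0 < `|v| ^+ n by rewrite exprn_gt0 // normr_gt0.
rewrite normrM normfV normrX ler_pdivrMr // -mulrA -exprD addnC.
exact: h.
Qed.

Lemma flat_pd0 r f : smbox r f -> flat r f -> flat r (pd0 f).
Proof. by move=> sf ff n; exact: jets0_pd0. Qed.

Lemma flat_pd1 r f : flat r f -> flat r (pd1 f).
Proof. by move=> ff n j u jn ur; rewrite -iterSr; exact: (ff n.+1). Qed.

(** Composed with (u, v) -> (u, v^2) it returns f at (u, |v|) off the axis. The extension by 0 fits
    smoothly when [f] is flat. *)
Definition root_ext f x := if 0 < cv x then f (rv2 (cu x) (Num.sqrt (cv x))) else 0.

Lemma sqrt_lt (r t : R) : 0 < r -> t < r ^+ 2 -> Num.sqrt t < r.
Proof.
move=> r0 tr; have -> : r = Num.sqrt (r ^+ 2) by rewrite sqrtr_sqr gtr0_norm.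
by rewrite ltr_sqrt // exprn_gt0.
Qed.

Lemma box_root r x : 0 < r -> r <= 1 -> box (r ^+ 2) x -> box r (rv2 (cu x) (Num.sqrt (cv x))).
Proof.
move=> r0 r1 [xu xv]; apply: box_rv2.
  by apply: (lt_le_trans xu); rewrite expr2 ler_piMr // ltW.
rewrite ger0_norm ?sqrtr_ge0 //; apply: sqrt_lt => //.
by apply: le_lt_trans xv; rewrite ler_norm.
Qed.

Lemma smat_root_pos r f x : 0 < r -> r <= 1 -> smbox r f -> box (r ^+ 2) x -> 0 < cv x ->
  smat x (root_ext f).
Proof.
move=> r0 r1 sf bx x0.
apply: (@smat_ext R P R (fun y => f (rv2 (cu y) (Num.sqrt (cv y))))).
  apply/nbhs2P; exists (cv x) => // y _ h; rewrite /root_ext ifT //.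
  by move: h; rewrite ltr_norml => /andP[h _]; lra.
apply: (@smat_comp R P P (fun y => rv2 (cu y) (Num.sqrt (cv y))) f).
- exact: has_coords_rV.
- by apply: smat_rv2; [exact: smat_cu|apply: smat_sqrt => //; exact: smat_cv].
- by apply/sf/box_root.
Qed.

Lemma smat_root_neg f x : cv x < 0 -> smat x (root_ext f).
Proof.
move=> x0; apply: (@smat_ext R P R (fun=> 0)); last exact: smat_cst.
apply/nbhs2P; exists (- cv x); first by rewrite oppr_gt0.
move=> y _ h; rewrite /root_ext ifF //; apply/negbTE; rewrite -leNgt.
by move: h; rewrite ltr_norml => /andP[_ h]; lra.
Qed.

Lemma root_continuous r f x : 0 < r -> r <= 1 -> smbox r f -> flat r f -> box (r ^+ 2) x ->
  {for x, continuous (root_ext f)}.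
Proof.
move=> r0 r1 sf ff bx; have [x0|x0|x0] := ltgtP (cv x) 0.
- exact/smat_continuous/smat_root_neg.
- exact/smat_continuous/(smat_root_pos r0 r1 sf bx).
have ur : `|cu x| < r by have [] := box_root r0 r1 bx; rewrite cu_rv2.
apply/cvg2P => e e0.
have [d d0 hd] := jets0_bound sf (ff 0%N) ur e0.
exists (Num.min d (d ^+ 2)); first by rewrite lt_min d0 exprn_gt0.
move=> y; rewrite x0 subr0 !lt_min => /andP[u1 _] /andP[_ v2].
rewrite {2}/root_ext x0 ltxx subr0 /root_ext; case: ifP => y0; last by rewrite normr0 ltW.
have := hd (cu y) (Num.sqrt (cv y)) u1.
rewrite ger0_norm ?sqrtr_ge0 // (ff 1%N 0%N) // mul0r subr0 expr0 mulr1; apply.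
by apply: sqrt_lt => //; apply: le_lt_trans v2; rewrite ler_norm.
Qed.

Lemma root_partials r f x : 0 < r -> r <= 1 -> smbox r f -> flat r f -> box (r ^+ 2) x ->
  cv x != 0 ->
  has_partials (root_ext f) x (root_ext (pd0 f) x) (2^-1 * root_ext (quot 1 (pd1 f)) x).
Proof.
move=> r0 r1 sf ff bx; rewrite neq_lt => /orP[x0|x0].
  have n0 : (0 < cv x) = false by apply/negbTE; rewrite -leNgt ltW.
  rewrite {2 3}/root_ext n0 mulr0; split.
    rewrite (_ : (fun u => _) = (fun=> 0)); first exact: der_cst.
    by apply/funext => u; rewrite /root_ext cv_rv2 n0.
  apply: (@der_near R (fun=> 0) _ _ _ _ (der_cst 0 _)).
  have : \forall v \near cv x, v < 0 by apply: open_nbhs_nbhs; split => //; exact: open_lt.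
  by apply: filterS => v v0; rewrite /root_ext cv_rv2 ifF //; apply/negbTE; rewrite -leNgt ltW.
rewrite {2 3}/root_ext x0.
have sx := sf _ (box_root r0 r1 bx); set s := Num.sqrt (cv x) in sx *.
have [h0 h1] := smat_partials sx; rewrite cu_rv2 cv_rv2 in h0 h1.
split.
  rewrite (_ : (fun u => _) = (fun u => f (rv2 u s))) //.
  by apply/funext => u; rewrite /root_ext cv_rv2 cu_rv2 x0.
apply: (@der_near R (fun v => f (rv2 (cu x) (Num.sqrt v)))).
  have : \forall v \near cv x, 0 < v by apply: open_nbhs_nbhs; split => //; exact: open_gt.
  by apply: filterS => v v0; rewrite /root_ext cv_rv2 cu_rv2 v0.
have s0 : 0 < s by rewrite sqrtr_gt0.
apply: der_eq (der_comp (is_derive1_sqrt x0) h1) _.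
rewrite -/s /quot cv_rv2 gt_eqF // expr1.
by field; rewrite gt_eqF.
Qed.

(** The v-derivative of f(u, sqrt v) is [pd1 f] / (2 sqrt v), that is, half of
    [root_ext (quot 1 (pd1 f))]. Flatness survives [pd1] and division by v, so multiples of root
    extensions of flat functions form a stable family. The radius becomes r^2 because v is replaced
    by its root. *)
Lemma smooth_root r f : 0 < r -> r <= 1 -> smbox r f -> flat r f -> smbox (r ^+ 2) (root_ext f).
Proof.
move=> r0 r1 sf ff; apply: smbox_on.
pose C q := exists c f, [/\ smbox r f, flat r f & q = fun x => c * root_ext f x].
have cC (c : R) g : smbox r g -> flat r g -> forall x, box (r ^+ 2) x ->
    {for x, continuous (fun x => c * root_ext g x)}.
  move=> sg fg x bx; apply: (@continuousM R P (fun=> c) (root_ext g)); first exact: cst_continuous.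
  exact: root_continuous bx.
apply: (@smooth_coind R (box (r ^+ 2)) C (open_box _)); last 1 first.
- by exists 1, f; split => //; apply/funext => x; rewrite mul1r.
- by move=> q [c [g [sg fg ->]]] x bx; apply: cC.
move=> q [c [g [sg fg ->]]].
have s0 : smbox r (pd0 g) by move=> x /sg; exact: smat_pd0.
have s1 : smbox r (pd1 g) by move=> x /sg; exact: smat_pd1.
have f0 : flat r (pd0 g) by exact: flat_pd0.
have fg1 : flat r (pd1 g) by exact: flat_pd1.
have f1 : flat r (quot 1 (pd1 g)) by exact: flat_quot.
have s2 := smooth_quot s1 (fg1 1%N).
exists (fun x => c * root_ext (pd0 g) x), (fun x => c / 2 * root_ext (quot 1 (pd1 g)) x).
split; [by exists c, (pd0 g)|by exists (c / 2), (quot 1 (pd1 g))|].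
apply: (@has_partials_glue R (box (r ^+ 2)) _ _ _ 0 (open_box _));
  [by move=> x bx; apply: cC|by move=> x bx; apply: cC|by move=> x bx; apply: cC|].
move=> x bx x0; have [h0 h1] := root_partials r0 r1 sg fg bx x0.
split; first exact: derZ h0.
by apply: der_eq (derZ c h1) _; rewrite mulrA.
Qed.

End RootExtension.

(** * Primitives of the cosine and convergence of series *)

Section OneVariableJets.
Variable R : realType.
Implicit Types (f g : R -> R) (x y t : R).

Lemma smooth_sin_cos k : Ck k setT (@sin R) /\ Ck k setT (@cos R).
Proof.
elim: k => [|k [IHs IHc]].
  by split=> x _; [exact: continuous_sin|exact: continuous_cos].
split; apply: Ck_derive1 => //; try exact: openT.
  apply: (@Ck_ext R R R k setT (@cos R)) => //; first exact: openT.
  by move=> x _; rewrite derive1E derive_val.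
apply: (@Ck_ext R R R k setT (fun x => (-1 : R) *: sin x)) => //; first exact: openT.
  by move=> x _; rewrite derive1E derive_val [_ *: _]mulN1r.
by apply: Ck_scale => //; exact: openT.
Qed.

Lemma smat_sin x : smat x (@sin R).
Proof. by apply: (smooth_on_smat openT) => // k; have [] := smooth_sin_cos k. Qed.

Lemma smat_cos x : smat x (@cos R).
Proof. by apply: (smooth_on_smat openT) => // k; have [] := smooth_sin_cos k. Qed.

Lemma smat_iter_deriv f x j : smat x f -> smat x (iter_deriv j f).
Proof. by move=> sf; elim: j => //= j; exact: smat_derive1. Qed.

Lemma is_derive_iter_deriv f x j : smat x f ->
  is_derive x 1 (iter_deriv j f) (iter_deriv j.+1 f x).
Proof. by move=> sf; exact/smat_is_derive/smat_iter_deriv. Qed.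

(* The [m]-fold primitive of [cos (y / e)] whose lower derivatives vanish at 0. *)
Fixpoint cosprim e m (y : R) : R := match m with
  | 0 => cos (y / e)
  | m'.+1 => match m' with
    | 0 => e * sin (y / e)
    | m''.+1 => e ^+ 2 * (y ^+ m'' / m''`!%:R - cosprim e m'' y)
    end
  end.

Lemma cosprimSS e m y : cosprim e m.+2 y = e ^+ 2 * (y ^+ m / m`!%:R - cosprim e m y).
Proof. by []. Qed.

Lemma nat_ind2 (Q : nat -> Prop) : Q 0%N -> Q 1%N -> (forall n, Q n -> Q n.+1 -> Q n.+2) ->
  forall n, Q n.
Proof. by move=> q0 q1 qS n; suff [] : Q n /\ Q n.+1 by []; elim: n => // n [h1 h2]; split => //; exact: qS. Qed.

Lemma smat_cosprim e m y : smat y (cosprim e m).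
Proof.
have sd : smat y (fun y => y / e) by apply: smatM; [exact: smat_id|exact: smat_cst].
elim/nat_ind2: m => [||m IH _].
- by apply: (@smat_comp R R R (fun y => y / e)) => //; [exact: has_coords_R|exact: smat_cos].
- apply: (@smatM R R (fun=> e)); first exact: smat_cst.
  by apply: (@smat_comp R R R (fun y => y / e)) => //; [exact: has_coords_R|exact: smat_sin].
apply: (@smatM R R (fun=> e ^+ 2)); first exact: smat_cst.
apply: (@smatB R R (fun y => y ^+ m / m`!%:R)) => //.
apply: (@smatM R R (fun y => y ^+ m)); last exact: smat_cst.
apply: smatX; exact: smat_id.
Qed.

Lemma der_cosprim e m y : e != 0 -> is_derive y 1 (cosprim e m.+1) (cosprim e m y).
Proof.
move=> e0; have dd : is_derive y 1 (fun y => y / e) e^-1.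
  by apply: der_eq (derM (der_id y) (der_cst e^-1 y)) _; ring.
elim/nat_ind2: m => [||m IH _].
- apply: der_eq (derZ e (der_comp dd (is_derive_sin (y / e)))) _.
  by rewrite /=; field.
- rewrite (_ : cosprim e 2 = fun y => e ^+ 2 * (1 - cos (y / e))); last first.
    by apply/funext => z; rewrite /= expr0 fact0 divr1.
  apply: der_eq (derZ (e ^+ 2) (derB (der_cst 1 y) (der_comp dd (is_derive_cos (y / e))))) _.
  by rewrite /=; field.
have -> : cosprim e m.+3 = fun y => e ^+ 2 * (y ^+ m.+1 / m.+1`!%:R - cosprim e m.+1 y) by [].
exact: derZ (derB (der_monomial m y) IH).
Qed.

Lemma cosprim0 e m : cosprim e m.+1 0 = 0.
Proof.
elim/nat_ind2: m => [||m IH _]; first by rewrite /= mul0r sin0 mulr0.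
  by rewrite /= mul0r cos0 expr0 fact0 divr1 subrr mulr0.
by rewrite cosprimSS IH expr0n mul0r subrr mulr0.
Qed.

(** The first primitive brings the factor [e]; further integration from 0 over a segment of length
    at most 1 does not enlarge it. *)
Lemma cosprim_bound e m y : 0 < e -> `|y| <= 1 -> `|cosprim e m.+1 y| <= e.
Proof.
move=> e0; elim: m y => [|m IH] y y1.
  rewrite /= normrM gtr0_norm // ler_piMr //; first exact: ltW.
  by rewrite ler_norml sin_geN1 sin_le1.
have := @mvt_ineq R (cosprim e m.+2) (cosprim e m.+1) 0 y 0 e.
rewrite cosprim0 !subr0 mul0r subr0 => H; apply: (le_trans (H _ _)).
- move=> t; rewrite !subr0 => _ ty; split; first by apply: der_cosprim; rewrite gt_eqF.
  by apply: IH; apply: le_trans y1; exact: ltW.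
- by move=> t _; exact/smat_continuous/smat_cosprim.
by rewrite ler_piMr //; exact: ltW.
Qed.

Lemma iter_deriv_cosprim e m j : e != 0 -> (j <= m)%N ->
  iter_deriv j (cosprim e m) = cosprim e (m - j).
Proof.
move=> e0; elim: j => [|j IH] jm; first by rewrite subn0.
rewrite /= IH ?(ltnW jm) //; apply/funext => y.
have := der_cosprim (m - j.+1) y e0; rewrite -subSn // subSS => -[_].
by rewrite derive1E.
Qed.

Lemma segment_bounded f r : 0 <= r -> (forall x, `|x| <= r -> {for x, continuous f}) ->
  exists2 C, 0 <= C & forall x, `|x| <= r -> `|f x| <= C.
Proof.
move=> r0 cf.
have [||c _ hc] := @EVT_max R (fun x => `|f x|) (- r) r.
- lra.
- apply: continuous_in_subspaceT => t; rewrite inE /= in_itv /= => /andP[t1 t2].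
  have ct : {for t, continuous f} by apply: cf; rewrite ler_norml t1.
  exact: (@continuous_comp _ _ _ f (fun z : R => `|z|) t ct (@norm_continuous R R (f t))).
exists `|f c| => // x; rewrite ler_norml => /andP[x1 x2].
by apply: hc; rewrite in_itv /= x1.
Qed.

(** Geometric weights; the tail from the N-th one on sums to [2 * hpow N]. *)
Definition hpow (k : nat) : R := 2^-1 ^+ k.

Lemma hpow_gt0 k : 0 < hpow k.
Proof. by rewrite exprn_gt0 // invr_gt0. Qed.

Lemma hpowS k : hpow k = 2 * hpow k.+1.
Proof. by rewrite /hpow exprS mulrA divff ?mul1r // pnatr_eq0. Qed.

Lemma hpow_small e : 0 < e -> exists n, forall m, (n <= m)%N -> 2 * hpow m <= e.
Proof.
move=> e0; exists (Num.truncn (2 / e)).+1 => m nm.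
have h : 2 / e < m%:R.
  apply: (@lt_le_trans _ _ (Num.truncn (2 / e)).+1%:R); last by rewrite ler_nat.
  by apply: truncnS_gt.
have h2 : (m%:R : R) <= 2 ^+ m by rewrite -natrX ler_nat ltnW // ltn_expl.
have p2 : 0 < (2 : R) ^+ m by rewrite exprn_gt0.
rewrite /hpow exprVn ler_pdivrMr // mulrC.
by rewrite -ler_pdivrMr //; lra.
Qed.

(** Nested intervals: partial sums minus the tail bound increase, partial sums plus the tail bound
    decrease, and the supremum of the former lies in all intervals. Only the terms from [m] on are
    controlled, as is the case for derivatives of the Borel series. *)
Lemma series_limit (t : nat -> R) m : (forall k, (m <= k)%N -> `|t k| <= hpow k) ->
  exists l, forall N, (m <= N)%N -> `|l - \sum_(k < N) t k| <= 2 * hpow N.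
Proof.
move=> ht; pose q N := \sum_(k < N) t k.
have lo N i : (m <= N)%N -> q N - 2 * hpow N <= q (N + i)%N - 2 * hpow (N + i).
  move=> mN; elim: i => [|i IH]; first by rewrite addn0.
  rewrite (le_trans IH) // addnS /q big_ord_recr /=.
  have := ht _ (leq_trans mN (leq_addr i N)).
  by rewrite ler_norml (hpowS (N + i)) => /andP[h _]; lra.
have up N i : (m <= N)%N -> q (N + i)%N + 2 * hpow (N + i) <= q N + 2 * hpow N.
  move=> mN; elim: i => [|i IH]; first by rewrite addn0.
  apply: (le_trans _ IH); rewrite addnS /q big_ord_recr /=.
  have := ht _ (leq_trans mN (leq_addr i N)).
  by rewrite ler_norml (hpowS (N + i)) => /andP[_ h]; lra.
pose A : set R := [set z | exists2 N, (m <= N)%N & z = q N - 2 * hpow N].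
have ubA M : (m <= M)%N -> ubound A (q M + 2 * hpow M).
  move=> mM _ [N mN ->].
  have h1 := lo N M mN; have h2 := up M N mM; rewrite addnC in h2.
  have := hpow_gt0 (N + M); lra.
have A0 : A !=set0 by exists (q m - 2 * hpow m); exists m.
have sA : has_sup A by split => //; exists (q m + 2 * hpow m); exact: ubA.
exists (sup A) => N mN; rewrite ler_norml; apply/andP; split.
  have : q N - 2 * hpow N <= sup A by apply: sup_upper_bound => //; exists N.
  by rewrite /q; lra.
have : sup A <= q N + 2 * hpow N by apply: ge_sup => //; exact: ubA.
by rewrite /q; lra.
Qed.

Lemma der_limit (S dS : nat -> R -> R) (B dB : R -> R) (a r : R) : 0 < r ->
  (forall N s, `|s - a| < r -> is_derive s 1 (S N) (dS N s)) ->
  (forall e, 0 < e -> exists M, forall N s, (M <= N)%N -> `|s - a| < r ->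
     `|B s - S N s| <= e /\ `|dB s - dS N s| <= e) ->
  {for a, continuous dB} -> is_derive a 1 B (dB a).
Proof.
move=> r0 hd hl cB; apply: is_derive_bound => e e0.
have e2 : 0 < e / 2 by rewrite divr_gt0.
have /cvgrPdist_le/(_ _ e2)/nbhs_ballP[d d0 hdB] := cB.
exists (Num.min r d); first by rewrite lt_min r0.
move=> t; rewrite lt_min => /andP[tr td].
apply/ler_addgt0Pr => eta eta0.
have eta2 : 0 < eta / 2 by rewrite divr_gt0.
(* Two thresholds: [M1] brings the derivatives within [e / 2], while the error on the values is not
   proportional to |t - a| and therefore has to be made arbitrarily small by [M2]. *)
have [M1 hM1] := hl _ e2; have [M2 hM2] := hl _ eta2.
pose N := maxn M1 M2.
have {}hM1 := hM1 N _ (leq_maxl _ _); have {}hM2 := hM2 N _ (leq_maxr _ _).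
have K : `|S N t - S N a - dB a * (t - a)| <= e * `|t - a|.
  apply: (@mvt_ineq R (S N) (dS N)).
    move=> s _ st; have sr : `|s - a| < r by exact: lt_trans st tr.
    split; first exact: hd.
    have h1 : `|dB a - dB s| <= e / 2.
      by apply: hdB; rewrite /ball /= distrC; exact: lt_trans st td.
    have [_ h2] := hM1 s sr.
    have -> : dS N s - dB a = - ((dB a - dB s) + (dB s - dS N s)) by ring.
    rewrite normrN (le_trans (ler_normD _ _)) // [leRHS]splitr.
    exact: lerD.
  move=> s st; have sr : `|s - a| < r by exact: le_lt_trans st tr.
  exact: is_derive_continuous (hd N s sr).
have [h1 _] := hM2 t tr.
have [h2 _] : `|B a - S N a| <= eta / 2 /\ `|dB a - dS N a| <= eta / 2.
  by apply: hM2; rewrite subrr normr0.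
have -> : B t - B a - dB a * (t - a) =
  (S N t - S N a - dB a * (t - a)) + (B t - S N t) - (B a - S N a) by ring.
apply: (le_trans (ler_normB _ _)); apply: (le_trans (lerD (ler_normD _ _) h2)).
apply: (le_trans (lerD (lerD K h1) (lexx _))).
by rewrite -addrA -splitr.
Qed.

End OneVariableJets.

(** * Borel's theorem with a parameter *)

Section Borel.
Variable R : realType.
Local Notation P := 'rV[R]_2.

Definition sm1 (r : R) (g : R -> R) := forall u, `|u| < r -> smat u g.

Lemma der_line0 (f : P -> R) (U : set P) x : open U -> U x ->
  (forall y, U y -> {for y, continuous f}) -> {for cu x, continuous (fun u => f (rv2 u (cv x)))}.
Proof.
move=> oU Ux cf.
have cl : {for cu x, continuous (fun u => rv2 u (cv x))}.
  apply: (@smat_continuous R R P).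
  by apply: smat_rv2; [exact: smat_id|exact: smat_cst].
have cfx : {for rv2 (cu x) (cv x), continuous f} by rewrite rv2K; exact: cf.
exact: (@continuous_comp _ _ _ (fun u => rv2 u (cv x)) f (cu x) cl cfx).
Qed.

Lemma der_line1 (f : P -> R) (U : set P) x : open U -> U x ->
  (forall y, U y -> {for y, continuous f}) -> {for cv x, continuous (fun v => f (rv2 (cu x) v))}.
Proof.
move=> oU Ux cf.
have cl : {for cv x, continuous (fun v => rv2 (cu x) v)}.
  apply: (@smat_continuous R R P).
  by apply: smat_rv2; [exact: smat_cst|exact: smat_id].
have cfx : {for rv2 (cu x) (cv x), continuous f} by rewrite rv2K; exact: cf.
exact: (@continuous_comp _ _ _ (fun v => rv2 (cu x) v) f (cv x) cl cfx).
Qed.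

(* Scaling [cosprim] makes the [k]-th summand of the Borel series small
   together with all its derivatives of lower order. *)
Lemma small_jet_factor k (g : R -> R) (d r : R) : 0 <= r -> r < d -> sm1 d g -> exists h : R -> R,
  [/\ forall y, smat y h,
      forall j, (j <= k)%N -> iter_deriv j h 0 = (j == k)%:R &
      forall i j u y, (i <= k)%N -> (j < k)%N -> `|u| <= r -> `|y| <= 1 ->
        `|iter_deriv i g u * iter_deriv j h y| <= hpow R k].
Proof.
move=> r0 rd sg.
have [C C0 hC] : exists2 C, 0 <= C & forall i u, (i <= k)%N -> `|u| <= r -> `|iter_deriv i g u| <= C.
  elim: (k) => [|n [C C0 hC]].
    have [u ur|C C0 hC] := @segment_bounded R g r r0.
      by apply/smat_continuous/sg; exact: le_lt_trans ur rd.
    by exists C => // i u; rewrite leqn0 => /eqP-> /=; exact: hC.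
  have [u ur|C' C'0 hC'] := @segment_bounded R (iter_deriv n.+1 g) r r0.
    by apply/smat_continuous/smat_iter_deriv/sg; exact: le_lt_trans ur rd.
  exists (C + C'); first exact: addr_ge0.
  move=> i u; rewrite leq_eqVlt => /predU1P[->|h1] h2.
    by apply: (le_trans (hC' u h2)); rewrite lerDr.
  by apply: (le_trans (hC i u h1 h2)); rewrite lerDl.
have C1 : 0 < 1 + C by rewrite ltr_pwDl.
(* [C] bounds the derivatives of [g] up to order k, and the derivatives of [cosprim e k] below order
   k are at most [e]; the product stays below [hpow R k]. *)
pose e := hpow R k / (1 + C).
have e0 : 0 < e by rewrite divr_gt0 // hpow_gt0.
have en : e != 0 by rewrite gt_eqF.
exists (cosprim e k); split.
- by move=> y; exact: smat_cosprim.
- move=> j jk; rewrite iter_deriv_cosprim //; case: eqVneq => [->|jn].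
    by rewrite subnn /= mul0r cos0.
  have : (j < k)%N by rewrite ltn_neqAle jn.
  by move=> {}jk; rewrite -(subnSK jk) cosprim0.
- move=> i j u y ik jk ur y1; rewrite iter_deriv_cosprim // ?(ltnW jk) // -(subnSK jk) normrM.
  apply: (@le_trans _ _ (C * e)).
    by apply: ler_pM => //; [exact: hC|exact: cosprim_bound].
  rewrite /e mulrCA ler_piMr //; first exact/ltW/hpow_gt0.
  by rewrite ler_pdivrMr // mul1r lerDr.
Qed.

(** The sum is over products [g k] (u) times [ph k] (v). The jet of [ph k] is prescribed only up to
    order k, so each summand disturbs all higher orders; hence [g k] is not [a k] but [a k] minus
    what the earlier summands contribute at order k. The (i, j) derivative of summand k is at most
    2^-k once k exceeds i and j, so every termwise derivative of the series converges uniformly. *)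
Theorem borel_family (a : nat -> R -> R) (d : R) : 0 < d -> (forall k, sm1 d (a k)) ->
  exists r b, [/\ 0 < r, smbox r b &
    forall k u, `|u| < r -> iter k (@pd1 R) b (rv2 u 0) = a k u].
Proof.
move=> d0 sa; pose r := Num.min (d / 2) 1.
have r0 : 0 < r by rewrite lt_min ltr01 divr_gt0.
have rd : r < d by rewrite gt_min; apply/orP; left; lra.
have r1 : r <= 1 by rewrite ge_min lexx orbT.
(* Smoothness of [kg.2] is a premise inside [Q] so that choice applies to all pairs; a pair that
   violates it receives the zero function. *)
pose Q (kg : nat * (R -> R)) (h : R -> R) := sm1 d kg.2 ->
  [/\ forall y, smat y h,
      forall j, (j <= kg.1)%N -> iter_deriv j h 0 = (j == kg.1)%:R &
      forall i j u y, (i <= kg.1)%N -> (j < kg.1)%N -> `|u| <= r -> `|y| <= 1 ->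
        `|iter_deriv i kg.2 u * iter_deriv j h y| <= hpow R kg.1].
have exQ kg : exists h, Q kg h.
  have [sg|ns] := pselect (sm1 d kg.2); last by exists (fun=> 0).
  by have [h H] := small_jet_factor kg.1 (ltW r0) rd sg; exists h.
have [pick hpick] := choice exQ.
(* [St n j] is the j-th v-derivative on the axis of the first n summands. It has to be built
   together with the factors, since the factor chosen at stage n depends on the correction
   [a n - St n n]. *)
pose St := fix St n : nat -> R -> R := match n with
  | 0 => fun _ _ => 0
  | n'.+1 => let g := fun u => a n' u - St n' n' u in
      fun j u => St n' j u + g u * iter_deriv j (pick (n', g)) 0
  end.
pose g n u := a n u - St n n u.
pose ph n := pick (n, g n).
have sSt n j : sm1 d (St n j).
  elim: n j => [|n IH] j u ud; first exact: smat_cst.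
  apply: (@smatD R R R (St n j) (fun u => g n u * iter_deriv j (ph n) 0)); first exact: IH.
  apply: (@smatM R R (g n)); last exact: smat_cst.
  by apply: (@smatB R R (a n)); [exact: sa|exact: IH].
have sg n : sm1 d (g n).
  by move=> u ud; apply: (@smatB R R (a n)); [exact: sa|exact: sSt].
have hph n := hpick (n, g n) (sg n).
have StE n j u : St n j u = \sum_(k < n) g k u * iter_deriv j (ph k) 0.
  by elim: n => [|n IH]; rewrite ?big_ord0 // big_ord_recr -IH.
(* Triangularity: summand j sets order j right, and later summands have a zero jet at that order. *)
have Sta j u n : (j < n)%N -> St n j u = a j u.
  elim: n => // n IH; rewrite ltnS leq_eqVlt => /predU1P[->|jn].
    have [_ h _] := hph n; change (St n n u + g n u * iter_deriv n (ph n) 0 = a n u).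
    by rewrite h // eqxx mulr1 /g; ring.
  have [_ h _] := hph n; change (St n j u + g n u * iter_deriv j (ph n) 0 = a j u).
  by rewrite h ?(ltnW jn) //= (ltn_eqF jn) mulr0 addr0 IH.
pose T i j k (x : P) := iter_deriv i (g k) (cu x) * iter_deriv j (ph k) (cv x).
have hT i j k x : box r x -> (maxn i j < k)%N -> `|T i j k x| <= hpow R k.
  move=> [xu xv]; rewrite gtn_max => /andP[ik jk].
  have [_ _ h] := hph k; apply: h => //; [exact: ltnW|exact: ltW|].
  exact: le_trans (ltW xv) r1.
pose S i j N (x : P) := \sum_(k < N) T i j k x.
(* [B i j] is the limit of the termwise (i, j) derivatives, with value 0 chosen outside the box.
   That these limits are the partial derivatives of one another is shown in [pB]. *)
have exB (z : nat * nat * P) : exists l, box r z.2 -> forall N, (maxn z.1.1 z.1.2 < N)%N ->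
    `|l - S z.1.1 z.1.2 N z.2| <= 2 * hpow R N.
  have [bz|nb] := pselect (box r z.2); last by exists 0.
  have [l hl] := @series_limit R (fun k => T z.1.1 z.1.2 k z.2) (maxn z.1.1 z.1.2).+1
    (fun k hk => hT _ _ k _ bz hk).
  by exists l => _ N hN; exact: hl.
have [B' hB'] := choice exB.
pose B i j x := B' (i, j, x).
have hB i j x : box r x -> forall N, (maxn i j < N)%N -> `|B i j x - S i j N x| <= 2 * hpow R N.
  by move=> bx; exact: (hB' (i, j, x)).
have unif i j e : 0 < e -> exists M, forall N x, (M <= N)%N -> box r x -> `|B i j x - S i j N x| <= e.
  move=> e0; have [M hM] := hpow_small e0; exists (maxn M (maxn i j).+1) => N x.
  by rewrite geq_max => /andP[h1 h2] bx; apply: (le_trans (hB i j x bx N h2)); exact: hM.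
have sT i j k x : box r x -> smat x (T i j k).
  move=> [xu xv]; apply: (@smatM R P (fun x => iter_deriv i (g k) (cu x))).
    apply: (@smat_comp R P R (@cu R)); [exact: has_coords_R|exact: smat_cu|].
    by apply/smat_iter_deriv/sg; exact: lt_trans xu rd.
  apply: (@smat_comp R P R (@cv R)); [exact: has_coords_R|exact: smat_cv|].
  by apply: smat_iter_deriv; have [h _ _] := hph k; exact: h.
have sS i j N x : box r x -> smat x (S i j N) by move=> bx; apply: smat_sum => k; exact: sT.
have cB i j x : box r x -> {for x, continuous (B i j)}.
  move=> bx; apply/cvg2P => e e0.
  have e3 : 0 < e / 3 by lra.
  have [N hN] := unif i j _ e3.
  have [d1 d10 hd1] := (iffLR (cvg2P _ _)) (smat_continuous (sS i j N x bx)) _ e3.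
  have /nbhs2P[d2 d20 hd2] : nbhs x (box r) by apply: open_nbhs_nbhs; split => //; exact: open_box.
  exists (Num.min d1 d2); first by rewrite lt_min d10.
  move=> y; rewrite !lt_min => /andP[u1 u2] /andP[v1 v2].
  have h1 := hN N x (leqnn _) bx; have h2 := hN N y (leqnn _) (hd2 y u2 v2).
  have h3 := hd1 y u1 v1.
  have -> : B i j y - B i j x = (B i j y - S i j N y) + (S i j N y - S i j N x) - (B i j x - S i j N x).
    by ring.
  apply: (le_trans (ler_normB _ _)); apply: (le_trans (lerD (ler_normD _ _) h1)).
  by apply: (le_trans (lerD (lerD h2 h3) (lexx _))); lra.
have pB i j x : box r x -> has_partials (B i j) x (B i.+1 j x) (B i j.+1 x).
  move=> bx; have [xu xv] := bx; split.
    have r' : 0 < r - `|cu x| by rewrite subr_gt0.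
    have inb s : `|s - cu x| < r - `|cu x| -> `|s| < r.
      by move=> h; have := ler_normD (s - cu x) (cu x); rewrite subrK => ?; lra.
    apply: der_eq (@der_limit R (fun N s => S i j N (rv2 s (cv x)))
      (fun N s => S i.+1 j N (rv2 s (cv x))) (fun s => B i j (rv2 s (cv x)))
      (fun s => B i.+1 j (rv2 s (cv x))) (cu x) _ r' _ _ _) _; last by rewrite rv2K.
    - move=> N s /inb sr; apply: der_sum => k; rewrite /T.
      rewrite !cu_rv2 !cv_rv2 (_ : (fun _ => _) =
        (fun s => iter_deriv i (g k) s * iter_deriv j (ph k) (cv x))); last first.
        by apply/funext => w; rewrite cu_rv2 cv_rv2.
      apply: der_eq (derM (is_derive_iter_deriv i (sg k s _)) (der_cst _ s)) _.
        exact: lt_trans sr rd.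
      by rewrite mulr0 add0r mulrC.
    - move=> e e0; have [M1 h1] := unif i j e e0; have [M2 h2] := unif i.+1 j e e0.
      exists (maxn M1 M2) => N s; rewrite geq_max => /andP[n1 n2] /inb sr.
      by have bs := box_rv2 sr xv; split; [exact: h1|exact: h2].
    - by apply: (der_line0 (open_box r) bx) => y; exact: cB.
  have r' : 0 < r - `|cv x| by rewrite subr_gt0.
  have inb s : `|s - cv x| < r - `|cv x| -> `|s| < r.
    by move=> h; have := ler_normD (s - cv x) (cv x); rewrite subrK => ?; lra.
  apply: der_eq (@der_limit R (fun N s => S i j N (rv2 (cu x) s))
    (fun N s => S i j.+1 N (rv2 (cu x) s)) (fun s => B i j (rv2 (cu x) s))
    (fun s => B i j.+1 (rv2 (cu x) s)) (cv x) _ r' _ _ _) _; last by rewrite rv2K.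
  - move=> N s /inb sr; apply: der_sum => k; rewrite /T.
    rewrite !cu_rv2 !cv_rv2 (_ : (fun _ => _) =
      (fun s => iter_deriv i (g k) (cu x) * iter_deriv j (ph k) s)); last first.
      by apply/funext => w; rewrite cu_rv2 cv_rv2.
    apply: derZ; apply: is_derive_iter_deriv.
    by have [h _ _] := hph k; exact: h.
  - move=> e e0; have [M1 h1] := unif i j e e0; have [M2 h2] := unif i j.+1 e e0.
    exists (maxn M1 M2) => N s; rewrite geq_max => /andP[n1 n2] /inb sr.
    by have bs := box_rv2 xu sr; split; [exact: h1|exact: h2].
  - by apply: (der_line1 (open_box r) bx) => y; exact: cB.
have sB i j : smbox r (B i j).
  apply: smbox_on; pose C f := exists i j, f = B i j.
  apply: (@smooth_coind R (box r) C (open_box r)); last by exists i, j.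
    by move=> f [i' [j' ->]] x bx; exact: cB.
  move=> f [i' [j' ->]]; exists (B i'.+1 j'), (B i' j'.+1); split.
  - by exists i'.+1, j'.
  - by exists i', j'.+1.
  - by move=> x bx; exact: pB.
exists r, (B 0%N 0%N); split => // k u ur.
have itB j x : box r x -> B 0%N j x = iter j (@pd1 R) (B 0%N 0%N) x.
  elim: j x => [//|j IH] x bx.
  have [_ e] := pd_ext (open_box r) (sB 0%N j) IH bx; rewrite iterS -e.
  by apply/esym/pd1E; [exact: sB|exact: (proj2 (pB 0%N j x bx))].
have bu : box r (rv2 u 0) by apply: box_rv2 => //; rewrite normr0.
rewrite -itB //; apply/eqP; rewrite -subr_eq0 -normr_le0.
apply/ler_addgt0Pr => e e0; rewrite add0r.
have [M hM] := unif 0%N k e e0.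
have := hM (maxn M k.+1) (rv2 u 0) (leq_maxl _ _) bu.
rewrite (_ : S _ _ _ _ = a k u) //.
rewrite -(Sta k u (maxn M k.+1)) ?leq_maxr // StE /S.
by apply: eq_bigr => i _; rewrite /T cu_rv2 cv_rv2.
Qed.

End Borel.

(** * Functions of v^2 and the even-odd splitting *)

Section EvenOddSplitting.
Variable R : realType.
Local Notation P := 'rV[R]_2.
Implicit Types (f g : P -> R) (r u v e : R) (x y : P).

Lemma taylor_O r f u n : smbox r f -> `|u| < r -> exists C d, [/\ 0 <= C, 0 < d & forall v, `|v| < d ->
  `|f (rv2 u v) - \sum_(i < n) iter i (@pd1 R) f (rv2 u 0) * (v ^+ i / i`!%:R)| <= C * `|v| ^+ n].
Proof.
move=> sf ur; have r0 : 0 < r by exact: le_lt_trans ur.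
have z0 : `|0 : R| < r by rewrite normr0.
have sn : smat (rv2 u 0) (iter n (@pd1 R) f) by apply/smat_iter/sf/box_rv2.
have [d d0 hd] := (iffLR (cvg2P _ _)) (smat_continuous sn) _ ltr01.
pose C := `|iter n (@pd1 R) f (rv2 u 0)| + 1.
exists C, (Num.min r d); split; [by rewrite addr_ge0|by rewrite lt_min r0|].
move=> v vd; have := @taylor_bound R (Num.min r d) C 0 n (fun j v => iter j (@pd1 R) f (rv2 u v)).
move=> /(_ _ _ v vd); rewrite mul0r addr0; apply.
  move=> j t jn; rewrite lt_min => /andP[tr _]; exact: (is_derive_jet j sf ur tr).
move=> t; rewrite lt_min subr0 => /andP[_ td].
have := hd (rv2 u t); rewrite !cu_rv2 !cv_rv2 subrr normr0 subr0 => /(_ d0 td) h.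
have := ler_normD (iter n (@pd1 R) f (rv2 u t) - iter n (@pd1 R) f (rv2 u 0)) (iter n (@pd1 R) f (rv2 u 0)).
by rewrite subrK /C => ?; lra.
Qed.

(** In terms of growth, flatness is visibly stable under reflection and linear combination. *)
Lemma flatP r f : smbox r f -> flat r f <-> forall n u, `|u| < r -> exists C d, 0 < d /\
   forall v, `|v| < d -> `|f (rv2 u v)| <= C * `|v| ^+ n.
Proof.
move=> sf; split=> [ff n u ur|h n j u jn ur].
  have [d d0 hd] := jets0_bound sf (ff n) ur ltr01.
  exists 1, d; split=> // v vd; have := hd u v.
  by rewrite subrr normr0 (ff n.+1 n u) // mul0r subr0; apply.
have [C [d [d0 hd]]] := h n u ur.
exact: (O_jets0 sf ur d0 hd).
Qed.

(** Degree 1 is set apart because the odd part is to be v^3 times a function of v^2; the odd degrees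
    in the second sum start at 3. *)
Lemma sum_even_odd n (E : nat -> R) : \sum_(i < n.*2.+3) E i =
  \sum_(k < n.+2) E k.*2 + \sum_(k < n) E k.*2.+3 + E 1%N.
Proof.
elim: n => [|n IH].
  by rewrite !big_ord_recl !big_ord0 /= /bump /=; ring.
rewrite doubleS 2!big_ord_recr IH (big_ord_recr n.+2) (big_ord_recr n) /=.
by rewrite doubleS; ring.
Qed.

Definition flip x : P := rv2 (cu x) (- cv x).

Lemma smat_flip f x : smat (flip x) f -> smat x (f \o flip).
Proof.
move=> sf; apply: (@smat_comp R P P flip f) => //; first exact: has_coords_rV.
by apply: smat_rv2; [exact: smat_cu|apply: smatN; exact: smat_cv].
Qed.

Lemma box_flip r x : box r x -> box r (flip x).
Proof. by move=> [? ?]; apply: box_rv2; rewrite ?normrN. Qed.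

Lemma flat_flip r f : smbox r f -> flat r f -> smbox r (f \o flip) /\ flat r (f \o flip).
Proof.
move=> sf ff; have s' : smbox r (f \o flip).
  by move=> x bx; apply: smat_flip; apply: sf; exact: box_flip.
split=> //; apply/(flatP s') => n u ur; have [C [d [d0 h]]] := (iffLR (flatP sf)) ff n u ur.
exists C, d; split=> // v vd; rewrite /= /flip cu_rv2 cv_rv2 -(normrN v).
by apply: h; rewrite normrN.
Qed.

Lemma flat_comb r (a b : R) f g : smbox r f -> smbox r g -> flat r f -> flat r g ->
  smbox r (fun x => a * f x + b * g x) /\ flat r (fun x => a * f x + b * g x).
Proof.
move=> sf sg ff fg; have s' : smbox r (fun x => a * f x + b * g x).
  move=> x bx; apply: (@smatD R P R (fun x => a * f x) (fun x => b * g x)).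
    exact: (@smatM R P (fun=> a) f x (smat_cst _ _) (sf x bx)).
  exact: (@smatM R P (fun=> b) g x (smat_cst _ _) (sg x bx)).
split=> //; apply/(flatP s') => n u ur.
have [C [d [d0 h]]] := (iffLR (flatP sf)) ff n u ur.
have [C' [d' [d'0 h']]] := (iffLR (flatP sg)) fg n u ur.
exists (`|a| * C + `|b| * C'), (Num.min d d'); split; first by rewrite lt_min d0.
move=> v; rewrite lt_min => /andP[/h h1 /h' h2].
apply: (le_trans (ler_normD _ _)); rewrite !normrM mulrDl -!mulrA.
by apply: lerD; rewrite ler_wpM2l.
Qed.

Definition fold x : P := rv2 (cu x) (cv x ^+ 2).

Lemma smat_fold f x : smat (fold x) f -> smat x (f \o fold).
Proof.
move=> sf; apply: (@smat_comp R P P fold f) => //; first exact: has_coords_rV.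
by apply: smat_rv2; [exact: smat_cu|apply: smatX; exact: smat_cv].
Qed.

Lemma box_fold r x : r <= 1 -> box r x -> box r (fold x).
Proof.
move=> r1 [h1 h2]; apply: box_rv2 => //; rewrite normrX.
apply: (le_lt_trans _ h2); rewrite expr2 ler_piMr //.
exact: ltW (lt_le_trans h2 r1).
Qed.

(** The factors k! / (2k)! and k! / (2k+3)! convert the Taylor coefficient of z at degree 2k or 2k+3
    in v into the derivative of order k in v^2. The functions [b] and [c] then account for the whole
    jet of z, whose linear term vanishes by hypothesis. *)
Lemma flat_remainder r z b c : 0 < r -> r <= 1 -> smbox r z -> smbox r b -> smbox r c ->
  (forall u, `|u| < r -> pd1 z (rv2 u 0) = 0) ->
  (forall k u, `|u| < r -> iter k (@pd1 R) b (rv2 u 0) =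
     k`!%:R / (k.*2)`!%:R * iter k.*2 (@pd1 R) z (rv2 u 0)) ->
  (forall k u, `|u| < r -> iter k (@pd1 R) c (rv2 u 0) =
     k`!%:R / (k.*2.+3)`!%:R * iter k.*2.+3 (@pd1 R) z (rv2 u 0)) ->
  let f := fun x => z x - b (fold x) - cv x ^+ 3 * c (fold x) in smbox r f /\ flat r f.
Proof.
move=> r0 r1 sz sb sc z1 hb hc f.
have sf : smbox r f.
  move=> x bx; have bf := box_fold r1 bx.
  apply: (@smatB R P (fun x => z x - b (fold x)) (fun x => cv x ^+ 3 * c (fold x))).
    by apply: (@smatB R P z (b \o fold)); [exact: sz|apply/smat_fold/sb].
  by apply: (@smatM R P (fun x => cv x ^+ 3) (c \o fold));
    [apply: smatX; exact: smat_cv|apply/smat_fold/sc].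
split=> //; apply/(flatP sf) => n u ur.
have [C1 [d1 [C10 d10 h1]]] := taylor_O n.*2.+3 sz ur.
have [C2 [d2 [C20 d20 h2]]] := taylor_O n.+2 sb ur.
have [C3 [d3 [C30 d30 h3]]] := taylor_O n sc ur.
exists (C1 + C2 + C3), (Num.min 1 (Num.min d1 (Num.min d2 d3))).
split; first by rewrite !lt_min ltr01 d10 d20 d30.
move=> v; rewrite !lt_min => /and4P[v1 vd1 vd2 vd3].
have vv : `|v ^+ 2| <= `|v| by rewrite normrX expr2 ler_piMr // ltW.
have {}h1 := h1 v vd1; have {}h2 := h2 _ (le_lt_trans vv vd2).
have {}h3 := h3 _ (le_lt_trans vv vd3).
pose E i := iter i (@pd1 R) z (rv2 u 0) * (v ^+ i / i`!%:R).
have nf i : (i`!%:R : R) != 0 by rewrite pnatr_eq0 -lt0n fact_gt0.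
have e1 : \sum_(i < n.*2.+3) E i = \sum_(k < n.+2) E k.*2 + \sum_(k < n) E k.*2.+3.
  by rewrite sum_even_odd {3}/E /= z1 // mul0r addr0.
have e2 : \sum_(i < n.+2) iter i (@pd1 R) b (rv2 u 0) * ((v ^+ 2) ^+ i / i`!%:R) =
    \sum_(k < n.+2) E k.*2.
  apply: eq_bigr => i _; rewrite hb // /E -exprM mul2n; field.
  by rewrite !nf.
have e3 : v ^+ 3 * \sum_(i < n) iter i (@pd1 R) c (rv2 u 0) * ((v ^+ 2) ^+ i / i`!%:R) =
    \sum_(k < n) E k.*2.+3.
  rewrite mulr_sumr; apply: eq_bigr => i _; rewrite hc // /E -exprM mul2n.
  rewrite -[in RHS](addn3 i.*2) exprD addn3.
  have idn (p q s t w : R) : s != 0 -> t != 0 -> p * (s / t * q * (w / s)) = q * (w * p / t).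
    by move=> s0 t0; field; rewrite s0 t0.
  exact: idn.
rewrite /f /fold cu_rv2 cv_rv2.
set Z := z (rv2 u v) in h1 *; set B := b _ in h2 *; set C := c _ in h3 *.
rewrite e1 in h1; rewrite e2 in h2.
move: h1 h2 h3 e3; rewrite -/E.
set SE := \sum_(k < n.+2) _; set SO := \sum_(k < n) E _; set SC := \sum_(k < n) _.
move=> h1 h2 h3 e3.
have idn (p q s t w k l : R) : p - q - w * s = (p - (k + w * l)) - (q - k) - w * (s - l) by ring.
rewrite (idn Z B C 0 (v ^+ 3) SE SC) e3.
have T3 (p q s : R) : `|p - q - s| <= `|p| + `|q| + `|s|.
  by apply: (le_trans (ler_normB _ _)); rewrite lerD2r ler_normB.
apply: (le_trans (T3 _ _ _)); rewrite !mulrDl.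
have pw i : (n <= i)%N -> `|v| ^+ i <= `|v| ^+ n.
  by move=> ni; rewrite ler_wiXn2l // ltW.
apply: lerD; first apply: lerD.
- apply: (le_trans h1); rewrite ler_wpM2l // pw //.
  by rewrite -addnn -addnS -addnS -addnS leq_addr.
- apply: (le_trans h2); rewrite ler_wpM2l // normrX -exprM pw //.
  by rewrite (leq_trans (leqW (leqnSn n))) // leq_pmull.
- rewrite normrM; apply: (le_trans (ler_wpM2l (normr_ge0 _) h3)).
  rewrite mulrCA ler_wpM2l // !normrX -exprM -exprD pw //.
  by rewrite (leq_trans (leq_pmull n (isT : (0 < 2)%N))) // leq_addl.
Qed.

(** A flat remainder splits into an even and an odd part, both flat. The even part and the odd part
    divided by v^3 are even flat functions, so [root_ext] turns them into smooth functions of v^2,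
    which are added to the Borel sums. *)
Theorem even_odd_splitting r z : 0 < r -> smbox r z ->
  (forall u, `|u| < r -> pd1 z (rv2 u 0) = 0) ->
  exists s al be, [/\ 0 < s, smbox s al, smbox s be,
    forall x, box s x -> z x = al (fold x) + cv x ^+ 3 * be (fold x) &
    6 * be 0 = iter 3 (@pd1 R) z 0].
Proof.
move=> r0 sz z1.
pose jet j u := iter j (@pd1 R) z (rv2 u 0).
have sj j (k : R) : sm1 r (fun u => k * jet j u).
  move=> u ur; apply: (@smatM R R (fun=> k)); first exact: smat_cst.
  apply: (@smat_comp R R P (fun u => rv2 u 0) (iter j (@pd1 R) z)).
  - exact: has_coords_rV.
  - by apply: smat_rv2; [exact: smat_id|exact: smat_cst].
  - by apply/smat_iter/sz/box_rv2; rewrite ?normr0.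
have [r1 [b [r10 sb hb]]] := borel_family r0 (fun k => sj k.*2 (k`!%:R / (k.*2)`!%:R)).
have [r2 [c [r20 sc hc]]] := borel_family r0 (fun k => sj k.*2.+3 (k`!%:R / (k.*2.+3)`!%:R)).
pose q := Num.min (Num.min 1 r) (Num.min r1 r2).
have q0 : 0 < q by rewrite !lt_min ltr01 r0 r10.
have [[q1 qr] [qr1 qr2]] : (q <= 1 /\ q <= r) /\ (q <= r1 /\ q <= r2).
  have : q <= q by []; rewrite {2}/q !le_min => /andP[/andP[? ?] /andP[? ?]]; done.
have [] := @flat_remainder q z b c q0 q1 (smbox_le qr sz) (smbox_le qr1 sb) (smbox_le qr2 sc).
- by move=> u uq; apply: z1; exact: lt_le_trans uq qr.
- by move=> k u uq; apply: hb; exact: lt_le_trans uq qr1.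
- by move=> k u uq; apply: hc; exact: lt_le_trans uq qr2.
set f := fun x => _; move=> sf ff.
have [sm fm] := flat_flip sf ff.
have [se fe] := flat_comb 2^-1 2^-1 sf sm ff fm.
have [so fo] := flat_comb 2^-1 (- 2^-1) sf sm ff fm.
set ev := fun x => _ in se fe; set od := fun x => _ in so fo.
have sq := smooth_quot so (fo 3%N); have fq := flat_quot 3%N so fo.
have s1 := smooth_root q0 q1 se fe.
have s2 : smbox (q ^+ 2) (root_ext (quot 3%N od)) by apply: smooth_root.
have q2q : q ^+ 2 <= q by rewrite expr2 ler_piMr // ltW.
exists (q ^+ 2), (fun x => b x + root_ext ev x), (fun x => c x + root_ext (quot 3%N od) x); split.
- exact: exprn_gt0.
- by move=> x bx; apply: smatD; [exact: (smbox_le (le_trans q2q qr1) sb)|exact: s1].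
- by move=> x bx; apply: smatD; [exact: (smbox_le (le_trans q2q qr2) sc)|exact: s2].
- move=> x [bu bv]; have bu' := lt_le_trans bu q2q; have bv' := lt_le_trans bv q2q.
  suff : f x = root_ext ev (fold x) + cv x ^+ 3 * root_ext (quot 3%N od) (fold x) by rewrite /f mulrDr => e; lra.
  rewrite /root_ext /fold !cu_rv2 !cv_rv2 exprn_even_gt0 //= sqrtr_sqr.
  have [x0|x0] := eqVneq (cv x) 0.
    rewrite mulr0 addr0 -[x in LHS]rv2K x0.
    by apply: (ff 1%N 0%N).
  have bx' : box q (rv2 (cu x) `|cv x|) by apply: box_rv2; rewrite ?normr_id.
  have := quotK (fo 3%N) bx'; rewrite cv_rv2.
  set Q := quot _ _ _; rewrite /od /ev /= /flip !cu_rv2 !cv_rv2.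
  (* The root extensions are read at |v|. For negative v the even part keeps its value there, while
     the odd part changes sign together with v^3. *)
  have [p|p] := ger0P (cv x).
    rewrite (_ : f x = f (rv2 (cu x) (cv x))); last by rewrite rv2K.
    move: (f (rv2 (cu x) (cv x))) (f (rv2 (cu x) (- cv x))) => A B h.
    by rewrite -h; field.
  rewrite opprK (_ : f x = f (rv2 (cu x) (cv x))); last by rewrite rv2K.
  move: (f (rv2 (cu x) (cv x))) (f (rv2 (cu x) (- cv x))) => A B h.
  have -> : cv x ^+ 3 * Q = - ((- cv x) ^+ 3 * Q) by ring.
  by rewrite -h; field.
(* Root extensions vanish on the axis, so [be 0] is the value of [c], the third v-derivative of z
   divided by 3!. *)
- have := hc 0%N 0; rewrite normr0 => /(_ r20) /=.
  rewrite /jet /= /root_ext cv0 ltxx addr0.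
  have e0 : rv2 0 0 = 0 :> P by rewrite -[RHS]rv2K cu0 cv0.
  have idn (w : R) : 6 * (1 / 6%N%:R * w) = w by field.
  by rewrite e0 => ->; rewrite fact0 (_ : 3`! = 6%N) //; exact: idn.
Qed.

End EvenOddSplitting.

(** * Local diffeomorphisms and the cuspidal edge *)

Section ParametricInverse.
Variable R : realType.
Local Notation P := 'rV[R]_2.

Lemma diff2E (f : P -> R) x w : differentiable f x ->
  'd f x w = cu w * pd0 f x + cv w * pd1 f x.
Proof.
move=> df; have {1}-> : w = cu w *: rv2 1 0 + cv w *: rv2 0 1.
  rewrite -[LHS]rv2K; apply/rowP => i; rewrite !mxE; case: ifP => _.
    by rewrite mulr1 mulr0 addr0.
  by rewrite mulr1 mulr0 add0r.
by rewrite linearD !linearZ.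
Qed.

Lemma cuD (x y : P) : cu (x + y) = cu x + cu y. Proof. by rewrite /cu mxE. Qed.

Lemma cvD (x y : P) : cv (x + y) = cv x + cv y. Proof. by rewrite /cv mxE. Qed.

Lemma norm_cu (x : P) : `|cu x| <= `|x|. Proof. by rewrite norm_rv2 le_max lexx. Qed.

Lemma norm_cv (x : P) : `|cv x| <= `|x|. Proof. by rewrite norm_rv2 le_max lexx orbT. Qed.

(** Implicit differentiation: the linearisation of [h] at [K x] is solved for the increment of [k].
    Continuity of [k] brings that increment within the range where the linearisation is valid. *)
Lemma inverse_differentiable (h k : P -> R) (x : P) (m : R) :
  let K y := rv2 (cu y) (k y) in
  differentiable h (K x) -> 0 < m -> m <= pd1 h (K x) -> {for x, continuous k} ->
  (\forall y \near x, h (K y) = cv y) ->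
  differentiable k x /\ forall w, 'd k x w = (cv w - cu w * pd0 h (K x)) / pd1 h (K x).
Proof.
move=> K dh m0 mp ck hK; set p0 := pd0 h (K x); set p1 := pd1 h (K x) in mp *.
have p10 : 0 < p1 by exact: lt_le_trans mp.
pose L (w : P) : R := (cv w - cu w * p0) / p1.
have lL : linear L.
  move=> a u v; rewrite /L /cu /cv !mxE -[a *: (_ / _)]/(a * (_ / _)).
  by field; rewrite gt_eqF.
pose Lm := GRing.isLinear.Build _ _ _ _ _ lL.
pose Ll : {linear P -> R} := HB.pack L Lm.
have cL : continuous Ll.
  move=> y; apply: (@smat_continuous R P R L).
  apply: (@smatM R P (fun w => cv w - cu w * p0) (fun=> p1^-1)); last exact: smat_cst.
  apply: (@smatB R P (@cv R)); first exact: smat_cv.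
  by apply: (@smatM R P (@cu R)); [exact: smat_cu|exact: smat_cst].
have [] := @diff_of_bound R P R k Ll x cL; last first.
  by move=> dk E; split=> // w; exact: (congr1 (fun g => g w) E).
move=> e e0.
(* a priori bound [|dk| <= c |w|], then the error is at most [e' (1 + c) / p1] *)
pose c := 2 * (1 + `|p0| + p1) / p1.
have c0 : 0 < c by rewrite divr_gt0 // mulr_gt0 // ltr_wpDl // addr_ge0.
pose e' := Num.min (p1 / 2) (e * p1 / (1 + c)).
have c1 : 0 < 1 + c by rewrite addr_gt0.
have e'0 : 0 < e' by rewrite lt_min !divr_gt0 // mulr_gt0.
have e'1 : e' <= p1 / 2 by rewrite ge_min lexx.
have e'2 : e' * (1 + c) <= e * p1 by rewrite -ler_pdivlMr // ge_min lexx orbT.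
clearbody e'.
have /nbhs2P[d1 d10 hd1] := diff_bound dh e'0.
have [d2 d20 hd2] := (iffLR (cvg2P x k)) ck _ (divr_gt0 d10 (ltr0n R 2)).
have /nbhs2P[d3 d30 hd3] := hK.
have hKx : h (K x) = cv x by apply: hd3; rewrite subrr normr0.
apply/nbhs2P; exists (Num.min d1 (Num.min d2 d3)); first by rewrite !lt_min d10 d20.
move=> w; rewrite cu0 cv0 !subr0 !lt_min => /and3P[u1 u2 u3] /and3P[v1 v2 v3].
rewrite /= /L; pose dk := k (w + x) - k x.
have ewu : cu (w + x) - cu x = cu w by rewrite cuD addrK.
have ewv : cv (w + x) - cv x = cv w by rewrite cvD addrK.
have dkd : `|dk| < d1.
  apply: (@le_lt_trans _ _ (d1 / 2)); first by apply: hd2; rewrite ?ewu ?ewv.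
  by rewrite ltr_pdivrMr // ltr_pMr // ltr1n.
have hKw : h (K (w + x)) = cv (w + x) by apply: hd3; rewrite ?ewu ?ewv.
have := hd1 (rv2 (cu w) dk); rewrite cu0 cv0 !subr0 cu_rv2 cv_rv2 => /(_ u1 dkd).
have -> : rv2 (cu w) dk + K x = K (w + x).
  rewrite -[LHS]rv2K cuD cvD !cu_rv2 !cv_rv2 /K /dk cuD.
  by rewrite subrK.
rewrite hKw hKx cvD (diff2E _ dh) cu_rv2 cv_rv2 -/p0 -/p1 norm_rv2 cu_rv2 cv_rv2 => H.
have wu := norm_cu w; have wv := norm_cv w.
have Hd : Num.max `|cu w| `|dk| <= `|w| + `|dk|.
  by rewrite ge_max; apply/andP; split; [apply: (le_trans wu); rewrite lerDl|rewrite lerDr].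
have {}H : `|cv w - (cu w * p0 + dk * p1)| <= e' * (`|w| + `|dk|).
  apply: (le_trans _ (le_trans H _)); last by rewrite ler_wpM2l // ltW.
  by rewrite le_eqVlt; apply/orP; left; apply/eqP; congr `| _ |; ring.
have {}Hk : `|dk| <= c * `|w|.
  have h1 : `|dk * p1| <= `|w| + `|p0| * `|w| + e' * (`|w| + `|dk|).
    have -> : dk * p1 = cv w - cu w * p0 - (cv w - (cu w * p0 + dk * p1)) by ring.
    apply: (le_trans (ler_normB _ _)); apply: lerD => //.
    apply: (le_trans (ler_normB _ _)); apply: lerD => //.
    by rewrite normrM mulrC ler_wpM2l.
  have h2 : e' * (`|w| + `|dk|) <= p1 / 2 * (`|w| + `|dk|) by rewrite ler_wpM2r // addr_ge0.
  rewrite normrM [`|p1|]gtr0_norm // in h1.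
  have h3 : `|dk| * p1 <= 2 * (1 + `|p0| + p1) * `|w|.
    have alg (D W Q p E : R) : D * p <= W + Q * W + E -> E <= p / 2 * (W + D) ->
      0 <= p * W -> D * p <= 2 * (1 + Q + p) * W by lra.
    exact: alg h1 h2 (mulr_ge0 (ltW p10) (normr_ge0 w)).
  by rewrite /c mulrAC ler_pdivlMr.
have -> : k (w + x) - (k x + (cv w - cu w * p0) / p1) =
  - ((cv w - (cu w * p0 + dk * p1)) / p1) by rewrite /dk; field; rewrite gt_eqF.
rewrite normrN normrM normfV [`|p1|]gtr0_norm // ler_pdivrMr //.
apply: (le_trans H); apply: (@le_trans _ _ (e' * ((1 + c) * `|w|))).
  by rewrite ler_wpM2l ?(ltW e'0) // mulrDl mul1r lerD2l.
by rewrite mulrA [e * _ * _]mulrAC ler_wpM2r.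
Qed.

Lemma pd1_increase (h : P -> R) r m u s t : smbox r h -> (forall x, box r x -> m <= pd1 h x) ->
  `|u| < r -> `|s| < r -> `|t| < r -> s <= t -> m * (t - s) <= h (rv2 u t) - h (rv2 u s).
Proof.
move=> sh hm ur; rewrite !ltr_norml => /andP[s1 s2] /andP[t1 t2] st.
have inr (c : R) : s <= c <= t -> `|c| < r by move=> /andP[? ?]; rewrite ltr_norml; lra.
have [||c] := @MVT_segment R (fun v => h (rv2 u v)) (fun v => pd1 h (rv2 u v)) s t st.
- move=> c; rewrite in_itv /= => /andP[c1 c2].
  by apply/is_derive_pd1/sh/box_rv2 => //; apply: inr; rewrite !ltW.
- apply: continuous_in_subspaceT => c; rewrite inE /= in_itv /= => hc.
  by apply: is_derive_continuous; apply/is_derive_pd1/sh/box_rv2 => //; exact: inr.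
rewrite in_itv /= => hc ->; rewrite ler_wpM2r ?subr_ge0 //.
by apply/hm/box_rv2 => //; exact: inr.
Qed.

(** Quantitative injectivity in v, the source of both continuity and uniqueness of the fibrewise
    inverse. *)
Lemma pd1_expand (h : P -> R) r m u s t : smbox r h -> (forall x, box r x -> m <= pd1 h x) ->
  0 < m -> `|u| < r -> `|s| < r -> `|t| < r ->
  m * `|t - s| <= `|h (rv2 u t) - h (rv2 u s)|.
Proof.
move=> sh hm m0 ur sr tr; have [st|ts] := leP s t.
  rewrite ger0_norm ?subr_ge0 //; apply: (le_trans (pd1_increase sh hm ur sr tr st)).
  exact: ler_norm.
rewrite distrC [leRHS]distrC gtr0_norm ?subr_gt0 //.
by apply: (le_trans (pd1_increase sh hm ur tr sr (ltW ts))); exact: ler_norm.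
Qed.

(** The map (u, v) -> (u, h) preserves every vertical line, so the inverse function theorem reduces
    to the intermediate value theorem on each line. Monotonicity gives uniqueness and continuity in
    both variables. *)
Theorem parametric_inverse (h : P -> R) : smat 0 h -> (\forall u \near (0 : R), h (rv2 u 0) = 0) ->
  0 < pd1 h 0 -> exists k : P -> R, [/\ smat 0 k, k 0 = 0,
    \forall x \near (0 : P), k (rv2 (cu x) (h x)) = cv x &
    \forall x \near (0 : P), h (rv2 (cu x) (k x)) = cv x].
Proof.
move=> sh0 h0 hp; pose m := pd1 h 0 / 2.
have m0 : 0 < m by rewrite divr_gt0.
have em : pd1 h 0 = m + m by rewrite -splitr.
have [r1 r10 sh1] := smat_smbox sh0.
have [r2 r20 hr2] := (iffLR (cvg2P _ _)) (smat_continuous (smat_pd1 sh0)) _ m0.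
have /nbhs_ballP[r3 r30 hr3] := h0.
pose r := Num.min r1 (Num.min r2 r3).
have r0 : 0 < r by rewrite !lt_min r10 r20.
have [rr1 [rr2 rr3]] : r <= r1 /\ r <= r2 /\ r <= r3.
  by have : r <= r by []; rewrite {2}/r !le_min => /and3P[].
have sh := smbox_le rr1 sh1.
have hm x : box r x -> m <= pd1 h x.
  move=> [xu xv]; have := hr2 x; rewrite cu0 cv0 !subr0.
  move=> /(_ (lt_le_trans xu rr2) (lt_le_trans xv rr2)); rewrite ler_norml => /andP[h1 _].
  by move: h1; rewrite em lerBrDr addKr.
have hz (u : R) : `|u| < r -> h (rv2 u 0) = 0.
  by move=> ur; apply: hr3; rewrite /ball /= sub0r normrN; exact: lt_le_trans ur rr3.
clear em; clearbody r m.
(* Heights up to [d] stay inside the box. Since [h] vanishes on the axis and has slope at least [m],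
   its values on such a vertical segment cover (-m d, m d). *)
pose d := r / 2; have d0 : 0 < d by rewrite divr_gt0.
have dr : d < r by rewrite ltr_pdivrMr // ltr_pMr // ltr1n.
have z0 : `|0 : R| < r by rewrite normr0.
have dn : `|d| < r by rewrite gtr0_norm.
have dn' : `|- d| < r by rewrite normrN gtr0_norm.
have ch (u t : R) : `|u| < r -> `|t| < r -> {for t, continuous (fun t => h (rv2 u t))}.
  move=> ur tr; apply: (is_derive_continuous (L := pd1 h (rv2 u t))).
  exact/is_derive_pd1/sh/box_rv2.
have exk (x : P) : exists t, `|cu x| < d -> `|cv x| < m * d -> `|t| <= d /\ h (rv2 (cu x) t) = cv x.
  have [xu|] := boolP (`|cu x| < d); last by exists 0.
  have [xv|] := boolP (`|cv x| < m * d); last by exists 0.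
  have ur := lt_trans xu dr.
  have h1 := pd1_increase sh hm ur z0 dn (ltW d0); rewrite hz // !subr0 in h1.
  have nd : - d <= 0 by rewrite oppr_le0 ltW.
  have h2 := pd1_increase sh hm ur dn' z0 nd; rewrite hz // sub0r opprK in h2.
  have dd : - d <= d by lra.
  have [||t] := @IVT R (fun t => h (rv2 (cu x) t)) (- d) d (cv x) dd.
  - apply: continuous_in_subspaceT => t; rewrite inE /= in_itv /= => /andP[t1 t2].
    by apply: ch => //; apply: le_lt_trans dr; rewrite ler_norml t1.
  - rewrite ge_min le_max; move: xv; rewrite ltr_norml => /andP[v1 v2].
    by apply/andP; split; apply/orP; [left|right]; lra.
  rewrite in_itv /= => /andP[t1 t2] ht; exists t => _ _; split => //.
  by rewrite ler_norml t1.
have [k hk] := choice exk.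
pose q := Num.min d (m * d); have q0 : 0 < q by rewrite lt_min d0 mulr_gt0.
have hq x : box q x -> [/\ `|cu x| < r, `|k x| < r & h (rv2 (cu x) (k x)) = cv x].
  move=> []; rewrite !lt_min => /andP[u1 _] /andP[_ v2].
  by have [k1 k2] := hk x u1 v2; split => //; [exact: lt_trans u1 dr|exact: le_lt_trans k1 dr].
clearbody q.
pose K x := rv2 (cu x) (k x).
have bK x : box q x -> box r (K x) by move=> /hq[h1 h2 _]; exact: box_rv2.
have nq x : box q x -> \forall y \near x, box q y.
  by move=> bx; apply: open_nbhs_nbhs; split => //; exact: open_box.
have ck x : box q x -> {for x, continuous k}.
  move=> bx; have [xu xk xh] := hq x bx; apply/cvg2P => e e0.
  have me : 0 < m * e / 2 by rewrite divr_gt0 // mulr_gt0.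
  have /nbhs2P[d1 d10 hd1] := nq x bx.
  have [d2 d20 hd2] := (iffLR (cvg2P _ _)) (smat_continuous (sh _ (bK x bx))) _ me.
  exists (Num.min (Num.min d1 d2) (m * e / 2)); first by rewrite !lt_min d10 d20.
  move=> y; rewrite !lt_min => /andP[/andP[u1 u2] _] /andP[/andP[v1 v2] v3].
  have [yu yk yh] := hq y (hd1 y u1 v1).
  rewrite -(ler_pM2l m0); apply: (le_trans (pd1_expand sh hm m0 yu xk yk)).
  rewrite yh; have := hd2 (rv2 (cu y) (k x)); rewrite /K !cu_rv2 !cv_rv2 subrr normr0.
  move=> /(_ u2 d20); rewrite xh => H.
  have -> : cv y - h (rv2 (cu y) (k x)) = (cv y - cv x) - (h (rv2 (cu y) (k x)) - cv x) by ring.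
  apply: (le_trans (ler_normB _ _)); apply: (le_trans (lerD (ltW v3) H)).
  by rewrite -splitr.
have dk x : box q x -> differentiable k x /\
    forall w, 'd k x w = (cv w - cu w * pd0 h (K x)) / pd1 h (K x).
  move=> bx; have bKx := bK x bx.
  have nh : \forall y \near x, h (rv2 (cu y) (k y)) = cv y.
    by apply: filterS (nq x bx) => y /hq[].
  exact: (inverse_differentiable (smat_differentiable (sh _ bKx)) m0 (hm _ bKx) (ck x bx) nh).
have oq := open_box q.
(* Bootstrap: if [k] has class n then so has [K], and the formula in [dk] expresses the differential
   of [k] through [K] and the smooth partial derivatives of [h]. *)
have sk : smooth_on (box q) k.
  elim=> [|n IH]; first exact: ck.
  have CK : Ck n (box q) K.
    apply/Ck_rV => // i; rewrite (_ : (fun x => _) = if val i == 0%N then @cu R else k).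
      by case: ifP => // _; apply: (@smat_smooth_on R P R) => x _; exact: smat_cu.
    by apply/funext => x; rewrite mxE; case: ifP.
  have so (g : P -> R) : smbox r g -> Ck n (box r) g by move=> sg; exact: smat_smooth_on.
  have C0 : Ck n (box q) (fun x => pd0 h (K x)).
    exact: (Ck_comp (has_coords_rV R 2) oq bK CK (so _ (fun x bx => smat_pd0 (sh x bx)))).
  have C2 : Ck n (box q) (fun x => pd1 h (K x)).
    exact: (Ck_comp (has_coords_rV R 2) oq bK CK (so _ (fun x bx => smat_pd1 (sh x bx)))).
  have nz x : box q x -> [set x : R | x != 0] (pd1 h (K x)).
    by move=> bx; exact: lt0r_neq0 (lt_le_trans m0 (hm _ (bK x bx))).
  have C1 : Ck n (box q) (fun x => (pd1 h (K x))^-1).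
    exact: (Ck_comp (has_coords_R R) oq nz C2 (@smooth_inv R n)).
  split=> [x /dk[] //|w].
  apply: (@Ck_ext R P R n (box q) (fun x => (cv w + (- cu w) * pd0 h (K x)) * (pd1 h (K x))^-1)) => //.
    by move=> x /dk[_ ->]; rewrite mulNr.
  apply: (@CkM R P n _ (fun x => cv w + (- cu w) * pd0 h (K x))) => //.
  apply: (@CkD R P R n _ (fun=> cv w) (fun x => (- cu w) * pd0 h (K x))) => //; first exact: Ck_cst.
  by apply: (@CkM R P n _ (fun=> - cu w)) => //; exact: Ck_cst.
have b0 : box q (0 : P) by split; rewrite ?cu0 ?cv0 normr0.
have e0 : rv2 0 0 = 0 :> P by rewrite -[RHS]rv2K cu0 cv0.
have kun (u t v : R) : box q (rv2 u v) -> `|t| < r -> h (rv2 u t) = v -> k (rv2 u v) = t.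
  move=> bx tr ht; have [xu xk xh] := hq _ bx; rewrite cu_rv2 cv_rv2 in xu xh.
  have := pd1_expand sh hm m0 xu tr xk; rewrite xh ht subrr normr0 pmulr_rle0 // normr_le0 subr_eq0.
  by move=> /eqP.
exists k; split.
- exact: smooth_on_smat oq sk b0.
- by rewrite -e0; apply: kun; rewrite ?e0 ?normr0 // -e0 hz.
- have bh : {for (0 : P), continuous h} by exact: smat_continuous.
  have h00 : h 0 = 0 by rewrite -e0 hz.
  have [d1 d10 hd1] := (iffLR (cvg2P _ _)) bh _ (divr_gt0 q0 (ltr0n R 2)).
  apply/nbhs2P; exists (Num.min d1 (Num.min q r)); first by rewrite !lt_min d10 q0.
  move=> x; rewrite cu0 cv0 !subr0 !lt_min => /and3P[u1 u2 u3] /and3P[v1 v2 v3].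
  apply: kun => //; last by rewrite rv2K.
  apply: box_rv2 => //; have := hd1 x; rewrite cu0 cv0 !subr0 h00 subr0 => /(_ u1 v1) H.
  by apply: (le_lt_trans H); rewrite ltr_pdivrMr // ltr_pMr // ltr1n.
- by apply: filterS (nq 0 b0) => x /hq[].
Qed.

End ParametricInverse.

(** * Germs of diffeomorphisms and equivalence of map germs *)

Section LocalDiffeomorphisms.
Variable R : realType.

(** The inverse germ is required on both sides, so that composition needs no choice of domains and
    the openness of images can be recovered afterwards. *)
Definition ldiff n (phi : 'rV[R]_n -> 'rV[R]_n) (x : 'rV[R]_n) := exists psi,
  [/\ smat x phi, smat (phi x) psi, \forall y \near x, psi (phi y) = y &
      \forall y \near phi x, phi (psi y) = y].

Lemma smat_near_image n (phi : 'rV[R]_n -> 'rV[R]_n) x (A : 'rV[R]_n -> Prop) :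
  smat x phi -> (\forall y \near phi x, A y) -> \forall y \near x, A (phi y).
Proof. by move=> /smat_continuous cp nA; exact: cp nA. Qed.

Lemma ldiff_comp n (phi chi : 'rV[R]_n -> 'rV[R]_n) x :
  ldiff phi x -> ldiff chi (phi x) -> ldiff (chi \o phi) x.
Proof.
move=> [psi [s1 s2 e1 e2]] [om [t1 t2 f1 f2]].
have px : psi (phi x) = x by exact: nbhs_singleton e1.
have ox : om (chi (phi x)) = phi x by exact: nbhs_singleton f1.
exists (psi \o om); split.
- exact: (smat_comp_rV (has_coords_rV R n) s1 t1).
- by apply: (smat_comp_rV (has_coords_rV R n) t2); rewrite ox.
- by apply: filterS2 e1 (smat_near_image s1 f1) => y /= e f; rewrite f.
- rewrite -ox in e2.
  by apply: filterS2 f2 (smat_near_image t2 e2) => y /= f e; rewrite e.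
Qed.

(** On U = V with phi landing in W, the image is W intersected with the preimage of V under the
    inverse, hence open. The predicate [A] lets U be shrunk further as the application demands. *)
Lemma ldiff_diffeo n (phi : 'rV[R]_n -> 'rV[R]_n) x (A : 'rV[R]_n -> Prop) : ldiff phi x ->
  (\forall y \near x, A y) -> exists U, [/\ U x, diffeo_on U phi & forall y, U y -> A y].
Proof.
move=> [psi [s1 s2 e1 e2]] nA.
pose V := [set y | [/\ smat y phi, psi (phi y) = y & A y]]^°.
pose W := [set z | smat z psi /\ phi (psi z) = z]^°.
have oV : open V by exact: open_interior.
have oW : open W by exact: open_interior.
have Vx : V x.
  have h : \forall y \near x, [/\ smat y phi, psi (phi y) = y & A y].
    by apply: filterS3 (smat_near s1) e1 nA.
  exact: h.
have Wx : W (phi x).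
  have h : \forall z \near phi x, smat z psi /\ phi (psi z) = z.
    by apply: filterS2 (smat_near s2) e2.
  exact: h.
have hV y : V y -> [/\ smat y phi, psi (phi y) = y & A y] by move=> /interior_subset.
have hW z : W z -> smat z psi /\ phi (psi z) = z by move=> /interior_subset.
pose U := V `&` phi @^-1` W.
have oU : open U.
  rewrite openE => y [Vy Wy]; have [sy _ _] := hV y Vy.
  apply: (@filterS2 _ (nbhs y) _ V (fun z => W (phi z))) => //.
    exact: open_nbhs_nbhs.
  by apply: (smat_near_image sy); exact: open_nbhs_nbhs.
have im : phi @` U = W `&` psi @^-1` V.
  apply/seteqP; split=> [_ [y [Vy Wy] <-]|z [Wz Vz]].
    by split => //=; have [_ -> _] := hV y Vy.
  by have [_ e] := hW z Wz; exists (psi z) => //; split; [exact: Vz|rewrite /preimage /= e].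
have oI : open (phi @` U).
  rewrite im openE => z [Wz Vz]; have [sz _] := hW z Wz.
  apply: (@filterS2 _ (nbhs z) _ W (fun z => V (psi z))) => //.
    exact: open_nbhs_nbhs.
  by apply: (smat_near_image sz); exact: open_nbhs_nbhs.
exists U; split; [by split| |by move=> y [/hV[]]].
split=> //; split; first by apply: smat_smooth_on => y [/hV[]].
split=> //; exists psi; split; last by move=> y [/hV[]].
by rewrite im; apply: smat_smooth_on => z [/hW[]].
Qed.

(** The target domain is fixed first; continuity of [f] then allows the source domain to be shrunk
    until its image lies inside. *)
Lemma A_equiv_germ m (D : set 'rV[R]_2) (f g : 'rV[R]_2 -> 'rV[R]_m) p q phi Psi :
  ldiff phi q -> phi q = p -> ldiff Psi (f p) -> {for p, continuous f} ->
  (\forall x \near p, D x) -> (\forall x \near q, Psi (f (phi x)) = g x) ->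
  A_equiv D f p g q.
Proof.
move=> lphi pq lPsi cf nD eq.
have [W [Wp dW _]] := @ldiff_diffeo m Psi (f p) (fun=> True) lPsi (@filterT _ _ _).
have nW : \forall y \near p, W (f y).
  by apply: cf; have [oW _] := dW; exact: open_nbhs_nbhs.
have [phi' [s1 _ _ _]] := lphi; rewrite -pq in nD nW.
have nA : \forall x \near q, [/\ D (phi x), W (f (phi x)) & Psi (f (phi x)) = g x].
  by apply: filterS3 (smat_near_image s1 nD) (smat_near_image s1 nW) eq.
have [U [Uq dU hU]] := ldiff_diffeo lphi nA.
exists U, phi, W, Psi; split => //; split => //; split => //.
by rewrite -pq; exact: nbhs_singleton eq.
Qed.

End LocalDiffeomorphisms.

(** * Exclusion of the cross cap *)

Section CrosscapExclusion.
Variable R : realType.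

Lemma rv4_eq (a b c d a' b' c' d' : R) : rv4 a b c d = rv4 a' b' c' d' ->
  [/\ a = a', b = b', c = c' & d = d'].
Proof.
move=> e; have h k : rv4 a b c d ord0 (inord k) = rv4 a' b' c' d' ord0 (inord k) by rewrite e.
have h0 := h 0%N; have h1 := h 1%N; have h2 := h 2%N; have h3 := h 3%N.
by rewrite !mxE /= !inordK // in h0 h1 h2 h3.
Qed.

Lemma cuspidal_edge_nf_inj : injective (@cuspidal_edge_nf R).
Proof.
move=> x y /rv4_eq[hu h2 h3 _]; rewrite -(rv2K x) -(rv2K y) hu.
congr rv2; have [x0|x0] := eqVneq (cv x) 0.
  by move: h2; rewrite x0 expr0n /= => /esym/eqP; rewrite expf_eq0 /= => /eqP.
have : cv x * cv x ^+ 2 = cv y * cv x ^+ 2 by rewrite {2}h2 -!exprS.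
by move=> /mulIf; apply; rewrite expf_neq0.
Qed.

(* A cuspidal edge is injective, while the cross cap identifies (0, v) and (0, -v). *)
Lemma cuspidal_edge_not_crosscap (D : set 'rV[R]_2) f p :
  is_cuspidal_edge D f p -> ~ is_cuspidal_crosscap D f p.
Proof.
move=> [U [phi [W [Psi [[U0 [dU phi0]] _ H]]]]].
move=> [U' [phi' [W' [Psi' [[U0' [dU' phi0']] [_ [dW' _]] H']]]]].
have [oU [sU [oI _]]] := dU; have [oU' [sU' [_ [psi' [_ psi'K]]]]] := dU'.
have [_ [_ [_ [Xi [_ XiK]]]]] := dW'.
have cphi' : {for (0 : 'rV[R]_2), continuous phi'}.
  by apply: smat_continuous; exact: smooth_on_smat oU' sU' U0'.
have n1 : \forall x \near (0 : 'rV[R]_2), (phi @` U) (phi' x).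
  by apply: cphi'; apply: open_nbhs_nbhs; split => //; exists 0 => //; rewrite phi0 phi0'.
have n2 : \forall x \near (0 : 'rV[R]_2), U' x by exact: open_nbhs_nbhs.
have /nbhs2P[e e0 he] : \forall x \near (0 : 'rV[R]_2), (phi @` U) (phi' x) /\ U' x.
  by apply: filterS2 n1 n2.
pose v := e / 2; have v0 : 0 < v by rewrite divr_gt0.
have ve : v < e by rewrite ltr_pdivrMr // ltr_pMr // ltr1n.
have [] := he (rv2 0 v); rewrite ?cu0 ?cv0 ?cu_rv2 ?cv_rv2 ?subrr ?subr0 ?normr0 ?gtr0_norm //.
move=> [x Ux ex] Uv.
have [] := he (rv2 0 (- v)); rewrite ?cu0 ?cv0 ?cu_rv2 ?cv_rv2 ?subrr ?subr0 ?normr0 ?normrN ?gtr0_norm //.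
move=> [y Uy ey] Uv'.
have [_ w1 c1] := H' _ Uv; have [_ w2 c2] := H' _ Uv'.
have ff : f (phi' (rv2 0 v)) = f (phi' (rv2 0 (- v))).
  rewrite -(XiK _ w1) -(XiK _ w2) c1 c2 /cuspidal_crosscap_nf !cu_rv2 !cv_rv2.
  by rewrite !mul0r sqrrN.
have [_ _ d1] := H _ Ux; have [_ _ d2] := H _ Uy.
have xy : x = y by apply: cuspidal_edge_nf_inj; rewrite -d1 -d2 ex ey ff.
have vv : rv2 0 v = rv2 0 (- v) :> 'rV[R]_2 by rewrite -(psi'K _ Uv) -(psi'K _ Uv') -ex -ey xy.
have := congr1 (@cv R) vv; rewrite !cv_rv2 => h.
by have := v0; rewrite h oppr_gt0 ltNge (ltW v0).
Qed.

End CrosscapExclusion.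

#[local] Opaque pd0 pd1.

(** * Normal form of the map (u, Y, Z) *)

Section CuspNormalForm.
Variable R : realType.
Local Notation P := 'rV[R]_2.

Lemma coord4_rv4 (a b c d : R) : (coord4 (rv4 a b c d) 0 = a) * (coord4 (rv4 a b c d) 1 = b) *
  (coord4 (rv4 a b c d) 2 = c) * (coord4 (rv4 a b c d) 3 = d).
Proof. by rewrite /coord4 !mxE /= !inordK. Qed.

Lemma rv4K (w : 'rV[R]_4) : rv4 (coord4 w 0) (coord4 w 1) (coord4 w 2) (coord4 w 3) = w.
Proof.
apply/rowP => i; rewrite mxE /coord4.
by case: i => [[|[|[|[|]]]] hi] //=; congr (w _ _); apply: val_inj; rewrite /= inordK.
Qed.

Lemma smat_coord4 i (w : 'rV[R]_4) : smat w (fun w => coord4 w i).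
Proof. exact: smat_coord. Qed.

Lemma smat_rv4 (V : normedModType R) (a b c d : V -> R) x : smat x a -> smat x b -> smat x c ->
  smat x d -> smat x (fun y => rv4 (a y) (b y) (c y) (d y)).
Proof.
move=> sa sb sc sd; apply/smat_rV => i.
rewrite (_ : (fun y => _) = match val i with 0%N => a | 1%N => b | 2%N => c | _ => d end).
  by case: (val i) => [|[|[|]]].
by apply/funext => y; rewrite mxE; case: (val i) => [|[|[|]]].
Qed.

Lemma rv200 : rv2 0 0 = 0 :> P.
Proof. by rewrite -[RHS]rv2K cu0 cv0. Qed.

Lemma smat_graph (k : P -> R) x : smat x k -> smat x (fun y => rv2 (cu y) (k y)).
Proof. by move=> sk; apply: smat_rv2 => //; exact: smat_cu. Qed.

Lemma smat_at_graph (g k : P -> R) x : smat x k -> smat (rv2 (cu x) (k x)) g ->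
  smat x (fun y => g (rv2 (cu y) (k y))).
Proof.
by move=> sk sg; apply: (smat_comp (has_coords_rV R 2) (smat_graph sk) sg).
Qed.

Lemma pd1_graph (g k : P -> R) x : smat x k -> smat (rv2 (cu x) (k x)) g ->
  pd1 (fun y => g (rv2 (cu y) (k y))) x = pd1 g (rv2 (cu x) (k x)) * pd1 k x.
Proof.
move=> sk sg; apply: pd1E; first exact: smat_at_graph.
rewrite (_ : (fun v => _) = (fun v => g (rv2 (cu x) (k (rv2 (cu x) v))))); last first.
  by apply/funext => v; rewrite cu_rv2.
apply: (@der_comp R (fun v => k (rv2 (cu x) v)) (fun t => g (rv2 (cu x) t))).
  exact: (proj2 (smat_partials sk)).
by rewrite rv2K; exact: is_derive_pd1.
Qed.

Lemma pd1M (f g : P -> R) x : smat x f -> smat x g ->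
  pd1 (fun y => f y * g y) x = pd1 f x * g x + f x * pd1 g x.
Proof.
move=> sf sg; apply: pd1E; first exact: smatM.
apply: der_eq (derM (proj2 (smat_partials sf)) (proj2 (smat_partials sg))) _.
by rewrite rv2K addrC mulrC.
Qed.

Lemma pd1D (f g : P -> R) x : smat x f -> smat x g ->
  pd1 (fun y => f y + g y) x = pd1 f x + pd1 g x.
Proof.
move=> sf sg; apply: pd1E; first exact: smatD.
exact: derD (proj2 (smat_partials sf)) (proj2 (smat_partials sg)).
Qed.

Lemma pd1_cst (c : R) x : pd1 (fun=> c) x = 0.
Proof. by apply: pd1E; [exact: smat_cst|exact: der_cst]. Qed.

Lemma pd1_cv x : pd1 (@cv R) x = 1.
Proof.
apply: pd1E; first exact: smat_cv.
rewrite (_ : (fun v => _) = id); first exact: der_id.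
by apply/funext => v; rewrite cv_rv2.
Qed.

Lemma pd1_near (f g : P -> R) x : smat x f -> (\forall y \near x, f y = g y) ->
  \forall y \near x, pd1 f y = pd1 g y.
Proof.
move=> sf fg; pose U := [set y | smat y f /\ f y = g y]^°.
have oU : open U by exact: open_interior.
have Ux : U x.
  have h : \forall y \near x, smat y f /\ f y = g y by apply: filterS2 (smat_near sf) fg.
  exact: h.
have hU y : U y -> smat y f /\ f y = g y by move=> /interior_subset.
have nU : \forall y \near x, U y by exact: open_nbhs_nbhs.
apply: filterS nU => y Uy.
by have [] := @pd_ext R U f g oU (fun x Ux => proj1 (hU x Ux)) (fun x Ux => proj2 (hU x Ux)) y Uy.
Qed.

Lemma near_axis (A : P -> Prop) : (\forall x \near (0 : P), A x) -> \forall u \near (0 : R), A (rv2 u 0).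
Proof.
move=> /nbhs2P[e e0 he]; apply/nbhs_ballP; exists e => // u.
rewrite /ball /= sub0r normrN => ue.
by apply: he; rewrite ?cu0 ?cv0 ?cu_rv2 ?cv_rv2 subr0 ?normr0.
Qed.

Lemma near_axisP (A : R -> Prop) : (\forall u \near (0 : R), A u) -> exists2 r, 0 < r & forall u, `|u| < r -> A u.
Proof.
move=> /nbhs_ballP[r r0 hr]; exists r => // u ur; apply: hr.
by rewrite /ball /= sub0r normrN.
Qed.

Lemma smat_axis (Y : P -> R) (V : normedModType R) (g : V -> R) x : smat x g -> smat (rv2 (g x) 0) Y ->
  smat x (fun y => Y (rv2 (g y) 0)).
Proof.
move=> sg sY; apply: (smat_comp (f := fun y => rv2 (g y) 0) (has_coords_rV R 2)) => //.
by apply: smat_rv2 => //; exact: smat_cst.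
Qed.

Lemma smat_near_neq0 (V : normedModType R) (g : V -> R) x : smat x g -> g x != 0 ->
  \forall y \near x, g y != 0.
Proof.
move=> sg gx; have n : nbhs (g x) [set z : R | z != 0].
  by apply: open_nbhs_nbhs; split => //; exact: open_neq.
exact: smat_continuous sg _ n.
Qed.

(** After division by [c], whatever its sign, the vertical increment of [Y] is v^2 B with B = 1/2 at
    the origin. Thus sqrt B is smooth there, v sqrt B is an admissible vertical coordinate, and [k]
    is its inverse. *)
Lemma fold_coordinate (Y : P -> R) (c : R) : smat 0 Y -> c != 0 -> pd1 (pd1 Y) 0 = c ->
  (\forall u \near (0 : R), pd1 Y (rv2 u 0) = 0) ->
  exists k : P -> R, [/\ smat 0 k, ldiff (fun x => rv2 (cu x) (k x)) 0, k 0 = 0 /\ pd1 k 0 != 0,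
    \forall u \near (0 : R), k (rv2 u 0) = 0 &
    \forall x \near (0 : P), (Y (rv2 (cu x) (k x)) - Y (rv2 (cu x) 0)) / c = cv x ^+ 2].
Proof.
have half (a b : R) : 0 < a -> - (a / 2) <= b - a -> 0 < b by lra.
move=> sY c0 Yc Y1; have [r1 r10 sY1] := smat_smbox sY.
have [r2 r20 hr2] := near_axisP Y1.
pose r := Num.min r1 r2; have r0 : 0 < r by rewrite lt_min r10.
have rr1 : r <= r1 by rewrite ge_min lexx.
have rr2 : r <= r2 by rewrite ge_min lexx orbT.
clearbody r; have {}sY1 := smbox_le rr1 sY1.
have z0 : `|0 : R| < r by rewrite normr0.
have b0 : box r (0 : P) by rewrite -rv200; exact: box_rv2.
pose f (x : P) := c^-1 * (Y x - Y (rv2 (cu x) 0)).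
have sf : smbox r f.
  move=> x bx; apply: (@smatM R P (fun=> c^-1)); first exact: smat_cst.
  apply: (@smatB R P Y); first exact: sY1.
  by apply: smat_axis; [exact: smat_cu|apply/sY1/box_rv2 => //; case: bx].
have pf x : box r x -> c^-1 * pd1 Y x = pd1 f x.
  move=> bx; apply/esym/pd1E; first exact: sf.
  rewrite (_ : (fun v => _) = (fun v => c^-1 * (Y (rv2 (cu x) v) - Y (rv2 (cu x) 0)))); last first.
    by apply/funext => v; rewrite /f cu_rv2.
  apply: der_eq (derZ c^-1 (derB (proj2 (smat_partials (sY1 x bx))) (der_cst _ _))) _.
  by rewrite subr0.
have sZ (g : P -> R) x : smat x g -> smat x (fun y => c^-1 * g y).
  by move=> sg; apply: (@smatM R P (fun=> c^-1)) => //; exact: smat_cst.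
have f2 : pd1 (pd1 f) 0 = 1.
  have [_ <-] := pd_ext (open_box r) (fun x bx => sZ _ _ (smat_pd1 (sY1 x bx))) pf b0.
  rewrite pd1M; [|exact: smat_cst|exact/smat_pd1/sY1].
  by rewrite Yc mulVf // pd1_cst mul0r add0r.
have j2 : jets0 r 2 f.
  move=> [|[|//]] u _ ur /=.
    by rewrite /f cu_rv2 subrr mulr0.
  have bu : box r (rv2 u 0) by exact: box_rv2.
  by rewrite -pf // hr2 ?mulr0 //; exact: lt_le_trans ur rr2.
have sB := smooth_quot sf j2; have fB x := quotK (x := x) j2.
set B := quot 2 f in sB fB.
have B0 : 0 < B 0 by rewrite /B /quot cv0 eqxx /= f2 divr_gt0.
have ssB : smat 0 (fun x => Num.sqrt (B x)) by apply: smat_sqrt => //; exact: sB.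
pose h (x : P) := cv x * Num.sqrt (B x).
have sh : smat 0 h by apply: smatM => //; exact: smat_cv.
have ph : 0 < pd1 h 0.
  rewrite /h pd1M //; last exact: smat_cv.
  by rewrite cv0 mul0r addr0 pd1_cv mul1r sqrtr_gt0.
have h0 u : h (rv2 u 0) = 0 by rewrite /h cv_rv2 mul0r.
have nh0 : \forall u \near (0 : R), h (rv2 u 0) = 0.
  by apply/nbhs_ballP; exists 1 => //= u _; exact: h0.
have [k [sk k0 kh hk]] := parametric_inverse sh nh0 ph.
have K0 : rv2 (cu 0) (k 0) = 0 :> P by rewrite k0 cu0 rv200.
have sphi : smat 0 (fun x : P => rv2 (cu x) (k x)) by exact: smat_graph.
exists k; split => //.
- exists (fun x => rv2 (cu x) (h x)); rewrite K0; split => //.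
  + exact: smat_graph.
  + by apply: filterS hk => x hx; rewrite cu_rv2 hx rv2K.
  + by apply: filterS kh => x hx; rewrite cu_rv2 hx rv2K.
- split => //.
  have shk : smat 0 (fun x => h (rv2 (cu x) (k x))) by apply: smat_at_graph => //; rewrite K0.
  have := nbhs_singleton (pd1_near shk hk); rewrite pd1_graph ?K0 //.
  rewrite [X in _ = X]pd1_cv => e.
  by apply/eqP => e0; move: e; rewrite e0 mulr0 => /esym/eqP; rewrite oner_eq0.
- by apply: filterS (near_axis kh) => u; rewrite h0 cu_rv2 cv_rv2.
- have nphi (A : P -> Prop) : (\forall y \near (0 : P), A y) ->
      \forall x \near (0 : P), A (rv2 (cu x) (k x)).
    by move=> nA; apply: (smat_near_image sphi); rewrite K0.
  have nb : \forall y \near (0 : P), box r y by apply: open_nbhs_nbhs; split => //; exact: open_box.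
  have [e e0 he] := (iffLR (cvg2P _ _)) (smat_continuous (sB 0 b0)) _ (divr_gt0 B0 (ltr0n R 2)).
  have nB : \forall y \near (0 : P), 0 < B y.
    apply/nbhs2P; exists e => // y h1 h2; have := he y h1 h2.
    by rewrite ler_norml => /andP[a _]; exact: half B0 a.
  apply: filterS3 hk (nphi _ nb) (nphi _ nB) => x hx bx Bx.
  have := fB _ bx; rewrite /f cu_rv2 cv_rv2 mulrC => ->.
  rewrite -[in RHS]hx /h cv_rv2 exprMn sqr_sqrtr //; exact: ltW.
Qed.

(** The source change is dictated by [Y] alone. It fixes the axis and has nonzero vertical
    derivative, so the conditions on the vertical jet of [Z] pass to [z]: no linear term along the
    axis, as the splitting requires, and a nonzero cubic term at 0, which makes [be] invertible. *)
Theorem cusp_normal_form (Y Z : P -> R) : smat 0 Y -> smat 0 Z ->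
  (\forall u \near (0 : R), pd1 Y (rv2 u 0) = 0) -> (\forall u \near (0 : R), pd1 Z (rv2 u 0) = 0) ->
  pd1 (pd1 Y) 0 != 0 -> pd1 (pd1 Z) 0 = 0 -> pd1 (pd1 (pd1 Z)) 0 != 0 ->
  exists phi Psi, [/\ ldiff phi 0, phi 0 = 0, ldiff Psi (rv4 0 (Y 0) (Z 0) 0) &
    \forall x \near (0 : P), Psi (rv4 (cu (phi x)) (Y (phi x)) (Z (phi x)) 0) = cuspidal_edge_nf x].
Proof.
move=> sY sZ Y1 Z1 c0 Z20 Z30; set c := pd1 (pd1 Y) 0 in c0.
have [k [sk lphi [k0 k10] ku hk]] := fold_coordinate sY c0 erefl Y1.
pose phi (x : P) := rv2 (cu x) (k x).
have phi0 : phi 0 = 0 by rewrite /phi k0 cu0 rv200.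
have sphi : smat 0 phi by exact: smat_graph.
have atphi (g : P -> R) : smat 0 g -> \forall x \near (0 : P), smat (phi x) g.
  move=> sg; apply: (@smat_near_image R 2 phi 0 (fun y => smat y g) sphi).
  by rewrite phi0; exact: smat_near.
pose z x := Z (phi x).
have sz : smat 0 z by apply: smat_at_graph => //; rewrite -/(phi 0) phi0.
have nS : \forall x \near (0 : P), smat (phi x) Z /\ smat x k.
  by apply: filterS2 (atphi _ sZ) (smat_near sk).
have z1 : \forall x \near (0 : P), pd1 Z (phi x) * pd1 k x = pd1 z x.
  by apply: filterS nS => x [h1 h2]; rewrite /z pd1_graph.
have sg (g : P -> R) : smat 0 g -> smat 0 (fun x => g (phi x)).
  by move=> h; apply: smat_at_graph => //; rewrite -/(phi 0) phi0.
have sk1 := smat_pd1 sk; have sk2 := smat_pd1 sk1; have sk3 := smat_pd1 sk2.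
have sZ1 := smat_pd1 sZ; have sZ2 := smat_pd1 sZ1; have sZ3 := smat_pd1 sZ2.
have z2 : \forall x \near (0 : P),
    pd1 (pd1 Z) (phi x) * (pd1 k x * pd1 k x) + pd1 Z (phi x) * pd1 (pd1 k) x = pd1 (pd1 z) x.
  have n : \forall x \near (0 : P),
      pd1 (fun y => pd1 Z (phi y) * pd1 k y) x = pd1 (pd1 z) x.
    exact: pd1_near (smatM (sg _ sZ1) sk1) z1.
  have step x : smat (phi x) Z /\ smat x k -> pd1 (fun y => pd1 Z (phi y) * pd1 k y) x =
      pd1 (pd1 Z) (phi x) * (pd1 k x * pd1 k x) + pd1 Z (phi x) * pd1 (pd1 k) x.
    move=> [h1 h2]; have sa := smat_at_graph h2 (smat_pd1 h1).
    have e1 : pd1 (fun y => pd1 Z (phi y)) x = pd1 (pd1 Z) (phi x) * pd1 k x := pd1_graph h2 (smat_pd1 h1).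
    apply: (etrans (pd1M sa (smat_pd1 h2))).
    have e2 := congr1 (fun w => w * pd1 k x + pd1 Z (phi x) * pd1 (pd1 k) x) e1.
    apply: (etrans e2) => /=.
    have alg (p q w : R) : p * q * q + w = p * (q * q) + w by ring.
    exact: alg.
  apply: (@filterS2 _ (nbhs (0 : P)) _ (fun x => pd1 (fun y => pd1 Z (phi y) * pd1 k y) x = pd1 (pd1 z) x)
    (fun x => smat (phi x) Z /\ smat x k) _ _ n nS) => x hn hx.
  have h := step x hx; exact: (etrans (esym h) hn).
(* Third derivative of a composite: every other term contains the first or second vertical
   derivative of [Z], both zero at the origin. *)
have z3 : pd1 (pd1 (pd1 z)) 0 = pd1 (pd1 (pd1 Z)) 0 * pd1 k 0 ^+ 3.
  have sA := smatM (sg _ sZ2) (smatM sk1 sk1); have sB := smatM (sg _ sZ1) sk2.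
  have e0 : pd1 (fun x => pd1 (pd1 Z) (phi x) * (pd1 k x * pd1 k x) + pd1 Z (phi x) * pd1 (pd1 k) x) 0
      = pd1 (pd1 (pd1 z)) 0 := nbhs_singleton (pd1_near (smatD sA sB) z2).
  have Z10 : pd1 Z 0 = 0 by rewrite -rv200; exact: nbhs_singleton Z1.
  have gr (g : P -> R) : smat 0 g -> pd1 (fun x => g (phi x)) 0 = pd1 g 0 * pd1 k 0.
    move=> h; have h' : smat (phi 0) g by rewrite phi0.
    by apply: (etrans (pd1_graph sk h')); rewrite -/(phi 0) phi0.
  have e1 := pd1D sA sB.
  have e2 := pd1M (sg _ sZ2) (smatM sk1 sk1).
  have e3 := pd1M (sg _ sZ1) sk2.
  have g1 := gr _ sZ1; have g2 := gr _ sZ2.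
  apply: (etrans (esym e0)); apply: (etrans e1); apply: (etrans (congr2 +%R e2 e3)).
  apply: (etrans (congr2 +%R
    (congr2 +%R (congr1 (fun w => w * (pd1 k 0 * pd1 k 0)) g2) (erefl _))
    (congr2 +%R (congr1 (fun w => w * pd1 (pd1 k) 0) g1) (erefl _)))) => /=.
  have f1 : pd1 (pd1 Z) (phi 0) = 0 by rewrite phi0.
  have f2 : pd1 Z (phi 0) = 0 by rewrite phi0.
  have alg (p q w y v a b d : R) : a = 0 -> b = 0 -> d = 0 ->
    p * q * (q * q) + a * w + (d * q * v + b * y) = p * q ^+ 3 by move=> -> -> ->; ring.
  exact: alg f1 f2 Z20.
have z1u : \forall u \near (0 : R), pd1 z (rv2 u 0) = 0.
  by apply: filterS3 (near_axis z1) ku Z1 => u <- hku hZ; rewrite /phi cu_rv2 hku hZ mul0r.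
have [r1 r10 szb] := smat_smbox sz; have [r2 r20 hz1] := near_axisP z1u.
pose r := Num.min r1 r2; have r0 : 0 < r by rewrite lt_min r10.
have rr1 : r <= r1 by rewrite ge_min lexx.
have rr2 : r <= r2 by rewrite ge_min lexx orbT.
have [s [al [be [s0 sal sbe hz hbe]]]] := @even_odd_splitting R r z r0
  (smbox_le rr1 szb) (fun u ur => hz1 u (lt_le_trans ur rr2)).
have be0 : be 0 != 0.
  apply/eqP => e0; move: hbe; rewrite e0 mulr0 => /esym hb.
  by have := mulf_neq0 Z30 (expf_neq0 3 k10); rewrite -z3 => /eqP; apply.
have salp := smbox_smat s0 sal; have sbep := smbox_smat s0 sbe.
(* On the image of the surface [yv] recovers v^2 and [pt] the point (u, v^2), where [al] and [be]
   are evaluated. [Psi] therefore is a map of the target, with inverse [Om]. *)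
pose yv (w : 'rV[R]_4) := (coord4 w 1 - Y (rv2 (coord4 w 0) 0)) / c.
pose pt (w : 'rV[R]_4) := rv2 (coord4 w 0) (yv w).
pose Psi (w : 'rV[R]_4) :=
  rv4 (coord4 w 0) (yv w) ((coord4 w 2 - al (pt w)) / be (pt w)) (coord4 w 3).
pose pt' (w : 'rV[R]_4) := rv2 (coord4 w 0) (coord4 w 1).
pose Om (w : 'rV[R]_4) := rv4 (coord4 w 0) (Y (rv2 (coord4 w 0) 0) + c * coord4 w 1)
   (coord4 w 2 * be (pt' w) + al (pt' w)) (coord4 w 3).
pose w0 := rv4 0 (Y 0) (Z 0) 0.
have c4 (a b d e : R) := coord4_rv4 a b d e.
have pt0 : pt w0 = 0 by rewrite /pt /yv /w0 !c4 rv200 subrr mul0r rv200.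
have cc i (w : 'rV[R]_4) : smat w (fun w => coord4 w i) by exact: smat_coord4.
have syv : smat w0 yv.
  apply: (@smatM R _ (fun w => coord4 w 1 - Y (rv2 (coord4 w 0) 0)) (fun=> c^-1)); last exact: smat_cst.
  apply: (@smatB R _ (fun w => coord4 w 1) (fun w => Y (rv2 (coord4 w 0) 0))); first exact: cc.
  by apply: (@smat_axis Y _ (fun w => coord4 w 0)); [exact: cc|rewrite /w0 c4 rv200].
have spt : smat w0 pt by apply: smat_rv2; [exact: cc|exact: syv].
have sgpt (g : P -> R) : smat 0 g -> smat w0 (fun w => g (pt w)).
  by move=> h; apply: (smat_comp (has_coords_rV R 2) spt); rewrite pt0.
have sPsi : smat w0 Psi.
  apply: smat_rv4; [exact: cc|exact: syv| |exact: cc].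
  apply: (@smat_div R _ (fun w => coord4 w 2 - al (pt w)) (fun w => be (pt w))).
  - by apply: (@smatB R _ (fun w => coord4 w 2) (fun w => al (pt w))); [exact: cc|exact: sgpt].
  - exact: sgpt.
  - by rewrite pt0.
pose w1 := Psi w0.
have pt1 : pt' w1 = 0.
  by rewrite /pt' /w1 /Psi !c4 /yv /w0 !c4 rv200 subrr mul0r rv200.
have spt' : smat w1 pt' by apply: smat_rv2; exact: cc.
have sgpt' (g : P -> R) : smat 0 g -> smat w1 (fun w => g (pt' w)).
  by move=> h; apply: (smat_comp (has_coords_rV R 2) spt'); rewrite pt1.
have sOm : smat w1 Om.
  apply: smat_rv4; [exact: cc| | |exact: cc].
  - apply: (@smatD R _ R (fun w => Y (rv2 (coord4 w 0) 0)) (fun w => c * coord4 w 1)).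
      by apply: (@smat_axis Y _ (fun w => coord4 w 0)); [exact: cc|rewrite /w1 /Psi /w0 !c4 rv200].
    by apply: (@smatM R _ (fun=> c)); [exact: smat_cst|exact: cc].
  - apply: (@smatD R _ R (fun w => coord4 w 2 * be (pt' w)) (fun w => al (pt' w))).
      by apply: (@smatM R _ (fun w => coord4 w 2)); [exact: cc|exact: sgpt'].
    exact: sgpt'.
exists phi, Psi; split => //.
- exists Om; split => //.
  + have n1 : \forall w \near w0, be (pt w) != 0 by apply: smat_near_neq0; [exact: sgpt|rewrite pt0].
    apply: filterS n1 => w bw.
    have e1 : yv w * c = coord4 w 1 - Y (rv2 (coord4 w 0) 0) by exact: divfK c0 _.
    have e2 : pt' (Psi w) = pt w by rewrite /pt' /Psi !c4.
    rewrite /Om e2 /Psi !c4 divfK // subrK mulrC e1 addrC subrK.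
    exact: rv4K.
  + have n1 : \forall w \near w1, be (pt' w) != 0 by apply: smat_near_neq0; [exact: sgpt'|rewrite pt1].
    apply: filterS n1 => w bw.
    have e1 : yv (Om w) = coord4 w 1.
      by rewrite /yv /Om !c4 addrC addKr mulrC; exact: mulKf c0 _.
    have e2 : pt (Om w) = pt' w by rewrite /pt e1 /Om !c4.
    rewrite /Psi e2 e1 /Om !c4 addrK mulfK //.
    exact: rv4K.
- have n1 : \forall x \near (0 : P), be (fold x) != 0.
    have sf : smat (0 : P) (be \o @fold R) by apply: smat_fold; rewrite /fold cu0 cv0 expr0n rv200.
    have nf : (be \o @fold R) 0 != 0 by rewrite /= /fold cu0 cv0 expr0n rv200.
    exact: smat_near_neq0 sf nf.
  have n2 : \forall x \near (0 : P), box s x.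
    by apply: open_nbhs_nbhs; split; [exact: open_box|rewrite -rv200; apply: box_rv2; rewrite normr0].
  apply: (@filterS3 _ (nbhs (0 : P)) _ (fun x => (Y (rv2 (cu x) (k x)) - Y (rv2 (cu x) 0)) / c = cv x ^+ 2)
    (fun x => be (fold x) != 0) (fun x => box s x) _ _ hk n1 n2) => x h1 h2 h3.
  have e1 : yv (rv4 (cu (phi x)) (Y (phi x)) (Z (phi x)) 0) = cv x ^+ 2.
    by rewrite /yv !c4 /phi !cu_rv2.
  have e2 : pt (rv4 (cu (phi x)) (Y (phi x)) (Z (phi x)) 0) = fold x.
    by rewrite /pt e1 !c4 /phi !cu_rv2.
  rewrite /Psi e2 e1 !c4 /cuspidal_edge_nf.
  have e3 : (Z (phi x) - al (fold x)) / be (fold x) = cv x ^+ 3.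
    by rewrite -/(z x) hz // addrC addKr mulfK.
  by rewrite e3 /phi cu_rv2.
Qed.

End CuspNormalForm.

(** * The surface generated by a dual pair of curves *)

Section Developable.
Variable R : realType.
Local Notation P := 'rV[R]_2.

Lemma smat_cuv (x : P) : smat x (fun y => cu y + cv y).
Proof. by apply: smatD; [exact: smat_cu|exact: smat_cv]. Qed.

Lemma smat_at_cuv (h : R -> R) (x : P) : smat (cu x + cv x) h -> smat x (fun y => h (cu y + cv y)).
Proof. by move=> sh; apply: (smat_comp (has_coords_R R) (smat_cuv x) sh). Qed.

Lemma pd1_at_cuv (h : R -> R) (x : P) : smat (cu x + cv x) h ->
  pd1 (fun y => h (cu y + cv y)) x = derive1 h (cu x + cv x).
Proof.
move=> sh; apply: pd1E; first exact: smat_at_cuv.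
rewrite (_ : (fun v => _) = (fun v => h (cu x + v))); last first.
  by apply/funext => v; rewrite cu_rv2 cv_rv2.
have dv : is_derive (cv x) 1 (fun v => cu x + v) 1.
  by apply: der_eq (derD (der_cst _ _) (der_id _)) _; rewrite add0r.
by apply: der_eq (der_comp dv (smat_is_derive sh)) _; rewrite mulr1.
Qed.

Lemma near_cuv (A : R -> Prop) : (\forall s \near (0 : R), A s) -> \forall x \near (0 : P), A (cu x + cv x).
Proof.
move=> nA; have := smat_continuous (smat_cuv 0).
rewrite /prop_for /continuous_at /= cu0 cv0 addr0; exact.
Qed.

(* With [x = (u, r)]: the height over the abscissa u of the tangent line of the graph
   of [p] at u + r. *)
Definition tangent_height (p : R -> R) (x : P) := p (cu x + cv x) - cv x * derive1 p (cu x + cv x).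

Lemma smat_tangent_height p : smat 0 p -> smat 0 (tangent_height p).
Proof.
move=> sp; have s0 : smat (cu (0 : P) + cv (0 : P)) p by rewrite cu0 cv0 addr0.
apply: (@smatB R P (fun x => p (cu x + cv x)) (fun x => cv x * derive1 p (cu x + cv x))).
  exact: smat_at_cuv.
apply: (@smatM R P (@cv R)); first exact: smat_cv.
by apply: smat_at_cuv; exact: smat_derive1.
Qed.

Lemma pd1_cvM (c : R) (h : R -> R) (x : P) : smat (cu x + cv x) h ->
  pd1 (fun y => c * cv y * h (cu y + cv y)) x =
   c * h (cu x + cv x) + c * cv x * derive1 h (cu x + cv x).
Proof.
move=> sh; have sc : smat x (fun y => c * cv y).
  by apply: (@smatM R P (fun=> c)); [exact: smat_cst|exact: smat_cv].
apply: (etrans (pd1M sc (smat_at_cuv sh))).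
have e1 := pd1_at_cuv sh.
have e2 : pd1 (fun y : P => c * cv y) x = c.
  apply: (etrans (pd1M (smat_cst c x) (smat_cv x))).
  have alg (a b : R) : a = 0 -> b = 1 -> a * cv x + c * b = c by move=> -> ->; ring.
  exact: alg (pd1_cst _ _) (pd1_cv _).
by rewrite e1 e2.
Qed.

(** The r-derivative of p(u+r) - r p'(u+r) collapses to -r p''(u+r): it vanishes on the axis, and
    two more derivatives at r = 0 give -p'' and -2 p'''. *)
Lemma tangent_height_jets p : smat 0 p -> [/\
  \forall u \near (0 : R), pd1 (tangent_height p) (rv2 u 0) = 0,
  pd1 (pd1 (tangent_height p)) 0 = - derive1 (derive1 p) 0 &
  pd1 (pd1 (pd1 (tangent_height p))) 0 = - 2 * derive1 (derive1 (derive1 p)) 0].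
Proof.
move=> sp; set p1 := derive1 p; set p2 := derive1 p1; set p3 := derive1 p2.
have s1 : smat 0 p1 by exact: smat_derive1.
have s2 : smat 0 p2 by exact: smat_derive1.
have s3 : smat 0 p3 by exact: smat_derive1.
have cuv0 : cu (0 : P) + cv (0 : P) = 0 by rewrite cu0 cv0 addr0.
have nS : \forall x \near (0 : P), smat (cu x + cv x) p.
  exact: (@near_cuv (fun s => smat s p) (smat_near sp)).
have s2' : smat (cu (0 : P) + cv (0 : P)) p2 by rewrite cuv0; exact: s2.
have s3' : smat (cu (0 : P) + cv (0 : P)) p3 by rewrite cuv0; exact: s3.
have scm : smat (0 : P) (fun x => -1 * cv x).
  by apply: (@smatM R P (fun=> -1)); [exact: smat_cst|exact: smat_cv].
have E1 x : smat (cu x + cv x) p -> -1 * cv x * p2 (cu x + cv x) = pd1 (tangent_height p) x.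
  move=> sx; have sx1 := smat_derive1 sx.
  apply/esym/pd1E.
    apply: (@smatB R P (fun x => p (cu x + cv x)) (fun x => cv x * p1 (cu x + cv x))).
      exact: smat_at_cuv.
    by apply: (@smatM R P (@cv R)); [exact: smat_cv|exact: smat_at_cuv].
  rewrite (_ : (fun v => _) = (fun v => p (cu x + v) - v * p1 (cu x + v))); last first.
    by apply/funext => v; rewrite /tangent_height cu_rv2 cv_rv2.
  have dv : is_derive (cv x) 1 (fun v => cu x + v) 1.
    by apply: der_eq (derD (der_cst _ _) (der_id _)) _; rewrite add0r.
  have d0 := der_comp dv (smat_is_derive sx); have d1 := der_comp dv (smat_is_derive sx1).
  apply: der_eq (derB d0 (derM (der_id _) d1)) _.
  rewrite -/p1 -/p2; move: (p1 _) (p2 _) => a b; ring.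
have n1 : \forall x \near (0 : P), -1 * cv x * p2 (cu x + cv x) = pd1 (tangent_height p) x.
  by apply: filterS nS => x; exact: E1.
have sA : smat (0 : P) (fun x => -1 * cv x * p2 (cu x + cv x)).
  exact: smatM scm (smat_at_cuv s2').
have n2 : \forall x \near (0 : P), -1 * p2 (cu x + cv x) + -1 * cv x * p3 (cu x + cv x) =
    pd1 (pd1 (tangent_height p)) x.
  have n := pd1_near sA n1.
  apply: (@filterS2 _ (nbhs (0 : P)) _ (fun x => smat (cu x + cv x) p)
    (fun x => pd1 (fun x => -1 * cv x * p2 (cu x + cv x)) x = pd1 (pd1 (tangent_height p)) x)
    _ _ nS n) => x sx hx.
  have h := pd1_cvM (-1) (smat_derive1 (smat_derive1 sx)); exact: (etrans (esym h) hx).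
have sB : smat (0 : P) (fun x => -1 * cv x * p3 (cu x + cv x)).
  exact: smatM scm (smat_at_cuv s3').
have sC : smat (0 : P) (fun x => -1 * p2 (cu x + cv x)).
  exact: (@smatM R P (fun=> -1) (fun x => p2 (cu x + cv x)) 0 (smat_cst _ _) (smat_at_cuv s2')).
have h3 : pd1 (fun x : P => -1 * p2 (cu x + cv x)) 0 = - p3 0.
  apply: (etrans (@pd1M R (fun=> -1) (fun x => p2 (cu x + cv x)) 0 (smat_cst _ _) (smat_at_cuv s2'))).
  have alg (a b c d : R) : a = 0 -> b = d -> a * c + -1 * b = - d by move=> -> ->; ring.
  apply: alg; first exact: pd1_cst.
  by apply: (etrans (pd1_at_cuv s2')); rewrite cuv0.
split.
- apply: filterS (near_axis n1) => u <-; by rewrite cv_rv2 mulr0 mul0r.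
- apply: (etrans (esym (nbhs_singleton n2))).
  rewrite cuv0 cv0; move: (p2 0) (p3 0) => a b; ring.
- have e := nbhs_singleton (pd1_near (smatD sC sB) n2).
  apply: (etrans (esym e)); apply: (etrans (pd1D sC sB)).
  apply: (etrans (congr2 +%R h3 (pd1_cvM (-1) s3'))).
  rewrite cuv0 cv0; move: (p3 0) (derive1 p3 0) => a b; ring.
Qed.

(** An instance of the two-variable theorem with a dummy first variable. *)
Lemma inverse_1d (s : R -> R) (t0 : R) : smat t0 s -> s t0 = 0 -> 0 < derive1 s t0 ->
  exists tau : R -> R, [/\ smat 0 tau, tau 0 = t0, \forall t \near t0, tau (s t) = t &
    \forall w \near (0 : R), s (tau w) = w].
Proof.
move=> ss s0 sp; pose h (x : P) := s (t0 + cv x).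
have sc : smat (0 : P) (fun x => t0 + cv x).
  by apply: (@smatD R P R (fun=> t0)); [exact: smat_cst|exact: smat_cv].
have ss0 : smat (t0 + cv (0 : P)) s by rewrite cv0 addr0.
have sh : smat 0 h by exact: (smat_comp (has_coords_R R) sc ss0).
have nh0 : \forall u \near (0 : R), h (rv2 u 0) = 0.
  by apply/nbhs_ballP; exists 1 => //= u _; rewrite /h cv_rv2 addr0.
have ph : pd1 h 0 = derive1 s t0.
  apply: pd1E => //.
  rewrite (_ : (fun v => _) = (fun v => s (t0 + v))); last first.
    by apply/funext => v; rewrite /h cv_rv2.
  have dv : is_derive (cv (0 : P)) 1 (fun v => t0 + v) 1.
    by apply: der_eq (derD (der_cst _ _) (der_id _)) _; rewrite add0r.
  by apply: der_eq (der_comp dv (smat_is_derive ss0)) _; rewrite mulr1 cv0 addr0.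
have ph0 : 0 < pd1 h 0 by rewrite ph.
have [k [sk k0 kh hk]] := parametric_inverse sh nh0 ph0.
have line (A : P -> Prop) : (\forall x \near (0 : P), A x) -> \forall w \near (0 : R), A (rv2 0 w).
  move=> /nbhs2P[e e0 he]; apply/nbhs_ballP; exists e => // w.
  rewrite /ball /= sub0r normrN => we.
  by apply: he; rewrite ?cu0 ?cv0 ?cu_rv2 ?cv_rv2 subr0 ?normr0.
exists (fun w => t0 + k (rv2 0 w)); split.
- apply: (@smatD R R R (fun=> t0)); first exact: smat_cst.
  apply: (smat_comp (f := fun w => rv2 0 w) (has_coords_rV R 2)).
    by apply: smat_rv2; [exact: smat_cst|exact: smat_id].
  by rewrite rv200.
- by rewrite rv200 k0 addr0.
- have := line _ kh => /near_axisP[e e0 he].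
  apply/nbhs_ballP; exists e => // t; rewrite /ball /= distrC => te.
  have := he _ te; rewrite /h cu_rv2 cv_rv2 addrC subrK => ->.
  by rewrite addrC subrK.
- by apply: filterS (line _ hk) => w; rewrite /h cu_rv2 !cv_rv2.
Qed.

Lemma coshR_gt0 (t : R) : 0 < coshR t.
Proof. by rewrite divr_gt0 // addr_gt0 // expR_gt0. Qed.

Lemma cosh2_sinh2 (t : R) : coshR t ^+ 2 - sinhR t ^+ 2 = 1.
Proof.
have e : expR t * expR (- t) = 1 by rewrite -expRD subrr expR0.
have alg (a b : R) : ((a + b) / 2) ^+ 2 - ((a - b) / 2) ^+ 2 = a * b by field.
by rewrite /coshR /sinhR alg.
Qed.

Definition artanh (z : R) : R := ln ((1 + z) / (1 - z)) / 2.

Lemma artanhK (z : R) : -1 < z -> z < 1 -> sinhR (artanh z) / coshR (artanh z) = z.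
Proof.
move=> z1 z2; set q := (1 + z) / (1 - z).
have q0 : 0 < q by rewrite divr_gt0; lra.
set w := expR (artanh z).
have w0 : 0 < w by exact: expR_gt0.
have w2 : w * w = q by rewrite -expRD /artanh -splitr lnK.
have wN : expR (- artanh z) = w^-1 by rewrite expRN.
rewrite /sinhR /coshR wN -/w.
have n1 : w * w + 1 != 0 by rewrite gt_eqF // addr_gt0 // mulr_gt0.
have -> : (w - w^-1) / 2 / ((w + w^-1) / 2) = (w * w - 1) / (w * w + 1).
  by field; rewrite n1 gt_eqF.
have n2 : 1 - z != 0 by rewrite gt_eqF; lra.
rewrite w2 /q; field; rewrite n2 /=.
by rewrite (_ : 1 + z + (1 - z) = 2) ?pnatr_eq0 //; ring.
Qed.

Lemma tanhK (t : R) : artanh (sinhR t / coshR t) = t.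
Proof.
have c0 := coshR_gt0 t; have cn : coshR t != 0 by rewrite gt_eqF.
have e1 : coshR t + sinhR t = expR t by rewrite /coshR /sinhR; field.
have e2 : coshR t - sinhR t = expR (- t) by rewrite /coshR /sinhR; field.
have en : expR (- t) != 0 by rewrite gt_eqF // expR_gt0.
rewrite /artanh (_ : _ / (1 - _) = expR (t + t)).
  by rewrite expRK; field.
have -> : 1 + sinhR t / coshR t = expR t / coshR t by rewrite -e1; field.
have -> : 1 - sinhR t / coshR t = expR (- t) / coshR t by rewrite -e2; field.
rewrite expRD; have e : expR t * expR (- t) = 1 by rewrite -expRD subrr expR0.
by rewrite -[RHS]mulr1 -(divff en) expRN; field; rewrite cn gt_eqF // expR_gt0.
Qed.

Lemma smat_coshR (V : normedModType R) (f : V -> R) x : smat x f -> smat x (fun y => coshR (f y)).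
Proof.
move=> sf; apply: (@smatM R V (fun y => expR (f y) + expR (- f y)) (fun=> 2^-1)); last exact: smat_cst.
by apply: (@smatD R V R (fun y => expR (f y))); apply: smat_expR => //; exact: smatN.
Qed.

Lemma smat_sinhR (V : normedModType R) (f : V -> R) x : smat x f -> smat x (fun y => sinhR (f y)).
Proof.
move=> sf; apply: (@smatM R V (fun y => expR (f y) - expR (- f y)) (fun=> 2^-1)); last exact: smat_cst.
by apply: (@smatB R V (fun y => expR (f y))); apply: smat_expR => //; exact: smatN.
Qed.

Lemma smat_artanh (V : normedModType R) (f : V -> R) x : smat x f -> -1 < f x -> f x < 1 ->
  smat x (fun y => artanh (f y)).
Proof.
move=> sf f1 f2; have n2 : 1 - f x != 0 by rewrite gt_eqF; lra.
apply: (@smatM R V (fun y => ln ((1 + f y) / (1 - f y))) (fun=> 2^-1)); last exact: smat_cst.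
apply: smat_ln; last by rewrite divr_gt0; lra.
apply: (@smat_div R V (fun y => 1 + f y) (fun y => 1 - f y)) => //.
  by apply: (@smatD R V R (fun=> 1)) => //; exact: smat_cst.
by apply: (@smatB R V (fun=> 1)) => //; exact: smat_cst.
Qed.

End Developable.

(** * The projective chart of the target *)

Section ProjectiveChart.
Variable R : realType.

(* Central projection of a neighbourhood of (1, 0, 0, 0); the fourth coordinate
   vanishes exactly on the quadric [x0^2 - x1^2 + x2^2 + x3^2 = 1]. *)
Definition chart (w : 'rV[R]_4) : 'rV[R]_4 :=
  rv4 (coord4 w 1 / coord4 w 0) (coord4 w 2 / coord4 w 0) (coord4 w 3 / coord4 w 0)
    (coord4 w 0 ^+ 2 - coord4 w 1 ^+ 2 + coord4 w 2 ^+ 2 + coord4 w 3 ^+ 2 - 1).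

(** A point with affine coordinates (a, b, c) is f0 times (1, a, b, c), and the fourth coordinate s
    determines the scale through f0^2 (1 - a^2 + b^2 + c^2) = 1 + s, with f0 the positive root. *)
Lemma ldiff_chart : ldiff chart (rv4 1 0 0 0).
Proof.
pose w0 : 'rV[R]_4 := rv4 1 0 0 0.
have c4 (a b d e : R) := coord4_rv4 a b d e.
have cc i (w : 'rV[R]_4) : smat w (fun w => coord4 w i) by exact: smat_coord4.
have cX i k (w : 'rV[R]_4) : smat w (fun w => coord4 w i ^+ k) by exact: smatX (cc i w).
have e1 : chart w0 = 0.
  rewrite /chart /w0 !c4 !divr1 expr0n expr1n /= -[RHS]rv4K.
  have c0 i : coord4 (0 : 'rV[R]_4) i = 0 by rewrite /coord4 mxE.
  by rewrite !c0; congr rv4; ring.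
pose q (w : 'rV[R]_4) := coord4 w 0 ^+ 2 - coord4 w 1 ^+ 2 + coord4 w 2 ^+ 2 + coord4 w 3 ^+ 2.
pose d (w : 'rV[R]_4) := 1 - coord4 w 0 ^+ 2 + coord4 w 1 ^+ 2 + coord4 w 2 ^+ 2.
pose f0 (w : 'rV[R]_4) := Num.sqrt ((1 + coord4 w 3) / d w).
pose Om (w : 'rV[R]_4) := rv4 (f0 w) (f0 w * coord4 w 0) (f0 w * coord4 w 1) (f0 w * coord4 w 2).
have c0 i : coord4 (0 : 'rV[R]_4) i = 0 by rewrite /coord4 mxE.
have sq w : smat w q.
  apply: (smatD (smatD (smatB (cX 0 2 w) (cX 1 2 w)) (cX 2 2 w)) (cX 3 2 w)).
have sd w : smat w d.
  apply: (@smatD R _ R (fun w => 1 - coord4 w 0 ^+ 2 + coord4 w 1 ^+ 2) (fun w => coord4 w 2 ^+ 2)) => //.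
  apply: (@smatD R _ R (fun w => 1 - coord4 w 0 ^+ 2) (fun w => coord4 w 1 ^+ 2)) => //.
  by apply: (@smatB R _ (fun=> 1)) => //; exact: smat_cst.
have d0 : d 0 = 1 by rewrite /d !c0 expr0n /=; ring.
have sr : smat (0 : 'rV[R]_4) (fun w => (1 + coord4 w 3) / d w).
  apply: (@smat_div R _ (fun w => 1 + coord4 w 3) d) => //; last by rewrite d0 oner_neq0.
  by apply: (@smatD R _ R (fun=> 1)) => //; exact: smat_cst.
have sf0 : smat (0 : 'rV[R]_4) f0.
  by apply: smat_sqrt => //; rewrite d0 c0 addr0 divr1.
have schart : smat w0 chart.
  have n0 : coord4 w0 0 != 0 by rewrite /w0 c4 oner_neq0.
  apply: smat_rv4; [exact: (smat_div (cc 1 _) (cc 0 _))|exact: (smat_div (cc 2 _) (cc 0 _))|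
    exact: (smat_div (cc 3 _) (cc 0 _))|].
  by apply: (@smatB R _ q (fun=> 1)) => //; exact: smat_cst.
have gt_near (V : normedModType R) (g : V -> R) x : smat x g -> 0 < g x -> \forall y \near x, 0 < g y.
  move=> sg gx; have n : nbhs (g x) [set z : R | 0 < z].
    by apply: open_nbhs_nbhs; split => //; exact: open_gt.
  exact: smat_continuous sg _ n.
exists Om; rewrite e1; split => //.
- by apply: smat_rv4 => //; apply: smatM.
- have n1 : \forall w \near w0, 0 < coord4 w 0.
    by apply: gt_near; [exact: cc|rewrite /w0 c4].
  have n2 : \forall w \near w0, 0 < q w.
    by apply: gt_near; [exact: sq|rewrite /q /w0 !c4 expr1n expr0n /= subr0 !addr0].
  apply: (@filterS2 _ (nbhs w0) _ (fun w => 0 < coord4 w 0) (fun w => 0 < q w) _ _ n1 n2) => w w00 qw.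
  have wn : coord4 w 0 != 0 by rewrite gt_eqF.
  have qn : q w != 0 by rewrite gt_eqF.
  have ed : d (chart w) = q w / coord4 w 0 ^+ 2 by rewrite /d /chart !c4 /q; field.
  have ef : f0 (chart w) = coord4 w 0.
    rewrite /f0 ed /chart !c4 -/(q w) addrC subrK invf_div mulrCA divff // mulr1.
    by rewrite sqrtr_sqr gtr0_norm.
  by rewrite /Om ef /chart !c4 ![coord4 w 0 * _]mulrC !divfK // rv4K.
- have n1 : \forall w \near (0 : 'rV[R]_4), 0 < d w by apply: gt_near; [exact: sd|rewrite d0].
  have n2 : \forall w \near (0 : 'rV[R]_4), 0 < 1 + coord4 w 3.
    apply: gt_near; last by rewrite c0 addr0.
    by apply: (@smatD R _ R (fun=> 1)) => //; exact: smat_cst.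
  apply: (@filterS2 _ (nbhs (0 : 'rV[R]_4)) _ (fun w => 0 < d w) (fun w => 0 < 1 + coord4 w 3) _ _ n1 n2) => w dw ww.
  have fp : 0 < f0 w by rewrite sqrtr_gt0 divr_gt0.
  have fn : f0 w != 0 by rewrite gt_eqF.
  have f2 : f0 w ^+ 2 = (1 + coord4 w 3) / d w by rewrite sqr_sqrtr // ltW // divr_gt0.
  rewrite /chart /Om !c4 ![f0 w * _]mulrC !mulfK //.
  rewrite -[RHS]rv4K; congr rv4.
  have alg (f a b c : R) : f ^+ 2 - (a * f) ^+ 2 + (b * f) ^+ 2 + (c * f) ^+ 2 - 1 =
    f ^+ 2 * (1 - a ^+ 2 + b ^+ 2 + c ^+ 2) - 1 by ring.
  rewrite alg f2 -/(d w) divfK ?gt_eqF //; ring.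
Qed.

End ProjectiveChart.

(** * Projection of a dual pair to a tangent developable *)

Section DualPair.
Variable R : realType.
Local Notation P := 'rV[R]_2.

Lemma der_ratio (x y : nat -> R -> R) (ka : R) i (t : R) :
  is_derive t 1 (x i) (- (ka * y i t)) -> is_derive t 1 (x 0%N) (- (ka * y 0%N t)) -> x 0%N t != 0 ->
  is_derive t 1 (fun t => x i t / x 0%N t)
    (- ka * (y i t * x 0%N t - x i t * y 0%N t) / x 0%N t ^+ 2).
Proof.
move=> h1 h0 x0; apply: der_eq (der_div h1 h0 x0) _.
by congr (_ / _); ring.
Qed.

Lemma near_at (tau : R -> R) (A : R -> Prop) : smat 0 tau -> (\forall t \near tau 0, A t) ->
  \forall w \near (0 : R), A (tau w).
Proof. by move=> /smat_continuous ct nA; exact: ct nA. Qed.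

Lemma derive1_eq (f : R -> R) (t a : R) : is_derive t 1 f a -> derive1 f t = a.
Proof. by move=> [_ <-]; rewrite derive1E. Qed.

Lemma near_derive1 (f g : R -> R) (t : R) : (\forall s \near t, f s = g s) -> derive1 f t = derive1 g t.
Proof. by move=> fg; rewrite !derive1E; exact: near_eq_derive. Qed.

Lemma near_near (A : R -> Prop) (t : R) : (\forall s \near t, A s) -> \forall s \near t, \forall w \near s, A w.
Proof. by move=> nA; exact: (near_join nA). Qed.

Section Curves.
Variables (x y n : nat -> R -> R) (ka rho : R -> R) (t0 : R).
Hypothesis sx : forall i, smat t0 (x i).
Hypothesis sy : forall i, smat t0 (y i).
Hypothesis sn : forall i, smat t0 (n i).
Hypothesis srho : smat t0 rho.
Hypothesis dx : forall i, \forall t \near t0, is_derive (t : R) 1 (x i) (- (ka t * y i t)).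
Hypothesis dy : forall i, \forall t \near t0, is_derive (t : R) 1 (y i) (rho t * n i t - ka t * x i t).
Hypothesis x0 : forall i, (i < 4)%N -> x i t0 = (i == 0%N)%:R.
Hypothesis y0 : forall i, (i < 4)%N -> y i t0 = - (i == 1%N)%:R.
Hypothesis n0 : forall i, (i < 4)%N -> n i t0 = (i == 2%N)%:R.
Hypothesis ka0 : 0 < ka t0.
Hypothesis rho0 : rho t0 != 0.
Hypothesis dn3 : derive1 (n 3) t0 != 0.

(** Minors of the pair (x, y) against coordinate 0: the derivative of x i / x 0 is -ka w i / (x
    0)^2, so [slope i] is the derivative of projected coordinate i with respect to projected
    coordinate 1, and [H i] is the t-derivative of that slope. In the derivative of [w i] the terms
    with [ka] cancel and only [n] remains, which explains the factor [rho]. *)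
Let w i t := y i t * x 0%N t - x i t * y 0%N t.
Let slope i t := w i t / w 1%N t.
Let K i t := (n i t * x 0%N t - x i t * n 0%N t) * w 1%N t -
  w i t * (n 1%N t * x 0%N t - x 1%N t * n 0%N t).
Let H i t := rho t * K i t / w 1%N t ^+ 2.

Let sw i : smat t0 (w i).
Proof.
by apply: (@smatB R R (fun t => y i t * x 0%N t) (fun t => x i t * y 0%N t)); apply: smatM.
Qed.

Let w1 : w 1%N t0 = -1.
Proof. by rewrite /w !x0 // !y0 //= mulr1 mul0r subr0. Qed.

Let sK i : smat t0 (K i).
Proof.
apply: (@smatB R R (fun t => (n i t * x 0%N t - x i t * n 0%N t) * w 1%N t)
  (fun t => w i t * (n 1%N t * x 0%N t - x 1%N t * n 0%N t))).
  apply: (@smatM R R (fun t => n i t * x 0%N t - x i t * n 0%N t)) => //.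
  by apply: (@smatB R R (fun t => n i t * x 0%N t) (fun t => x i t * n 0%N t)); apply: smatM.
apply: (@smatM R R (w i)) => //.
by apply: (@smatB R R (fun t => n 1%N t * x 0%N t) (fun t => x 1%N t * n 0%N t)); apply: smatM.
Qed.

Let sw2 : smat t0 (fun t => w 1%N t ^+ 2). Proof. exact: smatX. Qed.

Let w2n : w 1%N t0 ^+ 2 != 0. Proof. by rewrite w1 sqrrN expr1n oner_neq0. Qed.

Let sH i : smat t0 (H i).
Proof. by apply: (@smat_div R R (fun t => rho t * K i t)) => //; apply: smatM. Qed.

Let dw i : \forall t \near t0,
  is_derive (t : R) 1 (w i) (rho t * (n i t * x 0%N t - x i t * n 0%N t)).
Proof.
apply: filterS3 (filterI (dx i) (dx 0%N)) (dy i) (dy 0%N) => t [h1 h2] h3 h4.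
apply: der_eq (derB (derM h3 h2) (derM h1 h4)) _.
by ring.
Qed.

Let nw1 : \forall t \near t0, w 1%N t != 0.
Proof. by apply: smat_near_neq0 => //; rewrite w1 oppr_eq0 oner_neq0. Qed.

Let nx0 : \forall t \near t0, x 0%N t != 0.
Proof. by apply: smat_near_neq0 => //; rewrite x0 // oner_neq0. Qed.

Let dslope i : \forall t \near t0, is_derive (t : R) 1 (slope i) (H i t).
Proof.
apply: filterS3 (dw i) (dw 1%N) nw1 => t h1 h2 h3.
apply: der_eq (der_div h1 h2 h3) _.
by rewrite /H /K; congr (_ / _); ring.
Qed.

Let H2 : H 2 t0 != 0.
Proof.
rewrite /H /K w1 !n0 // !x0 //= !mulr1 !mul0r !subr0 mul1r mulr0 subr0.
by rewrite sqrrN expr1n divr1 mulrN1 oppr_eq0.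
Qed.

Let K3 : K 3 t0 = 0.
Proof. by rewrite /K !n0 // !x0 //= !mul0r !subr0 !mul0r mulr0 subr0. Qed.

Let H3 : H 3 t0 = 0.
Proof. by rewrite /H K3 mulr0 mul0r. Qed.

(** All terms but one contain [n 3], [x 3], [w 3] or [n 0], which vanish at [t0]; what remains is
    -rho times the derivative of [n 3]. *)
Let dH3 : derive1 (H 3) t0 != 0.
Proof.
have dN i := smat_is_derive (sn i).
have dX i := nbhs_singleton (dx i).
have d3 := nbhs_singleton (dw 3); have d1 := nbhs_singleton (dw 1%N).
have dK := derB (derM (derB (derM (dN 3) (dX 0%N)) (derM (dX 3) (dN 0%N))) d1)
   (derM d3 (derB (derM (dN 1%N) (dX 0%N)) (derM (dX 1%N) (dN 0%N)))).
have {}dK : is_derive t0 1 (K 3) (- derive1 (n 3) t0).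
  apply: der_eq dK _.
  have e3 : w 3 t0 = 0 by rewrite /w !x0 // !y0 //= oppr0 !mul0r subr0.
  rewrite w1 e3 !n0 // !x0 // !y0 //=.
  by move: (derive1 (n 3) t0) (derive1 (n 0%N) t0) (derive1 (n 1%N) t0) => a b c; ring.
have dA := smat_is_derive srho; have dB := smat_is_derive sw2.
rewrite (derive1_eq (der_div (derM dA dK) dB w2n)) K3 w1.
have alg (r k a b : R) :
    ((r * - k + 0 * a) * (-1) ^+ 2 - r * 0 * b) / ((-1) ^+ 2) ^+ 2 = - (r * k) by field.
by rewrite alg oppr_eq0 mulf_neq0.
Qed.

Let s t := x 1%N t / x 0%N t.

Let ss : smat t0 s.
Proof. by apply: smat_div => //; rewrite x0 // oner_neq0. Qed.

Let s0 : s t0 = 0. Proof. by rewrite /s x0 // mul0r. Qed.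

Lemma projected_abscissa_increasing : 0 < derive1 s t0.
Proof.
have x00 : x 0%N t0 != 0 by rewrite x0 // oner_neq0.
rewrite (derive1_eq (der_ratio (nbhs_singleton (dx 1%N)) (nbhs_singleton (dx 0%N)) x00)).
by rewrite -/(w 1%N t0) w1 mulrN1 opprK x0 //= expr1n divr1.
Qed.

Variable tau : R -> R.
Hypothesis stau : smat 0 tau.
Hypothesis tau0 : tau 0 = t0.
Hypothesis stauK : \forall u \near (0 : R), s (tau u) = u.

(** In the parameter u = x 1 / x 0 the projected curve is the graph (u, p 2 u, p 3 u). *)
Let p i u := x i (tau u) / x 0%N (tau u).

Let sxt i : smat 0 (fun u => x i (tau u)).
Proof. by apply: (smat_comp (has_coords_R R)) => //; rewrite tau0. Qed.

Let sp i : smat 0 (p i).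
Proof. by apply: smat_div => //; rewrite tau0 x0 // oner_neq0. Qed.

Let nt (A : R -> Prop) : (\forall t \near t0, A t) -> \forall u \near (0 : R), A (tau u).
Proof. by move=> nA; apply: near_at => //; rewrite tau0. Qed.

Let dtau : \forall u \near (0 : R), is_derive (u : R) 1 tau (derive1 tau u) /\
  - ka (tau u) * w 1%N (tau u) / x 0%N (tau u) ^+ 2 * derive1 tau u = 1.
Proof.
have h := near_near stauK.
have nd : \forall t \near t0, is_derive (t : R) 1 s (- ka t * w 1%N t / x 0%N t ^+ 2).
  apply: filterS3 (dx 1%N) (dx 0%N) nx0 => t h1 h2 h3; exact: der_ratio.
have n2 : \forall u \near (0 : R), smat u tau by exact: smat_near.
apply: filterS3 h (nt nd) n2 => u h1 h2 h3.
have dt := smat_is_derive h3; split => //.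
have e := der_comp dt h2.
have e' : is_derive u 1 (fun u => s (tau u)) 1.
  apply: (@der_near R (fun u => u) _ u 1 _ (der_id u)).
  by apply: filterS h1 => v ->.
exact: is_derive_uniq e e'.
Qed.

Lemma derive1_projected i : \forall u \near (0 : R), derive1 (p i) u = slope i (tau u).
Proof.
have nd : \forall t \near t0, is_derive (t : R) 1 (fun t => x i t / x 0%N t) (- ka t * w i t / x 0%N t ^+ 2).
  apply: filterS3 (dx i) (dx 0%N) nx0 => t h1 h2 h3; exact: der_ratio.
apply: filterS3 (nt nd) dtau (filterI (nt nw1) (nt nx0)) => u h1 [h2 h3] [h4 h5].
rewrite (derive1_eq (der_comp h2 h1)) /slope.
have -> : - ka (tau u) * w i (tau u) / x 0%N (tau u) ^+ 2 * derive1 tau u =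
  w i (tau u) / w 1%N (tau u) * (- ka (tau u) * w 1%N (tau u) / x 0%N (tau u) ^+ 2 * derive1 tau u).
  by field; rewrite h4 h5.
by rewrite h3 mulr1.
Qed.

Lemma derive2_projected i : \forall u \near (0 : R), derive1 (derive1 (p i)) u = H i (tau u) * derive1 tau u.
Proof.
apply: filterS3 (near_near (derive1_projected i)) (nt (dslope i)) dtau => u h1 h2 [h3 _].
by rewrite (near_derive1 h1) (derive1_eq (der_comp h3 h2)).
Qed.

Let tau1 : derive1 tau 0 != 0.
Proof.
have [_ h] := nbhs_singleton dtau; apply/eqP => e; move: h; rewrite e mulr0 => /esym/eqP.
by rewrite oner_eq0.
Qed.

Lemma projected_jets : [/\ smat 0 (p 2), smat 0 (p 3), derive1 (derive1 (p 2)) 0 != 0,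
  derive1 (derive1 (p 3)) 0 = 0 & derive1 (derive1 (derive1 (p 3))) 0 != 0].
Proof.
split => //.
- by rewrite (nbhs_singleton (derive2_projected 2)) tau0 mulf_neq0.
- by rewrite (nbhs_singleton (derive2_projected 3)) tau0 H3 mul0r.
- rewrite (near_derive1 (derive2_projected 3)).
  have dt := smat_is_derive stau; have dt2 := smat_is_derive (smat_derive1 stau).
  have dh : is_derive (tau 0) 1 (H 3) (derive1 (H 3) t0) by rewrite tau0; exact: smat_is_derive.
  rewrite (derive1_eq (derM (der_comp dt dh) dt2)) tau0 H3 mul0r add0r.
  by rewrite !mulf_neq0.
Qed.

Hypothesis tauK : \forall t \near t0, tau (s t) = t.
Hypothesis qxx : \forall t \near t0, x 0%N t ^+ 2 - x 1%N t ^+ 2 + x 2%N t ^+ 2 + x 3%N t ^+ 2 = 1.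
Hypothesis qxy : \forall t \near t0,
  x 0%N t * y 0%N t - x 1%N t * y 1%N t + x 2%N t * y 2%N t + x 3%N t * y 3%N t = 0.
Hypothesis qyy : \forall t \near t0, y 0%N t ^+ 2 - y 1%N t ^+ 2 + y 2%N t ^+ 2 + y 3%N t ^+ 2 = -1.

Let tt (z : P) := tau (cu z + cv z).
Let den (z : P) := y 1%N (tt z) - cu z * y 0%N (tt z).
Let Th (z : P) := (cu z * x 0%N (tt z) - x 1%N (tt z)) / den z.
Let phi2 (z : P) := rv2 (tt z) (artanh (Th z)).
Let th (z : P) := sinhR (cv z) / coshR (cv z).
Let de (z : P) := x 0%N (cu z) + th z * y 0%N (cu z).
Let uu (z : P) := (x 1%N (cu z) + th z * y 1%N (cu z)) / de z.
Let psi2 (z : P) := rv2 (uu z) (s (cu z) - uu z).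

Let stt : smat 0 tt.
Proof. by apply: smat_at_cuv; rewrite cu0 cv0 addr0. Qed.

Let tt0 : tt 0 = t0. Proof. by rewrite /tt cu0 cv0 addr0 tau0. Qed.

Let at_tt (f : R -> R) : smat t0 f -> smat 0 (fun z => f (tt z)).
Proof. by move=> sf; apply: (smat_comp (has_coords_R R) stt); rewrite tt0. Qed.

Let sden : smat 0 den.
Proof.
apply: (@smatB R P (fun z => y 1%N (tt z)) (fun z => cu z * y 0%N (tt z))); first exact: at_tt.
by apply: (@smatM R P (@cu R)); [exact: smat_cu|exact: at_tt].
Qed.

Let den0 : den 0 = -1. Proof. by rewrite /den tt0 cu0 mul0r subr0 y0. Qed.

Let den0n : den 0 != 0. Proof. by rewrite den0 oppr_eq0 oner_neq0. Qed.

Let sTh : smat 0 Th.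
Proof.
apply: (@smat_div R P (fun z => cu z * x 0%N (tt z) - x 1%N (tt z))) => //.
apply: (@smatB R P (fun z => cu z * x 0%N (tt z))); last exact: at_tt.
by apply: (@smatM R P (@cu R)); [exact: smat_cu|exact: at_tt].
Qed.

Let Th0 : Th 0 = 0.
Proof. by rewrite /Th tt0 cu0 !x0 //= !mul0r subr0 mul0r. Qed.

Let sphi2 : smat 0 phi2.
Proof. by apply: smat_rv2 => //; apply: smat_artanh => //; rewrite Th0 // oppr_lt0. Qed.

Let phi20 : phi2 0 = rv2 t0 0.
Proof. by rewrite /phi2 tt0 Th0 /artanh addr0 subr0 divr1 ln1 mul0r. Qed.

Let ntt (A : R -> Prop) : (\forall t \near t0, A t) -> \forall z \near (0 : P), A (tt z).
Proof. by move=> nA; apply: smat_continuous stt _ _; rewrite tt0. Qed.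

Let nTh : \forall z \near (0 : P), -1 < Th z /\ Th z < 1.
Proof.
have nb : nbhs (Th 0) [set v : R | -1 < v /\ v < 1].
  rewrite Th0; apply/nbhs_ballP; exists 1 => //= v; rewrite /ball /= sub0r normrN ltr_norml.
  by move=> /andP[].
exact: smat_continuous sTh _ nb.
Qed.

Let at_cu (f : R -> R) : smat t0 f -> smat (rv2 t0 0) (fun z => f (cu z)).
Proof. by move=> sf; apply: (smat_comp (has_coords_R R) (smat_cu _)); rewrite cu_rv2. Qed.

Let sth : smat (rv2 t0 0) th.
Proof.
apply: (@smat_div R P (fun z => sinhR (cv z)) (fun z => coshR (cv z))).
- by apply: smat_sinhR; exact: smat_cv.
- by apply: smat_coshR; exact: smat_cv.
- by rewrite gt_eqF // coshR_gt0.
Qed.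

Let th0 : th (rv2 t0 0) = 0.
Proof. by rewrite /th cv_rv2 /sinhR oppr0 subrr !mul0r. Qed.

Let sde : smat (rv2 t0 0) de.
Proof.
apply: (@smatD R P R (fun z => x 0%N (cu z)) (fun z => th z * y 0%N (cu z))); first exact: at_cu.
by apply: smatM => //; exact: at_cu.
Qed.

Let de0 : de (rv2 t0 0) != 0.
Proof. by rewrite /de th0 cu_rv2 mul0r addr0 x0 // oner_neq0. Qed.

Let suu : smat (rv2 t0 0) uu.
Proof.
apply: (@smat_div R P (fun z => x 1%N (cu z) + th z * y 1%N (cu z))) => //.
apply: (@smatD R P R (fun z => x 1%N (cu z)) (fun z => th z * y 1%N (cu z))); first exact: at_cu.
by apply: smatM => //; exact: at_cu.
Qed.

Let spsi2 : smat (rv2 t0 0) psi2.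
Proof.
apply: smat_rv2 => //; apply: (@smatB R P (fun z => s (cu z))) => //.
exact: at_cu.
Qed.

Let ncuv : \forall z \near (0 : P), s (tt z) = cu z + cv z.
Proof. exact: (@near_cuv R (fun u => s (tau u) = u) stauK). Qed.

Let ratio (X0 X1 Xi Y0 Y1 Yi u : R) : Y1 - u * Y0 != 0 -> Y1 * X0 - X1 * Y0 != 0 ->
  (Xi + (u * X0 - X1) / (Y1 - u * Y0) * Yi) / (X0 + (u * X0 - X1) / (Y1 - u * Y0) * Y0) =
  (Xi * (Y1 - u * Y0) + (u * X0 - X1) * Yi) / (Y1 * X0 - X1 * Y0).
Proof.
move=> h1 h2; have -> : X0 + (u * X0 - X1) / (Y1 - u * Y0) * Y0 = (Y1 * X0 - X1 * Y0) / (Y1 - u * Y0).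
  by field.
by field; rewrite h1 h2.
Qed.

Let ldiff_phi2 : ldiff phi2 0.
Proof.
exists psi2; rewrite phi20; split => //.
- have n1 := smat_near_neq0 sden den0n.
  apply: filterS3 n1 nTh (filterI (ntt nw1) ncuv) => z h1 [h2 h3] [h4 h5].
  have e1 : th (phi2 z) = Th z by rewrite /th /phi2 cv_rv2 artanhK.
  have e2 : uu (phi2 z) = cu z.
    rewrite /uu /de e1 /phi2 cu_rv2 /Th /den ratio //.
    rewrite -[RHS](mulfK h4); congr (_ / _); rewrite /w; ring.
  by rewrite /psi2 e2 /phi2 cu_rv2 h5 addrAC subrr add0r rv2K.
- have n1 := smat_near_neq0 sde de0.
  have n2 (A : R -> Prop) : (\forall t \near t0, A t) -> \forall z \near (rv2 t0 0 : P), A (cu z).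
    by move=> nA; apply: smat_continuous (smat_cu _) _ _; rewrite cu_rv2.
  apply: filterS3 n1 (n2 _ tauK) (n2 _ nw1) => z h1 h2 h3.
  have e1 : tt (psi2 z) = cu z by rewrite /tt /psi2 cu_rv2 cv_rv2 addrC subrK.
  have e2 : Th (psi2 z) = th z.
    rewrite /Th /den e1 /psi2 cu_rv2 /uu.
    have alg (X0 X1 Y0 Y1 t : R) : X0 + t * Y0 != 0 -> Y1 * X0 - X1 * Y0 != 0 ->
      ((X1 + t * Y1) / (X0 + t * Y0) * X0 - X1) / (Y1 - (X1 + t * Y1) / (X0 + t * Y0) * Y0) = t.
      move=> a1 a2.
      have -> : (X1 + t * Y1) / (X0 + t * Y0) * X0 - X1 = t * (Y1 * X0 - X1 * Y0) / (X0 + t * Y0) by field.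
      have -> : Y1 - (X1 + t * Y1) / (X0 + t * Y0) * Y0 = (Y1 * X0 - X1 * Y0) / (X0 + t * Y0) by field.
      by field; rewrite a1 a2.
    exact: alg h1 h3.
  by rewrite /phi2 e1 e2 /th tanhK rv2K.
Qed.

Let G i (z : P) := coshR (cv z) * x i (cu z) + sinhR (cv z) * y i (cu z).

(** For fixed t the surface point projects onto the tangent line of the projected curve at t,
    because y is proportional to x'. At abscissa u the tangent line at u + r has the heights
    [tangent_height]. *)
Let chart_G : \forall z \near (0 : P),
  chart (rv4 (G 0%N (phi2 z)) (G 1%N (phi2 z)) (G 2%N (phi2 z)) (G 3%N (phi2 z))) =
  rv4 (cu z) (tangent_height (p 2) z) (tangent_height (p 3) z) 0.
Proof.
have n1 := smat_near_neq0 sden den0n.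
have nq : \forall z \near (0 : P),
    [/\ x 0%N (tt z) ^+ 2 - x 1%N (tt z) ^+ 2 + x 2%N (tt z) ^+ 2 + x 3%N (tt z) ^+ 2 = 1,
    x 0%N (tt z) * y 0%N (tt z) - x 1%N (tt z) * y 1%N (tt z) + x 2%N (tt z) * y 2%N (tt z)
      + x 3%N (tt z) * y 3%N (tt z) = 0 &
    y 0%N (tt z) ^+ 2 - y 1%N (tt z) ^+ 2 + y 2%N (tt z) ^+ 2 + y 3%N (tt z) ^+ 2 = -1].
  by apply: filterS3 (ntt qxx) (ntt qxy) (ntt qyy).
have nd i : \forall z \near (0 : P), derive1 (p i) (cu z + cv z) = slope i (tt z).
  exact: (@near_cuv R (fun u => derive1 (p i) u = slope i (tau u)) (derive1_projected i)).
have nw : \forall z \near (0 : P), [/\ w 1%N (tt z) != 0, x 0%N (tt z) != 0 & s (tt z) = cu z + cv z].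
  by apply: filterS3 (ntt nw1) (ntt nx0) ncuv.
have nD : \forall z \near (0 : P), [/\ den z != 0, -1 < Th z & Th z < 1].
  by apply: filterS2 n1 nTh => z ? [].
have nd23 : \forall z \near (0 : P), derive1 (p 2) (cu z + cv z) = slope 2 (tt z) /\
    derive1 (p 3) (cu z + cv z) = slope 3 (tt z).
  by apply: filterS2 (nd 2) (nd 3).
have main z : [/\ x 0%N (tt z) ^+ 2 - x 1%N (tt z) ^+ 2 + x 2%N (tt z) ^+ 2 + x 3%N (tt z) ^+ 2 = 1,
    x 0%N (tt z) * y 0%N (tt z) - x 1%N (tt z) * y 1%N (tt z) + x 2%N (tt z) * y 2%N (tt z)
      + x 3%N (tt z) * y 3%N (tt z) = 0 &
    y 0%N (tt z) ^+ 2 - y 1%N (tt z) ^+ 2 + y 2%N (tt z) ^+ 2 + y 3%N (tt z) ^+ 2 = -1] ->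
  [/\ w 1%N (tt z) != 0, x 0%N (tt z) != 0 & s (tt z) = cu z + cv z] ->
  [/\ den z != 0, -1 < Th z & Th z < 1] ->
  (derive1 (p 2) (cu z + cv z) = slope 2 (tt z) /\ derive1 (p 3) (cu z + cv z) = slope 3 (tt z)) ->
  chart (rv4 (G 0%N (phi2 z)) (G 1%N (phi2 z)) (G 2%N (phi2 z)) (G 3%N (phi2 z))) =
  rv4 (cu z) (tangent_height (p 2) z) (tangent_height (p 3) z) 0; last first.
  by apply: filterS3 nq nw (filterI nD nd23) => z a b [c d]; exact: main.
move=> [q1 q2 q3] [h4 h7 h5] [h1 h2 h3] [d2 d3].
have c0 : coshR (cv (phi2 z)) != 0 by rewrite gt_eqF // coshR_gt0.
have e1 : sinhR (cv (phi2 z)) = Th z * coshR (cv (phi2 z)).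
  by rewrite -(artanhK h2 h3) /phi2 cv_rv2 divfK // gt_eqF // coshR_gt0.
have Gi i : G i (phi2 z) / G 0%N (phi2 z) =
    (x i (tt z) * den z + (cu z * x 0%N (tt z) - x 1%N (tt z)) * y i (tt z)) / w 1%N (tt z).
  have alg (c t a b a' b' : R) : c != 0 -> (c * a + t * c * b) / (c * a' + t * c * b') =
      (a + t * b) / (a' + t * b').
    move=> c'; have -> : c * a + t * c * b = c * (a + t * b) by ring.
    have -> : c * a' + t * c * b' = c * (a' + t * b') by ring.
    by rewrite invfM mulrACA divff // mul1r.
  by rewrite /G e1 alg // {1 2}/phi2 !cu_rv2 /Th ratio.
have T i : derive1 (p i) (cu z + cv z) = slope i (tt z) -> G i (phi2 z) / G 0%N (phi2 z) = tangent_height (p i) z.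
  move=> di; rewrite Gi /tangent_height di /p -/(tt z) /slope.
  have -> : cv z = s (tt z) - cu z by rewrite h5 addrAC subrr add0r.
  rewrite /s /w /den; rewrite /w in h4.
  by field; rewrite h4 h7.
rewrite /chart !(coord4_rv4 (G 0%N (phi2 z))); congr rv4.
- rewrite Gi -[RHS](mulfK h4); congr (_ / _); rewrite /den /w; ring.
- exact: T d2.
- exact: T d3.
(* The fourth coordinate is the quadric evaluated on cosh x + sinh y; by the relations on x and y it
   equals cosh^2 - sinh^2 - 1. *)
- have ch := cosh2_sinh2 (cv (phi2 z)); rewrite /G /phi2 !cu_rv2 -/(phi2 z).
  move: q1 q2 q3 ch; rewrite /phi2 cv_rv2.
  move: (coshR _) (sinhR _) => c d.
  move: (x 0%N _) (x 1%N _) (x 2%N _) (x 3%N _) (y 0%N _) (y 1%N _) (y 2%N _) (y 3%N _).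
  move=> a0 a1 a2 a3 b0 b1 b2 b3 q1 q2 q3 ch.
  have -> : (c * a0 + d * b0) ^+ 2 - (c * a1 + d * b1) ^+ 2 + (c * a2 + d * b2) ^+ 2 +
    (c * a3 + d * b3) ^+ 2 - 1 = c ^+ 2 * (a0 ^+ 2 - a1 ^+ 2 + a2 ^+ 2 + a3 ^+ 2)
    + 2 * c * d * (a0 * b0 - a1 * b1 + a2 * b2 + a3 * b3)
    + d ^+ 2 * (b0 ^+ 2 - b1 ^+ 2 + b2 ^+ 2 + b3 ^+ 2) - 1 by ring.
  by rewrite q1 q2 q3 mulr1 mulr0 addr0 mulrN1 ch subrr.
Qed.

Lemma dual_pair_cusp_tau : exists phi Psi, [/\ ldiff phi (0 : P), phi 0 = rv2 t0 0,
  ldiff Psi (rv4 1 0 0 0 : 'rV[R]_4) &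
  \forall z \near (0 : P),
    Psi (rv4 (G 0%N (phi z)) (G 1%N (phi z)) (G 2%N (phi z)) (G 3%N (phi z))) = cuspidal_edge_nf z].
Proof.
have [s2 s3 j2 j3 j4] := projected_jets.
have [t1 t2 _] := tangent_height_jets s2; have [t3 t4 t5] := tangent_height_jets s3.
have j3' : pd1 (pd1 (tangent_height (p 2))) 0 != 0.
  by rewrite t2 oppr_eq0; exact: j2.
have j4' : pd1 (pd1 (tangent_height (p 3))) 0 = 0.
  by rewrite t4 j3; exact: oppr0.
have j5' : pd1 (pd1 (pd1 (tangent_height (p 3)))) 0 != 0.
  by rewrite t5; apply: mulf_neq0; [rewrite oppr_eq0 pnatr_eq0|exact: j4].
have [phi1 [Psi1 [l1 z1 L1 E1]]] := cusp_normal_form (smat_tangent_height s2)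
  (smat_tangent_height s3) t1 t3 j3' j4' j5'.
have l2 := ldiff_phi2; rewrite -z1 in l2.
have h0 i : (i < 4)%N -> (1 < i)%N -> tangent_height (p i) 0 = 0.
  move=> i4 i1; rewrite /tangent_height cu0 cv0 addr0 mul0r subr0 /p tau0 x0 // gtn_eqF ?mul0r //.
  exact: ltnW.
have e0 : chart (rv4 1 0 0 0) = rv4 0 (tangent_height (p 2) 0) (tangent_height (p 3) 0) 0.
  rewrite !h0 // /chart !(coord4_rv4 1 0 0 0) !mul0r; congr rv4; ring.
exists (phi2 \o phi1), (Psi1 \o @chart R); split.
- exact: ldiff_comp l1 l2.
- by rewrite /= z1.
- by apply: ldiff_comp; [exact: ldiff_chart|rewrite e0].
have [psi1 [sp1 _ _ _]] := l1.
have cG : \forall z \near (0 : P), chart (rv4 (G 0%N (phi2 (phi1 z))) (G 1%N (phi2 (phi1 z)))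
    (G 2%N (phi2 (phi1 z))) (G 3%N (phi2 (phi1 z)))) =
  rv4 (cu (phi1 z)) (tangent_height (p 2) (phi1 z)) (tangent_height (p 3) (phi1 z)) 0.
  have cp := smat_continuous sp1; rewrite /prop_for /continuous_at z1 in cp.
  exact: cp _ chart_G.
by apply: filterS2 cG E1 => z /= h; rewrite h.
Qed.

End Curves.

(* [x] and [y] play the roles of [mu] and [nu] in a constant frame adapted to [t0]. *)
Theorem dual_pair_cusp (x y n : nat -> R -> R) (ka rho : R -> R) (t0 : R) :
  (forall i, smat t0 (x i)) -> (forall i, smat t0 (y i)) -> (forall i, smat t0 (n i)) ->
  smat t0 rho ->
  (forall i, \forall t \near t0, is_derive (t : R) 1 (x i) (- (ka t * y i t))) ->
  (forall i, \forall t \near t0, is_derive (t : R) 1 (y i) (rho t * n i t - ka t * x i t)) ->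
  (forall i, (i < 4)%N -> x i t0 = (i == 0%N)%:R) ->
  (forall i, (i < 4)%N -> y i t0 = - (i == 1%N)%:R) ->
  (forall i, (i < 4)%N -> n i t0 = (i == 2%N)%:R) ->
  0 < ka t0 -> rho t0 != 0 -> derive1 (n 3) t0 != 0 ->
  (\forall t \near t0, x 0%N t ^+ 2 - x 1%N t ^+ 2 + x 2%N t ^+ 2 + x 3%N t ^+ 2 = 1) ->
  (\forall t \near t0,
    x 0%N t * y 0%N t - x 1%N t * y 1%N t + x 2%N t * y 2%N t + x 3%N t * y 3%N t = 0) ->
  (\forall t \near t0, y 0%N t ^+ 2 - y 1%N t ^+ 2 + y 2%N t ^+ 2 + y 3%N t ^+ 2 = -1) ->
  let G i (z : P) := coshR (cv z) * x i (cu z) + sinhR (cv z) * y i (cu z) in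
  exists phi Psi, [/\ ldiff phi (0 : P), phi 0 = rv2 t0 0, ldiff Psi (rv4 1 0 0 0 : 'rV[R]_4) &
  \forall z \near (0 : P),
    Psi (rv4 (G 0%N (phi z)) (G 1%N (phi z)) (G 2%N (phi z)) (G 3%N (phi z))) = cuspidal_edge_nf z].
Proof.
move=> sx sy sn srho dx dy x0 y0 n0 ka0 rho0 dn3 qxx qxy qyy G.
have [|||tau [st t00 tK sK]] := @inverse_1d R (fun t => x 1%N t / x 0%N t) t0.
- by apply: smat_div => //; rewrite x0 // oner_neq0.
- by rewrite x0 // mul0r.
- exact: (projected_abscissa_increasing dx x0 y0 ka0).
exact: (dual_pair_cusp_tau sx sy sn srho dx dy x0 y0 n0 rho0 dn3 st t00 sK tK qxx qxy qyy).
Qed.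

End DualPair.

(** * The Frenet type frame *)

Section LorentzFrames.
Variable R : realType.
Local Notation V4 := 'rV[R]_4.

Definition minor3 (a : nat -> nat -> R) : R :=
  a 0%N 0%N * (a 1%N 1%N * a 2%N 2%N - a 1%N 2%N * a 2%N 1%N)
  - a 0%N 1%N * (a 1%N 0%N * a 2%N 2%N - a 1%N 2%N * a 2%N 0%N)
  + a 0%N 2%N * (a 1%N 0%N * a 2%N 1%N - a 1%N 1%N * a 2%N 0%N).

Lemma det3E (A : 'M[R]_3) a : (forall i j : 'I_3, A i j = a (val i) (val j)) -> \det A = minor3 a.
Proof.
move=> h; rewrite (expand_det_row _ ord0) !big_ord_recl big_ord0 /cofactor.
rewrite !(expand_det_row _ ord0) !big_ord_recl !big_ord0 /cofactor !det_mx11 !mxE /=.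
by rewrite !h /= /bump /= /minor3; ring.
Qed.

Lemma det4E (A : 'M[R]_4) a : (forall i j : 'I_4, A i j = a (val i) (val j)) ->
  \det A = a 0%N 0%N * minor3 (fun i j => a i.+1 (bump 0 j))
   - a 0%N 1%N * minor3 (fun i j => a i.+1 (bump 1 j))
   + a 0%N 2%N * minor3 (fun i j => a i.+1 (bump 2 j))
   - a 0%N 3%N * minor3 (fun i j => a i.+1 (bump 3 j)).
Proof.
move=> h; rewrite (expand_det_row _ ord0) !big_ord_recl big_ord0 /cofactor.
have D (c : 'I_4) : \det (row' ord0 (col' c A)) = minor3 (fun i j => a i.+1 (bump c j)).
  by apply: det3E => i j; rewrite !mxE h.
by rewrite !D !h /= /bump /=; ring.
Qed.

(** The cofactor signs +, -, +, - meet the minus sign of e0, which leaves the pattern -, -, +, -. *)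
Lemma coord4_wedge3 (x y z : V4) : let X := coord4 x in let Y := coord4 y in let Z := coord4 z in
  let d i j k := X i * (Y j * Z k - Y k * Z j) - X j * (Y i * Z k - Y k * Z i)
    + X k * (Y i * Z j - Y j * Z i) in
  (coord4 (wedge3 x y z) 0 = - d 1%N 2%N 3%N) * (coord4 (wedge3 x y z) 1 = - d 0%N 2%N 3%N) *
  (coord4 (wedge3 x y z) 2 = d 0%N 1%N 3%N) * (coord4 (wedge3 x y z) 3 = - d 0%N 1%N 2%N).
Proof.
move=> X Y Z d.
pose a (k i j : nat) : R := match i with
  | 0%N => (k == j)%:R | 1%N => X j | 2%N => Y j | _ => Z j end.
have E k : (k < 4)%N -> coord4 (wedge3 x y z) k = (if k == 0%N then -1 else 1) *
   (a k 0%N 0%N * minor3 (fun i j => a k i.+1 (bump 0 j))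
   - a k 0%N 1%N * minor3 (fun i j => a k i.+1 (bump 1 j))
   + a k 0%N 2%N * minor3 (fun i j => a k i.+1 (bump 2 j))
   - a k 0%N 3%N * minor3 (fun i j => a k i.+1 (bump 3 j))).
  move=> k4; rewrite {1}/coord4 mxE /= inordK //; congr (_ * _).
  apply: (@det4E _ (a k)) => i j; rewrite mxE /a /X /Y /Z /coord4.
  case: i => [[|[|[|m]]] hi] /=; rewrite ?inord_val //.
  by rewrite -(inj_eq val_inj) /= inordK.
by rewrite !E // /a /minor3 /bump /= /d; do !split; ring.
Qed.

Lemma lorC (x y : V4) : lor x y = lor y x.
Proof. by rewrite /lor; ring. Qed.

Lemma coord4D (x y : V4) i : coord4 (x + y) i = coord4 x i + coord4 y i.
Proof. by rewrite /coord4 mxE. Qed.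

Lemma coord4Z (k : R) (x : V4) i : coord4 (k *: x) i = k * coord4 x i.
Proof. by rewrite /coord4 mxE. Qed.

Lemma lorDl (x y z : V4) : lor (x + y) z = lor x z + lor y z.
Proof. by rewrite /lor !coord4D; ring. Qed.

Lemma lorZl (k : R) (x z : V4) : lor (k *: x) z = k * lor x z.
Proof. by rewrite /lor !coord4Z; ring. Qed.

Lemma lor0l (z : V4) : lor 0 z = 0.
Proof. by rewrite -(scale0r 0) lorZl mul0r. Qed.

Lemma lorDr (x y z : V4) : lor z (x + y) = lor z x + lor z y.
Proof. by rewrite /lor !coord4D; ring. Qed.

Lemma lorZr (k : R) (x z : V4) : lor z (k *: x) = k * lor z x.
Proof. by rewrite /lor !coord4Z; ring. Qed.

Lemma wedge3_orth (x y z : V4) : [/\ lor (wedge3 x y z) x = 0, lor (wedge3 x y z) y = 0 &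
  lor (wedge3 x y z) z = 0].
Proof. by rewrite /lor !(coord4_wedge3 x y z); split; ring. Qed.

(** Minus the Gram determinant; the sign is that of the determinant of the metric. *)
Lemma wedge3_norm (x y z : V4) : lor (wedge3 x y z) (wedge3 x y z) =
  - (lor x x * (lor y y * lor z z - lor y z ^+ 2) - lor x y * (lor x y * lor z z - lor y z * lor x z)
     + lor x z * (lor x y * lor y z - lor y y * lor x z)).
Proof. by rewrite /lor !(coord4_wedge3 x y z); ring. Qed.

(** [eps i] is the causal sign of [e i], equal to its own inverse. *)
Definition pseudo_frame (e : 'I_4 -> V4) (eps : 'I_4 -> R) :=
  (forall i, eps i * eps i = 1) /\ forall i j, lor (e i) (e j) = eps i * (i == j)%:R.

Lemma coord4_eq (x y : V4) : (forall i, (i < 4)%N -> coord4 x i = coord4 y i) -> x = y.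
Proof. by move=> h; rewrite -(rv4K x) -(rv4K y) !h. Qed.

Lemma lor_sum (x y : V4) : lor x y = \sum_(k < 4) (if val k == 0%N then -1 else 1) * (x ord0 k * y ord0 k).
Proof.
have E (w : V4) (k : 'I_4) : w ord0 k = coord4 w k by rewrite /coord4 inord_val.
under eq_bigr do rewrite !E.
by rewrite !big_ord_recl big_ord0 /= /bump /= /lor; ring.
Qed.

(** The Gram relations say that [N], the transpose of the frame matrix corrected by signs, is a
    right inverse of [M]; for square matrices it is also a left inverse. *)
Lemma frame_expansion e eps : pseudo_frame e eps ->
  forall w, w = \sum_i (eps i * lor w (e i)) *: e i.
Proof.
move=> [eps2 gram] w.
pose M : 'M[R]_4 := \matrix_(i, j) e i ord0 j.
pose N : 'M[R]_4 := \matrix_(i, j) ((if val i == 0%N then -1 else 1) * e j ord0 i * eps j).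
have MN : M *m N = 1%:M.
  apply/matrixP => i j; rewrite !mxE.
  under eq_bigr do rewrite !mxE.
  have -> : \sum_(k < 4) e i ord0 k * ((if val k == 0%N then -1 else 1) * e j ord0 k * eps j) =
     lor (e i) (e j) * eps j.
    by rewrite lor_sum mulr_suml; apply: eq_bigr => k _; ring.
  rewrite gram; case: eqVneq => [->|_]; first by rewrite mulr1 eps2.
  by rewrite mulr0 mul0r.
have NM := mulmx1C MN.
have : w *m (N *m M) = w by rewrite NM mulmx1.
move=> e1; apply/rowP => j; rewrite -{1}e1 mulmxA mxE summxE; apply: eq_bigr => i _.
rewrite !mxE; congr (_ * _).
rewrite lor_sum mulr_sumr; apply: eq_bigr => k _; rewrite !mxE; ring.
Qed.

Lemma lor_suml (f : 'I_4 -> V4) w : lor (\sum_i f i) w = \sum_i lor (f i) w.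
Proof. by rewrite !big_ord_recl !big_ord0 /= !lorDl /lor /coord4 !mxE; ring. Qed.

Lemma frame_lor e eps : pseudo_frame e eps ->
  forall w w', lor w w' = \sum_i eps i * (lor w (e i) * lor w' (e i)).
Proof.
move=> fe w w'; rewrite {1}(frame_expansion fe w).
rewrite lor_suml; apply: eq_bigr => i _.
by rewrite lorZl (lorC w' (e i)) mulrA.
Qed.

End LorentzFrames.

(** * Derivatives of curves in Minkowski space *)

Section VectorCurves.
Variable R : realType.
Local Notation V4 := 'rV[R]_4.
Implicit Types (f h : R -> V4) (t : R) (d : V4).

(** Coordinatewise, so that the one-variable rules apply to scalar multiples and Lorentz
    products. *)
Definition vder f t d := forall i, is_derive t 1 (fun s => coord4 (f s) i) (coord4 d i).

Lemma smat_vder f t : smat t f -> vder f t (derive1 f t).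
Proof.
move=> sf i; have [df _] := smat_is_derive sf.
have si : smat t (fun s => coord4 (f s) i) by exact: (iffLR (smat_rV f t) sf (inord i)).
have e : coord4 (derive1 f t) i = derive1 (fun s => coord4 (f s) i) t.
  by rewrite !derive1E (derive_mx df) /coord4 mxE.
by rewrite e; exact: smat_is_derive si.
Qed.

Lemma vder_line (F : 'rV[R]_2 -> V4) (p v : 'rV[R]_2) : differentiable F p ->
  vder (fun s : R => F (s *: v + p)) 0 ('d F p v).
Proof.
move=> df; have dv : derivable F p v by exact: diff_derivable.
rewrite -(deriveE v df) (derive_mx dv) => i.
have dvi : derivable (fun x => coord4 (F x) i) p v by exact: (iffLR (derivable_mxP F p v) dv).
rewrite {2}/coord4 mxE.
have E : (fun h : R => h^-1 *: (coord4 (F ((h *: 1 + 0) *: v + p)) i - coord4 (F (0 *: v + p)) i)) =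
         (fun h : R => h^-1 *: (coord4 (F (h *: v + p)) i - coord4 (F p) i)).
  by apply/funext => h; rewrite [h *: 1]mulr1 addr0 scale0r add0r.
by apply: DeriveDef; rewrite ?/derivable ?/derive /= E.
Qed.

Lemma vder_comp f (k : R -> R) t (dk : R) d : is_derive t 1 k dk -> vder f (k t) d ->
  vder (fun s => f (k s)) t (dk *: d).
Proof.
by move=> hk df i; apply: der_eq (der_comp hk (df i)) _; rewrite coord4Z mulrC.
Qed.

Lemma vderD f h t d d' : vder f t d -> vder h t d' -> vder (fun s => f s + h s) t (d + d').
Proof.
move=> df dh i; rewrite coord4D (_ : (fun s => _) = (fun s => coord4 (f s) i + coord4 (h s) i)).
  exact: derD.
by apply/funext => s; rewrite coord4D.
Qed.

Lemma vderZ (k : R -> R) f t (dk : R) d : is_derive t 1 k dk -> vder f t d ->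
  vder (fun s => k s *: f s) t (k t *: d + dk *: f t).
Proof.
move=> hk df i; rewrite (_ : (fun s => _) = (fun s => k s * coord4 (f s) i)).
  by apply: der_eq (derM hk (df i)) _; rewrite coord4D !coord4Z [dk * _]mulrC.
by apply/funext => s; rewrite coord4Z.
Qed.

Lemma der_expRZ (c t : R) : is_derive t 1 (fun s => expR (c * s)) (c * expR (c * t)).
Proof. by apply: der_eq (der_comp (derZ c (der_id t)) (is_derive_expR (c * t))) _; ring. Qed.

Lemma der_coshR (t : R) : is_derive t 1 (@coshR R) (sinhR t).
Proof.
rewrite (_ : @coshR R = fun s => (expR (1 * s) + expR (-1 * s)) * 2^-1).
  apply: der_eq (derM (derD (der_expRZ 1 t) (der_expRZ (-1) t)) (der_cst 2^-1 t)) _.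
  by rewrite /sinhR mulN1r !mul1r; field.
by apply/funext => s; rewrite mul1r mulN1r.
Qed.

Lemma der_sinhR (t : R) : is_derive t 1 (@sinhR R) (coshR t).
Proof.
rewrite (_ : @sinhR R = fun s => (expR (1 * s) - expR (-1 * s)) * 2^-1).
  apply: der_eq (derM (derB (der_expRZ 1 t) (der_expRZ (-1) t)) (der_cst 2^-1 t)) _.
  by rewrite /coshR mulN1r !mul1r; field.
by apply/funext => s; rewrite mul1r mulN1r.
Qed.

Lemma sinhR_eq0 (t : R) : sinhR t = 0 -> t = 0.
Proof.
move=> s0; have e : expR t = expR (- t).
  by move: s0; rewrite /sinhR => s0; lra.
by have := expR_inj e; lra.
Qed.

Lemma vder_uniq f t d d' : vder f t d -> vder f t d' -> d = d'.
Proof. by move=> h1 h2; apply: coord4_eq => i _; exact: is_derive_uniq (h1 i) (h2 i). Qed.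

Lemma vder_lor f h t d d' : vder f t d -> vder h t d' ->
  is_derive t 1 (fun s => lor (f s) (h s)) (lor d (h t) + lor (f t) d').
Proof.
move=> df dh; rewrite /lor.
apply: der_eq (derD (derD (derD (derN (derM (df 0%N) (dh 0%N))) (derM (df 1%N) (dh 1%N)))
  (derM (df 2%N) (dh 2%N))) (derM (df 3%N) (dh 3%N))) _.
ring.
Qed.

Lemma vder_lorc f t d (e : V4) : vder f t d -> is_derive t 1 (fun s => lor (f s) e) (lor d e).
Proof.
move=> df; have de : vder (fun=> e) t 0.
  by move=> i; rewrite /coord4 mxE; exact: der_cst.
apply: der_eq (vder_lor df de) _.
by rewrite /lor /coord4 !mxE; ring.
Qed.

Lemma smat_coord_curve (V : normedModType R) (f : V -> V4) x i : smat x f -> smat x (fun s => coord4 (f s) i).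
Proof. by move=> sf; exact: (iffLR (smat_rV f x) sf (inord i)). Qed.

Lemma smat_of_coords (V : normedModType R) (f : V -> V4) x : (forall i, smat x (fun s => coord4 (f s) i)) -> smat x f.
Proof.
move=> h; apply/smat_rV => i; have := h i.
by rewrite /coord4 inord_val.
Qed.

Lemma smat_scale (V : normedModType R) (k : V -> R) (f : V -> V4) x : smat x k -> smat x f ->
  smat x (fun s => k s *: f s).
Proof.
move=> sk sf; apply: smat_of_coords => i.
rewrite (_ : (fun s => _) = (fun s => k s * coord4 (f s) i)).
  by apply: smatM => //; exact: smat_coord_curve.
by apply/funext => s; rewrite coord4Z.
Qed.

Lemma smat_lor (V : normedModType R) (f h : V -> V4) x : smat x f -> smat x h ->
  smat x (fun s => lor (f s) (h s)).
Proof.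
move=> sf sh; have c i := smat_coord_curve i sf; have c' i := smat_coord_curve i sh.
have m i : smat x (fun s => coord4 (f s) i * coord4 (h s) i) by exact: smatM (c i) (c' i).
exact: smatD (smatD (smatD (smatN (m 0%N)) (m 1%N)) (m 2%N)) (m 3%N).
Qed.

Lemma smat_wedge3 (V : normedModType R) (f h k : V -> V4) x : smat x f -> smat x h -> smat x k ->
  smat x (fun s => wedge3 (f s) (h s) (k s)).
Proof.
move=> sf sh sk.
have c i := smat_coord_curve i sf; have c' i := smat_coord_curve i sh.
have c2 i := smat_coord_curve i sk.
pose d i j l s := coord4 (f s) i * (coord4 (h s) j * coord4 (k s) l - coord4 (h s) l * coord4 (k s) j)
  - coord4 (f s) j * (coord4 (h s) i * coord4 (k s) l - coord4 (h s) l * coord4 (k s) i)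
  + coord4 (f s) l * (coord4 (h s) i * coord4 (k s) j - coord4 (h s) j * coord4 (k s) i).
have sd i j l : smat x (d i j l).
  have q p r : smat x (fun s => coord4 (h s) p * coord4 (k s) r - coord4 (h s) r * coord4 (k s) p).
    exact: smatB (smatM (c' _) (c2 _)) (smatM (c' _) (c2 _)).
  exact: smatD (smatB (smatM (c _) (q _ _)) (smatM (c _) (q _ _))) (smatM (c _) (q _ _)).
have E : (fun s => wedge3 (f s) (h s) (k s)) = (fun s => rv4 (- d 1%N 2%N 3%N s) (- d 0%N 2%N 3%N s)
    (d 0%N 1%N 3%N s) (- d 0%N 1%N 2%N s)).
  by apply/funext => s; rewrite -[LHS]rv4K !(coord4_wedge3 (f s)).
by rewrite E; apply: smat_rv4 => //; apply: smatN.
Qed.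

(** The map is linear and the frame expansion is its inverse. *)
Lemma pseudo_frame_coordinates_ldiff (e : nat -> V4) (eps : 'I_4 -> R) w :
  pseudo_frame (fun i : 'I_4 => e i) eps ->
  ldiff (fun w => rv4 (lor w (e 0%N)) (lor w (e 1%N)) (lor w (e 2%N)) (lor w (e 3%N))) w.
Proof.
move=> fe.
pose lam (w : V4) := rv4 (lor w (e 0%N)) (lor w (e 1%N)) (lor w (e 2%N)) (lor w (e 3%N)).
pose psi (z : V4) := \sum_(i < 4) (eps i * coord4 z i) *: e i.
have lamE w' (i : 'I_4) : coord4 (lam w') i = lor w' (e i).
  by case: i => [[|[|[|[|//]]]] hi]; rewrite /lam coord4_rv4.
have psiK w' : psi (lam w') = w'.
  by rewrite [RHS](frame_expansion fe); apply: eq_bigr => i _; rewrite lamE.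
have lamK z : lam (psi z) = z.
  have [eps2 gram] := fe.
  apply: coord4_eq => i i4; rewrite (lamE _ (Ordinal i4)) /psi lor_suml (bigD1 (Ordinal i4)) //= big1.
    by rewrite lorZl (gram (Ordinal i4) (Ordinal i4)) eqxx mulr1 addr0 mulrAC eps2 mul1r.
  by move=> k ki; rewrite lorZl (gram k (Ordinal i4)) (negbTE ki) !mulr0.
have slor w' i : smat w' (fun w => lor w (e i)).
  apply: smat_lor (smat_cst (e i) w').
  by apply/smat_rV => j; exact: smat_coord.
have spsi z : smat z psi.
  apply: smat_of_coords => i.
  have E : (fun z => coord4 (psi z) i) = (fun z => \sum_(k < 4) eps k * coord4 z k * coord4 (e k) i).
    apply/funext => z'; rewrite /psi {1}/coord4 summxE; apply: eq_bigr => k _.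
    by rewrite mxE.
  rewrite E; apply: smat_sum => k.
  exact: smatM (smatM (smat_cst (eps k) z) (smat_coord4 k z)) (smat_cst (coord4 (e k) i) z).
exists psi; split.
- exact: smat_rv4.
- exact: spsi.
- by apply: (filterS _ (@filterT _ (nbhs w) _)) => y _; exact: psiK.
- by apply: (filterS _ (@filterT _ (nbhs (lam w)) _)) => y _; exact: lamK.
Qed.

End VectorCurves.

(** * Frenet equations of the framed curve and its dual surface *)

Section FramedCurve.
Variable R : realType.
Local Notation V4 := 'rV[R]_4.
Variables (I : set R) (g v1 v2 : R -> V4).
Hypothesis oI : open I.
Hypothesis fc : hyperbolic_framed_curve I g v1 v2.
Hypothesis ab0 : forall t, I t -> a_of g v1 v2 t ^+ 2 + b_of g v1 v2 t ^+ 2 != 0.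
Hypothesis MA0 : forall t, I t ->
     M_of g v1 v2 t * (derive1 (A_of g v1 v2)) t
     - (derive1 (M_of g v1 v2)) t * A_of g v1 v2 t = 0.
Hypothesis MA : forall t, I t -> A_of g v1 v2 t ^+ 2 < M_of g v1 v2 t ^+ 2.
Hypothesis N0 : forall t, I t -> N_of g v1 v2 t != 0.

Local Notation mu := (mu_of g v1 v2).
Local Notation a := (a_of g v1 v2).
Local Notation b := (b_of g v1 v2).
Local Notation M := (M_of g v1 v2).
Local Notation A := (A_of g v1 v2).
Local Notation N := (N_of g v1 v2).
Local Notation n := (n_of v1 v2).
Local Notation n1 := (n1_of g v1 v2).
Local Notation n2 := (n2_of g v1 v2).

Let near_I t : I t -> \forall s \near t, I s.
Proof. by move=> It; exact: open_nbhs_nbhs. Qed.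

Let sg t : I t -> smat t g.
Proof. by move=> It; have [h _ _ _] := fc; exact: smooth_on_smat oI (smooth_curve_on oI h) It. Qed.

Let sv1 t : I t -> smat t v1.
Proof. by move=> It; have [_ h _ _] := fc; exact: smooth_on_smat oI (smooth_curve_on oI h) It. Qed.

Let sv2 t : I t -> smat t v2.
Proof. by move=> It; have [_ _ h _] := fc; exact: smooth_on_smat oI (smooth_curve_on oI h) It. Qed.

Let smu t : I t -> smat t mu.
Proof. by move=> It; apply: smat_wedge3; [exact: sg|exact: sv1|exact: sv2]. Qed.

Let gram t : I t -> [/\ lor (g t) (g t) = -1, lor (v1 t) (v1 t) = 1, lor (v2 t) (v2 t) = 1,
  lor (v1 t) (v2 t) = 0 & lor (g t) (v1 t) = 0 /\ lor (g t) (v2 t) = 0].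
Proof. by move=> It; have [_ _ _ /(_ t It)[h1 h2 h3 h4 [h5 h6 _ _]]] := fc. Qed.

Let gram_mu t : I t -> [/\ lor (mu t) (g t) = 0, lor (mu t) (v1 t) = 0, lor (mu t) (v2 t) = 0 &
  lor (mu t) (mu t) = 1].
Proof.
move=> It; have [h1 h2 h3 h4 [h5 h6]] := gram It.
have [w1 w2 w3] := wedge3_orth (g t) (v1 t) (v2 t); split => //.
by rewrite /mu_of wedge3_norm h1 h2 h3 h4 h5 h6; ring.
Qed.

Let expand t (w : V4) : I t -> w = - lor w (g t) *: g t + lor w (v1 t) *: v1 t +
  lor w (v2 t) *: v2 t + lor w (mu t) *: mu t.
Proof.
move=> It; have [h1 h2 h3 h4 [h5 h6]] := gram It; have [h7 h8 h9 h10] := gram_mu It.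
pose e (i : 'I_4) : V4 := match val i with 0%N => g t | 1%N => v1 t | 2%N => v2 t | _ => mu t end.
pose eps (i : 'I_4) : R := if val i == 0%N then -1 else 1.
have fr : pseudo_frame e eps.
  split=> [i|i j]; first by rewrite /eps; case: ifP => _; ring.
  case: i => [[|[|[|[|//]]]] hi]; case: j => [[|[|[|[|//]]]] hj];
  rewrite /e /eps /= ?h1 ?h2 ?h3 ?h4 ?h5 ?h6 ?h7 ?h8 ?h9 ?h10 ?(lorC (g t) (mu t)) ?(lorC (v1 t) (mu t))
   ?(lorC (v2 t) (mu t)) ?(lorC (v1 t) (g t)) ?(lorC (v2 t) (g t)) ?(lorC (v2 t) (v1 t))
   ?h1 ?h2 ?h3 ?h4 ?h5 ?h6 ?h7 ?h8 ?h9 ?h10 ?mulr0 ?mulr1 //.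
rewrite {1}(frame_expansion fr w) !big_ord_recl big_ord0 /e /eps /= /bump /=.
by rewrite !mul1r mulN1r addr0 !addrA.
Qed.

Let lor_const (f h : R -> V4) (c : R) t : smat t f -> smat t h ->
  (forall s, I s -> lor (f s) (h s) = c) -> I t -> lor (derive1 f t) (h t) = - lor (derive1 h t) (f t).
Proof.
move=> sf sh fh It; have d := vder_lor (smat_vder sf) (smat_vder sh).
have d0 : is_derive t 1 (fun s => lor (f s) (h s)) 0.
  apply: (@der_near R (fun=> c) _ t 0 _ (der_cst c t)).
  by apply: filterS (near_I It) => s Is; rewrite fh.
by have := is_derive_uniq d d0; rewrite (lorC (f t)) => /eqP; rewrite addr_eq0 => /eqP.
Qed.

Let self_orth (f : R -> V4) (c : R) t : smat t f ->
  (forall s, I s -> lor (f s) (f s) = c) -> I t -> lor (derive1 f t) (f t) = 0.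
Proof.
move=> sf fh It; have := lor_const sf sf fh It; move: (lor _ _) => z h.
have e : z + z = 0 by rewrite {1}h addNr.
lra.
Qed.

Let dg t : I t -> derive1 g t = M t *: mu t.
Proof.
move=> It; rewrite (expand (derive1 g t) It).
have [_ _ _ /(_ t It)[_ _ _ _ [_ _ e1 e2]]] := fc.
rewrite e1 e2 (self_orth (sg It) (fun s Is => let: And5 h _ _ _ _ := gram Is in h) It).
by rewrite oppr0 !scale0r !add0r.
Qed.

Let dv1 t : I t -> derive1 v1 t = n t *: v2 t + a t *: mu t.
Proof.
move=> It; rewrite (expand (derive1 v1 t) It).
have [_ _ _ /(_ t It)[_ _ _ _ [_ _ e1 _]]] := fc.
rewrite (self_orth (sv1 It) (fun s Is => let: And5 _ h _ _ _ := gram Is in h) It).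
rewrite (lor_const (c := 0) (sv1 It) (sg It) _ It) ?e1; last first.
  by move=> s Is; rewrite lorC; have [_ _ _ _ []] := gram Is.
by rewrite !oppr0 !scale0r !add0r.
Qed.

Let dv2 t : I t -> derive1 v2 t = - n t *: v1 t + b t *: mu t.
Proof.
move=> It; rewrite (expand (derive1 v2 t) It).
have [_ _ _ /(_ t It)[_ _ _ _ [_ _ _ e2]]] := fc.
rewrite (self_orth (sv2 It) (fun s Is => let: And5 _ _ h _ _ := gram Is in h) It).
rewrite (lor_const (c := 0) (sv2 It) (sg It) _ It) ?e2; last first.
  by move=> s Is; rewrite lorC; have [_ _ _ _ []] := gram Is.
rewrite (lor_const (c := 0) (sv2 It) (sv1 It) _ It); last first.
  by move=> s Is; rewrite lorC; have [_ _ _ h _] := gram Is.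
by rewrite !oppr0 !scale0r add0r addr0.
Qed.

Let dmu t : I t -> derive1 mu t = M t *: g t + (- a t *: v1 t - b t *: v2 t).
Proof.
move=> It; rewrite (expand (derive1 mu t) It).
rewrite (self_orth (smu It) (fun s Is => let: And4 _ _ _ h := gram_mu Is in h) It).
rewrite (lor_const (c := 0) (smu It) (sg It) _ It); last by move=> s /gram_mu[].
rewrite (lor_const (c := 0) (smu It) (sv1 It) _ It); last by move=> s /gram_mu[].
rewrite (lor_const (c := 0) (smu It) (sv2 It) _ It); last by move=> s /gram_mu[].
by rewrite opprK scale0r addr0 -addrA !scaleNr.
Qed.

Let sa t : I t -> smat t a.
Proof. by move=> It; apply: smat_lor; [exact: smat_derive1 (sv1 It)|exact: smu]. Qed.

Let sb t : I t -> smat t b.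
Proof. by move=> It; apply: smat_lor; [exact: smat_derive1 (sv2 It)|exact: smu]. Qed.

Let sM t : I t -> smat t M.
Proof. by move=> It; apply: smat_lor; [exact: smat_derive1 (sg It)|exact: smu]. Qed.

Let sn t : I t -> smat t n.
Proof. by move=> It; apply: smat_lor; [exact: smat_derive1 (sv1 It)|exact: sv2]. Qed.

Let ab_gt0 t : I t -> 0 < a t ^+ 2 + b t ^+ 2.
Proof. by move=> It; rewrite lt_neqAle eq_sym ab0 //= addr_ge0 ?sqr_ge0. Qed.

Let sab t : I t -> smat t (fun s => a s ^+ 2 + b s ^+ 2).
Proof. by move=> It; exact: smatD (smatX 2 (sa It)) (smatX 2 (sb It)). Qed.

Let sA t : I t -> smat t A.
Proof. by move=> It; apply: smat_sqrt (sab It) (ab_gt0 It). Qed.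

Let A_gt0 t : I t -> 0 < A t.
Proof. by move=> It; rewrite sqrtr_gt0 ab_gt0. Qed.

Let A2 t : A t ^+ 2 = a t ^+ 2 + b t ^+ 2.
Proof. by rewrite sqr_sqrtr // addr_ge0 ?sqr_ge0. Qed.

Let ka t := Num.sqrt (M t ^+ 2 - A t ^+ 2).

Let ka_gt0 t : I t -> 0 < ka t.
Proof. by move=> It; rewrite sqrtr_gt0 subr_gt0 MA. Qed.

Let ka2 t : I t -> ka t ^+ 2 = M t ^+ 2 - A t ^+ 2.
Proof. by move=> It; rewrite sqr_sqrtr // subr_ge0 ltW // MA. Qed.

Let ska t : I t -> smat t ka.
Proof.
move=> It; apply: (@smat_sqrt R _ (fun s => M s ^+ 2 - A s ^+ 2)).
  exact: smatB (smatX 2 (sM It)) (smatX 2 (sA It)).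
by rewrite subr_gt0 MA.
Qed.

Let der_sqr (f : R -> R) t : smat t f -> is_derive t 1 (fun s => f s ^+ 2) (2 * f t * derive1 f t).
Proof. by move=> sf; apply: der_eq (derX 1 (smat_is_derive sf)) _; rewrite expr1. Qed.

Let dA t : I t -> A t * derive1 A t = a t * derive1 a t + b t * derive1 b t.
Proof.
move=> It; have h1 := der_sqr (sA It).
have h2 := derD (der_sqr (sa It)) (der_sqr (sb It)).
have h3 : is_derive t 1 (fun s => A s ^+ 2) (2 * a t * derive1 a t + 2 * b t * derive1 b t).
  by apply: der_near h2; apply: filterS (near_I It) => s _; rewrite A2.
have alg (x y u v z w : R) : 2 * x * y = 2 * u * v + 2 * z * w -> x * y = u * v + z * w by lra.
exact: alg (is_derive_uniq h1 h3).
Qed.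

(** [MA0] says that M / A has zero derivative; since ka^2 = M^2 - A^2, so has ka / A. The relation
    is kept free of division. *)
Let dka t : I t -> derive1 ka t * A t = ka t * derive1 A t.
Proof.
move=> It; have h1 := der_sqr (ska It).
have h2 := derB (der_sqr (sM It)) (der_sqr (sA It)).
have h3 : is_derive t 1 (fun s => ka s ^+ 2) (2 * M t * derive1 M t - 2 * A t * derive1 A t).
  by apply: der_near h2; apply: filterS (near_I It) => s Is; rewrite ka2.
have alg (k k' m m' x x' : R) : k != 0 -> 2 * k * k' = 2 * m * m' - 2 * x * x' ->
    m * x' - m' * x = 0 -> k ^+ 2 = m ^+ 2 - x ^+ 2 -> k' * x = k * x'.
  move=> k0 e1 e2 e3; apply: (mulfI k0).
  have -> : k * (k' * x) = (2 * k * k') * x / 2 by field.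
  have -> : k * (k * x') = k ^+ 2 * x' by ring.
  have -> : k ^+ 2 * x' = m * (m * x' - m' * x) + m * m' * x - x ^+ 2 * x' by rewrite e3; ring.
  by rewrite e1 e2; field.
exact: alg (lt0r_neq0 (ka_gt0 It)) (is_derive_uniq h1 h3) (MA0 It) (ka2 It).
Qed.

Definition nu_of t := (ka t)^-1 *: (- M t *: g t + A t *: n1 t).
Local Notation nu := nu_of.

Let nuE t : I t -> nu t = (ka t)^-1 *: (- M t *: g t + (a t *: v1 t + b t *: v2 t)).
Proof. by move=> It; rewrite /nu_of /n1_of scalerA divff ?scale1r // lt0r_neq0 // A_gt0. Qed.

Let snu t : I t -> smat t nu.
Proof.
move=> It; apply: (@smat_ext R _ _ (fun t => (ka t)^-1 *: (- M t *: g t + (a t *: v1 t + b t *: v2 t)))).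
  by apply: filterS (near_I It) => s Is; rewrite nuE.
apply: smat_scale; first exact: smatV (ska It) (lt0r_neq0 (ka_gt0 It)).
apply: smatD; first exact: smat_scale (smatN (sM It)) (sg It).
exact: smatD (smat_scale (sa It) (sv1 It)) (smat_scale (sb It) (sv2 It)).
Qed.

Let sn2 t : I t -> smat t n2.
Proof.
move=> It; apply: smat_scale; first exact: smatV (sA It) (lt0r_neq0 (A_gt0 It)).
exact: smatD (smat_scale (smatN (sb It)) (sv1 It)) (smat_scale (sa It) (sv2 It)).
Qed.

Let vmu t : I t -> vder mu t (- ka t *: nu t).
Proof.
move=> It; have h := smat_vder (smu It); rewrite dmu // in h.
rewrite (_ : - ka t *: nu t = M t *: g t + (- a t *: v1 t - b t *: v2 t)) //.
rewrite nuE // scalerA mulNr divff; last exact: lt0r_neq0 (ka_gt0 It).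
have alg (u v w : V4) (m x y : R) :
    - (- m *: u + (x *: v + y *: w)) = m *: u + (- x *: v - y *: w).
  by rewrite !opprD !scaleNr opprK.
by rewrite scaleN1r; exact: alg.
Qed.

Let rho t := A t * N t / ka t.

Let vg t : I t -> vder g t (M t *: mu t).
Proof. by move=> It; have := smat_vder (sg It); rewrite dg. Qed.

Let vv1 t : I t -> vder v1 t (n t *: v2 t + a t *: mu t).
Proof. by move=> It; have := smat_vder (sv1 It); rewrite dv1. Qed.

Let vv2 t : I t -> vder v2 t (- n t *: v1 t + b t *: mu t).
Proof. by move=> It; have := smat_vder (sv2 It); rewrite dv2. Qed.

(** The ratios M / ka and A / ka have zero derivative, so only the frame vectors in [nu] contribute:
    n1' gives the component along [n2], and the components along [mu] add up to (A^2 - M^2) / ka =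
    -ka. *)
Let vnu t : I t -> vder nu t (rho t *: n2 t + - ka t *: mu t).
Proof.
move=> It.
have dk := derV (smat_is_derive (ska It)) (lt0r_neq0 (ka_gt0 It)).
have h := vderZ dk (vderD (vderZ (derN (smat_is_derive (sM It))) (vg It))
  (vderD (vderZ (smat_is_derive (sa It)) (vv1 It)) (vderZ (smat_is_derive (sb It)) (vv2 It)))).
move=> i; have := h i; set dd := coord4 _ i => hd.
have : is_derive t 1 (fun s => coord4 (nu s) i) dd.
  by apply: der_near hd; apply: filterS (near_I It) => s Is; rewrite nuE.
move=> {}hd; apply: der_eq hd _; rewrite /dd.
rewrite !(coord4D, coord4Z) /rho /n2_of /N_of /f_of.

have alg (k k' m m' x x' p p' q q' nn G V W U : R) : k != 0 -> x != 0 ->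
   x ^+ 2 = p ^+ 2 + q ^+ 2 ->
   x * x' = p * p' + q * q' -> k' * x = k * x' -> m * x' - m' * x = 0 -> k ^+ 2 = m ^+ 2 - x ^+ 2 ->
   k^-1 * (- m * (m * U) + - m' * G + (p * (nn * W + p * U) + p' * V +
      (q * (- nn * V + q * U) + q' * W))) + - k' / k ^+ 2 * (- m * G + (p * V + q * W)) =
   x * ((p * q' - p' * q + nn * (p ^+ 2 + q ^+ 2)) / (p ^+ 2 + q ^+ 2)) / k *
     (x^-1 * (- q * V + p * W)) + - k * U.
  move=> k0 x0 e1 e2 e3 e4 e5.
  have X0 : p ^+ 2 + q ^+ 2 != 0 by rewrite -e1 expf_neq0.
  (* [r] is the common logarithmic derivative of A, ka and M; substituting it reduces the claim to
     an identity of rational functions. *)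
  pose r := (p * p' + q * q') / (p ^+ 2 + q ^+ 2).
  have ex : x' = x * r by apply: (mulfI x0); rewrite mulrA -expr2 e2 /r e1; field.
  have -> : k' = k * r by apply: (mulIf x0); rewrite e3 ex; ring.
  have -> : m' = m * r by apply: (mulIf x0); rewrite -(subr0_eq e4) ex; ring.
  have -> : - k * U = - ((m ^+ 2 - (p ^+ 2 + q ^+ 2)) / k) * U.
    by congr (- _ * _); rewrite -e1 -e5; field.
  by rewrite /r; field; rewrite x0 k0 X0.
apply: alg (lt0r_neq0 (ka_gt0 It)) (lt0r_neq0 (A_gt0 It)) (A2 t) (dA It) (dka It) (MA0 It) (ka2 It).
Qed.

Let lor_comb t (p q r p' q' r' : R) : I t ->
  lor (p *: g t + (q *: v1 t + r *: v2 t)) (p' *: g t + (q' *: v1 t + r' *: v2 t)) =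
  - (p * p') + q * q' + r * r'.
Proof.
move=> It; have [h1 h2 h3 h4 [h5 h6]] := gram It.
rewrite !(lorDl, lorDr, lorZl, lorZr) (lorC (v1 t) (g t)) (lorC (v2 t) (g t)) (lorC (v2 t) (v1 t)).
by rewrite h1 h2 h3 h4 h5 h6; ring.
Qed.

Let lor_mu_comb t (p q r : R) : I t -> lor (mu t) (p *: g t + (q *: v1 t + r *: v2 t)) = 0.
Proof.
move=> It; have [h1 h2 h3 _] := gram_mu It.
by rewrite !(lorDr, lorZr) h1 h2 h3; ring.
Qed.

Let nu_comb t : I t ->
  nu t = (- (M t / ka t)) *: g t + ((a t / ka t) *: v1 t + (b t / ka t) *: v2 t).
Proof.
have alg (k m p q : R) (u v w : V4) : k^-1 *: (- m *: u + (p *: v + q *: w)) =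
    (- (m / k)) *: u + ((p / k) *: v + (q / k) *: w).
  by rewrite !scalerDr !scalerA mulrN ![k^-1 * _]mulrC.
by move=> It; rewrite nuE //; exact: alg.
Qed.

Let n2_comb t : n2 t = 0 *: g t + ((- (b t / A t)) *: v1 t + (a t / A t) *: v2 t).
Proof.
by rewrite /n2_of scalerDr !scalerA mulrN ![(A t)^-1 * _]mulrC scale0r add0r.
Qed.

(* The de Sitter evolute, up to sign. *)
Let evo t := (- (A t / ka t)) *: g t +
  ((M t / ka t * (a t / A t)) *: v1 t + (M t / ka t * (b t / A t)) *: v2 t).

Let nu_norm t : I t -> lor (nu t) (nu t) = -1.
Proof.
move=> It; rewrite nu_comb // lor_comb //.
have alg (k m x p q : R) : k != 0 -> k ^+ 2 = m ^+ 2 - x ^+ 2 -> x ^+ 2 = p ^+ 2 + q ^+ 2 ->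
   - (- (m / k) * - (m / k)) + p / k * (p / k) + q / k * (q / k) = -1.
  move=> k0 e1 e2; have -> : - (- (m / k) * - (m / k)) + p / k * (p / k) + q / k * (q / k) =
     - (m ^+ 2 - (p ^+ 2 + q ^+ 2)) / k ^+ 2 by field.
  by rewrite -e2 -e1; field.
exact: alg (lt0r_neq0 (ka_gt0 It)) (ka2 It) (A2 t).
Qed.

Let mu_nu t : I t -> lor (mu t) (nu t) = 0.
Proof. by move=> It; rewrite nu_comb // lor_mu_comb. Qed.

(** Frozen at the base point, it supplies the constant frame in which [mu], [nu] and [n2] are
    expanded. *)
Definition frame_at t (i : nat) : V4 :=
  match i with 0%N => mu t | 1%N => nu t | 2%N => n2 t | _ => evo t end.

Let frame_eps (i : 'I_4) : R := if val i == 1%N then -1 else 1.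

Let frame_at_pseudo t : I t -> pseudo_frame (fun i : 'I_4 => frame_at t i) frame_eps.
Proof.
move=> It; split=> [i|i j]; first by rewrite /frame_eps; case: ifP => _; ring.
have [_ _ _ mm] := gram_mu It.
have k0 := lt0r_neq0 (ka_gt0 It); have A0 := lt0r_neq0 (A_gt0 It).
have en := A2 t; have ek := ka2 It.
have algnn (x p q : R) : x != 0 -> x ^+ 2 = p ^+ 2 + q ^+ 2 ->
   - (0 * 0) + - (q / x) * - (q / x) + p / x * (p / x) = 1.
  move=> x0 e; have -> : - (0 * 0) + - (q / x) * - (q / x) + p / x * (p / x) = (p ^+ 2 + q ^+ 2) / x ^+ 2 by field.
  by rewrite -e divff // expf_neq0.
have algEE (k m x p q : R) : k != 0 -> x != 0 -> k ^+ 2 = m ^+ 2 - x ^+ 2 -> x ^+ 2 = p ^+ 2 + q ^+ 2 ->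
   - (- (x / k) * - (x / k)) + m / k * (p / x) * (m / k * (p / x)) + m / k * (q / x) * (m / k * (q / x)) = 1.
  move=> k0' x0 e1 e2.
  have -> : - (- (x / k) * - (x / k)) + m / k * (p / x) * (m / k * (p / x)) + m / k * (q / x) * (m / k * (q / x))
    = (m ^+ 2 * ((p ^+ 2 + q ^+ 2) / x ^+ 2) - x ^+ 2) / k ^+ 2 by field; rewrite k0' x0.
  by rewrite -e2 divff ?expf_neq0 // mulr1 -e1 divff // expf_neq0.
have algyE (k m x p q : R) : k != 0 -> x != 0 -> x ^+ 2 = p ^+ 2 + q ^+ 2 ->
   - (- (m / k) * - (x / k)) + p / k * (m / k * (p / x)) + q / k * (m / k * (q / x)) = 0.
  move=> k0' x0 e2.
  have -> : - (- (m / k) * - (x / k)) + p / k * (m / k * (p / x)) + q / k * (m / k * (q / x))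
    = m * ((p ^+ 2 + q ^+ 2) - x ^+ 2) / (k ^+ 2 * x) by field; rewrite k0' x0.
  by rewrite -e2 subrr mulr0 mul0r.
have nn : lor (n2 t) (n2 t) = 1 by rewrite n2_comb lor_comb //; exact: algnn A0 en.
have yn : lor (nu t) (n2 t) = 0.
  by rewrite n2_comb nu_comb // lor_comb //; ring.
have nE : lor (n2 t) (evo t) = 0.
  by rewrite n2_comb /evo lor_comb //; ring.
have yE : lor (nu t) (evo t) = 0 by rewrite nu_comb // /evo lor_comb //; exact: algyE k0 A0 en.
have EE : lor (evo t) (evo t) = 1 by rewrite /evo lor_comb //; exact: algEE k0 A0 ek en.
have mn : lor (mu t) (n2 t) = 0 by rewrite n2_comb lor_mu_comb.
have mE : lor (mu t) (evo t) = 0 by rewrite lor_mu_comb.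
have my := mu_nu It; have yy := nu_norm It.
case: i => [[|[|[|[|//]]]] hi]; case: j => [[|[|[|[|//]]]] hj]; rewrite /frame_eps /= ?mulr0 ?mulr1;
  first [done | by rewrite lorC].
Qed.

(** The component equals -(M / ka) N, and M is nonzero because M^2 > A^2. It is the third-order
    condition of the cuspidal edge. *)
Let dn2_evo t : I t -> exists2 d, vder n2 t d & lor d (evo t) != 0.
Proof.
move=> It; have k0 := lt0r_neq0 (ka_gt0 It); have A0 := lt0r_neq0 (A_gt0 It).
have dk := derV (smat_is_derive (sA It)) A0.
have h := vderZ dk (vderD (vderZ (derN (smat_is_derive (sb It))) (vv1 It))
  (vderZ (smat_is_derive (sa It)) (vv2 It))).
eexists; first exact: h.
have E1 : lor (v1 t) (evo t) = M t / ka t * (a t / A t).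
  have [h1 h2 h3 h4 [h5 h6]] := gram It.
  by rewrite /evo !(lorDr, lorZr) (lorC _ (g t)) h2 h4 h5; ring.
have E2 : lor (v2 t) (evo t) = M t / ka t * (b t / A t).
  have [h1 h2 h3 h4 [h5 h6]] := gram It.
  by rewrite /evo !(lorDr, lorZr) (lorC _ (g t)) (lorC (v2 t) (v1 t)) h3 h4 h6; ring.
have mE : lor (mu t) (evo t) = 0 by rewrite lor_mu_comb.
rewrite !(lorDl, lorZl) E1 E2 mE.
have alg (k m x p p' q q' nn y : R) : k != 0 -> x != 0 ->
   x^-1 * (- q * (nn * (m / k * (q / x)) + p * 0) + - q' * (m / k * (p / x)) +
      (p * (- nn * (m / k * (p / x)) + q * 0) + p' * (m / k * (q / x)))) +
   y * (- q * (m / k * (p / x)) + p * (m / k * (q / x))) =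
   - (m / k) * ((p * q' - p' * q + nn * (p ^+ 2 + q ^+ 2)) / x ^+ 2).
  by move=> k0' x0; field; rewrite k0' x0.
have := alg (ka t) (M t) (A t) (a t) (derive1 a t) (b t) (derive1 b t) (n t) _ k0 A0.
move=> ->; apply: mulf_neq0; last by rewrite A2; exact: N0.
rewrite oppr_eq0; apply: mulf_neq0; last by rewrite invr_eq0.
by apply: contraTneq (MA It) => ->; rewrite expr0n /= -leNgt sqr_ge0.
Qed.

Let lor_frame t w w' : I t -> let e := frame_at t in
  lor w w' = lor w (e 0%N) * lor w' (e 0%N) - lor w (e 1%N) * lor w' (e 1%N)
    + lor w (e 2%N) * lor w' (e 2%N) + lor w (e 3%N) * lor w' (e 3%N).
Proof.
move=> It e; rewrite (frame_lor (frame_at_pseudo It)) !big_ord_recl big_ord0 /frame_eps /= /bump /=.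
by rewrite !mul1r mulN1r addr0 !addrA.
Qed.

Let srho t : I t -> smat t rho.
Proof.
move=> It; have sab' := lt0r_neq0 (ab_gt0 It).
have sf : smat t (f_of g v1 v2).
  have sa' := smat_derive1 (sa It); have sb' := smat_derive1 (sb It).
  exact: smatD (smatB (smatM (sa It) sb') (smatM sa' (sb It))) (smatM (sn It) (sab It)).
exact: smat_div (smatM (sA It) (smat_div sf (sab It) sab')) (ska It) (lt0r_neq0 (ka_gt0 It)).
Qed.

Let rho_neq0 t : I t -> rho t != 0.
Proof.
move=> It; apply: mulf_neq0; last by rewrite invr_eq0 lt0r_neq0 // ka_gt0.
by apply: mulf_neq0; [exact: lt0r_neq0 (A_gt0 It)|exact: N0].
Qed.

Let sFd2 t th : I t -> smat (rv2 t th) (Fd2 g v1 v2).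
Proof.
move=> It; have st : smat (cu (rv2 t th)) mu by rewrite cu_rv2; exact: smu.
have sy : smat (cu (rv2 t th)) nu by rewrite cu_rv2; exact: snu.
have cR := has_coords_R R.
apply: (@smat_of_coords R _ (Fd2 g v1 v2)) => i; apply: smat_coord_curve.
have s1 := smat_comp_rV cR (smat_cu (rv2 t th)) st.
have s2 := smat_comp_rV cR (smat_cu (rv2 t th)) sy.
have c1 := smat_coshR (smat_cv (rv2 t th)); have c2 := smat_sinhR (smat_cv (rv2 t th)).
exact: smatD (smat_scale c1 s1) (smat_scale c2 s2).
Qed.

Lemma dual_surface_cuspidal_edge t0 : I t0 ->
  is_cuspidal_edge [set x | I (cu x)] (Fd2 g v1 v2) (rv2 t0 0).
Proof.
move=> It; pose e := frame_at t0; have fr := frame_at_pseudo It.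
pose x i t := lor (mu t) (e i); pose y i t := lor (nu t) (e i).
pose nn i t := lor (n2 t) (e i).
have gr i j (hi : (i < 4)%N) (hj : (j < 4)%N) : lor (e i) (e j) =
    (if i == 1%N then -1 else 1) * (i == j)%:R.
  by have [_ /(_ (Ordinal hi) (Ordinal hj))] := fr.
have sx i : smat t0 (x i) by exact: smat_lor (smu It) (smat_cst (e i) t0).
have sy i : smat t0 (y i) by exact: smat_lor (snu It) (smat_cst (e i) t0).
have sn' i : smat t0 (nn i) by exact: smat_lor (sn2 It) (smat_cst (e i) t0).
have dx i : \forall t \near t0, is_derive (t : R) 1 (x i) (- (ka t * y i t)).
  apply: filterS (near_I It) => t Jt.
  exact: der_eq (vder_lorc (e i) (vmu Jt)) (etrans (lorZl _ _ _) (mulNr _ _)).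
have dy i : \forall t \near t0, is_derive (t : R) 1 (y i) (rho t * nn i t - ka t * x i t).
  apply: filterS (near_I It) => t Jt.
  apply: der_eq (vder_lorc (e i) (vnu Jt)) (etrans (lorDl _ _ _) _).
  exact: congr2 (lorZl _ _ _) (etrans (lorZl _ _ _) (mulNr _ _)).
have x0 i : (i < 4)%N -> x i t0 = (i == 0%N)%:R.
  by move=> i4; rewrite /x (gr 0%N i) // mul1r eq_sym.
(* [nu] is timelike, so its product with itself is -1; hence the minus sign. *)
have y0 i : (i < 4)%N -> y i t0 = - (i == 1%N)%:R.
  by move=> i4; rewrite /y (gr 1%N i) // mulN1r eq_sym.
have n0 i : (i < 4)%N -> nn i t0 = (i == 2%N)%:R.
  by move=> i4; rewrite /nn (gr 2%N i) // mul1r eq_sym.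
have dn3 : derive1 (nn 3%N) t0 != 0.
  by have [d dn d0] := dn2_evo It; rewrite (derive1_eq (vder_lorc (e 3%N) dn)).
have qxx : \forall t \near t0, x 0%N t ^+ 2 - x 1%N t ^+ 2 + x 2%N t ^+ 2 + x 3%N t ^+ 2 = 1.
  apply: filterS (near_I It) => t Jt; have [_ _ _ <-] := gram_mu Jt.
  by rewrite (lor_frame (mu t) (mu t) It) !expr2.
have qxy : \forall t \near t0,
    x 0%N t * y 0%N t - x 1%N t * y 1%N t + x 2%N t * y 2%N t + x 3%N t * y 3%N t = 0.
  by apply: filterS (near_I It) => t Jt; rewrite -(mu_nu Jt) (lor_frame (mu t) (nu t) It).
have qyy : \forall t \near t0, y 0%N t ^+ 2 - y 1%N t ^+ 2 + y 2%N t ^+ 2 + y 3%N t ^+ 2 = -1.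
  apply: filterS (near_I It) => t Jt; rewrite -(nu_norm Jt).
  by rewrite (lor_frame (nu t) (nu t) It) !expr2.
have [phi [Psi [lphi p0 lPsi eqn]]] := dual_pair_cusp sx sy sn' (srho It) dx dy x0 y0 n0
  (ka_gt0 It) (rho_neq0 It) dn3 qxx qxy qyy.
pose lam w := rv4 (lor w (e 0%N)) (lor w (e 1%N)) (lor w (e 2%N)) (lor w (e 3%N)).
have lamF z : lam (Fd2 g v1 v2 z) =
    rv4 (coshR (cv z) * x 0%N (cu z) + sinhR (cv z) * y 0%N (cu z))
        (coshR (cv z) * x 1%N (cu z) + sinhR (cv z) * y 1%N (cu z))
        (coshR (cv z) * x 2%N (cu z) + sinhR (cv z) * y 2%N (cu z))
        (coshR (cv z) * x 3%N (cu z) + sinhR (cv z) * y 3%N (cu z)).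
  have E i : lor (Fd2 g v1 v2 z) (e i) = coshR (cv z) * x i (cu z) + sinhR (cv z) * y i (cu z).
    apply: etrans (lorDl (coshR (cv z) *: mu (cu z)) (sinhR (cv z) *: nu (cu z)) (e i)) _.
    exact: congr2 (lorZl _ _ _) (lorZl _ _ _).
  by rewrite /lam !E.
have lam0 : lam (Fd2 g v1 v2 (rv2 t0 0)) = rv4 1 0 0 0.
  rewrite lamF cu_rv2 cv_rv2 !x0 // !y0 // /coshR /sinhR oppr0 expR0 subrr mul0r.
  by congr rv4; rewrite /=; field.
apply: (@A_equiv_germ R 4 _ _ _ _ _ phi (Psi \o lam) lphi p0).
- by apply: ldiff_comp; [exact: (pseudo_frame_coordinates_ldiff _ fr)|rewrite -/lam lam0].
- exact: smat_continuous (sFd2 0 It).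
- have sc := smat_cu (rv2 t0 0); apply: (smat_continuous sc).
  by rewrite /= cu_rv2; exact: near_I.
by apply: filterS eqn => z <-; rewrite /= lamF.
Qed.

(** For a direction (p, q) in the kernel, the component along [n2] is sinh(th) p rho and the one
    along [nu] is cosh(th) (q - ka p), up to sign. If sinh(th) is nonzero, the first forces p = 0
    and the second then q = 0. *)
Lemma dual_surface_singular t0 th : I t0 -> singular_point (Fd2 g v1 v2) (rv2 t0 th) -> th = 0.
Proof.
move=> It [dF [v [v0 dFv]]].
pose al := cu v; pose be := cv v.
have h1 := vder_line v dF; rewrite dFv in h1.
have du : is_derive (0 : R) 1 (fun s => t0 + s * al) al.
  by apply: der_eq (derD (der_cst t0 0) (derM (der_id 0) (der_cst al 0))) _; ring.
have dv : is_derive (0 : R) 1 (fun s => th + s * be) be.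
  by apply: der_eq (derD (der_cst th 0) (derM (der_id 0) (der_cst be 0))) _; ring.
have u0 : t0 + 0 * al = t0 by rewrite mul0r addr0.
have v0' : th + 0 * be = th by rewrite mul0r addr0.
have dc : is_derive (0:R) 1 (fun s => coshR (th + s * be)) (sinhR th * be).
  by apply: der_eq (der_comp dv (der_coshR (th + 0 * be))) _; rewrite v0'.
have ds : is_derive (0:R) 1 (fun s => sinhR (th + s * be)) (coshR th * be).
  by apply: der_eq (der_comp dv (der_sinhR (th + 0 * be))) _; rewrite v0'.
have hmu : vder mu (t0 + 0 * al) (- ka t0 *: nu t0) by rewrite u0; exact: vmu.
have hnu : vder nu (t0 + 0 * al) (rho t0 *: n2 t0 + - ka t0 *: mu t0) by rewrite u0; exact: vnu.
have h2 := vderD (vderZ dc (vder_comp du hmu)) (vderZ ds (vder_comp du hnu)).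
have E : (fun s : R => Fd2 g v1 v2 (s *: v + rv2 t0 th)) =
  (fun s => coshR (th + s * be) *: mu (t0 + s * al) + sinhR (th + s * be) *: nu (t0 + s * al)).
  apply/funext => s; rewrite /Fd2.
  have -> : cu (s *: v + rv2 t0 th) = t0 + s * al.
    by rewrite -{2}(cu_rv2 t0 th) {1}/cu mxE mxE addrC.
  have -> : cv (s *: v + rv2 t0 th) = th + s * be.
    by rewrite -{2}(cv_rv2 t0 th) {1}/cv mxE mxE addrC.
  by [].
rewrite E in h1; have := vder_uniq h1 h2; rewrite u0 v0' => {}h1.
have fr := frame_at_pseudo It.
have gr i j (hi : (i < 4)%N) (hj : (j < 4)%N) : lor (frame_at t0 i) (frame_at t0 j) =
    (if i == 1%N then -1 else 1) * (i == j)%:R.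
  by have [_ /(_ (Ordinal hi) (Ordinal hj))] := fr.
have alg (c s k r p q ey em ez : R) (y m z w : V4) : lor y w = ey -> lor m w = em -> lor z w = ez ->
  lor (c *: (p *: (k *: y)) + (s * q) *: m + (s *: (p *: (r *: z + k *: m)) + (c * q) *: y)) w =
  c * p * k * ey + s * q * em + s * p * (r * ez + k * em) + c * q * ey.
  by move=> <- <- <-; rewrite !(lorDl, lorZl); ring.
have P i (i4 : (i < 4)%N) := etrans (esym (alg _ _ _ _ _ _ _ _ _ _ _ _ _
    (gr 1%N i isT i4) (gr 0%N i isT i4) (gr 2%N i isT i4)))
  (etrans (esym (congr1 (fun w => lor w (frame_at t0 i)) h1)) (lor0l (frame_at t0 i))).
have alg2 (c s k r p q : R) : 0 < c -> r != 0 ->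
    c * p * - k * (-1 * 1) + s * q * (1 * 0) + s * p * (r * (1 * 0) + - k * (1 * 0)) + c * q * (-1 * 1) = 0 ->
    c * p * - k * (-1 * 0) + s * q * (1 * 0) + s * p * (r * (1 * 1) + - k * (1 * 0)) + c * q * (-1 * 0) = 0 ->
    s = 0 \/ p = 0 /\ q = 0.
  move=> c0 r0 e1 e2.
  have e3 : s * p * r = 0 by rewrite -e2; ring.
  have e4 : c * (p * k - q) = 0 by rewrite -e1; ring.
  move/eqP: e3; rewrite !mulf_eq0 (negbTE r0) orbF => /orP[/eqP ->|/eqP p0]; first by left.
  right; split; [exact: p0|]; move/eqP: e4; rewrite mulf_eq0 (gt_eqF c0) /= p0 mul0r sub0r oppr_eq0.
  by move=> /eqP.
have [s0|[p0 q0']] := alg2 _ _ _ _ _ _ (coshR_gt0 th) (rho_neq0 It) (P 1%N isT) (P 2%N isT).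
  exact: sinhR_eq0.
by move: v0; rewrite -(rv2K v) -/al -/be p0 q0' rv200 eqxx.
Qed.

End FramedCurve.

Theorem mainTheorem16 (R : realType) (I : set R) (g v1 v2 : R -> 'rV[R]_4) :
  open I -> is_interval I ->
  hyperbolic_framed_curve I g v1 v2 ->
  (forall t, I t -> a_of g v1 v2 t ^+ 2 + b_of g v1 v2 t ^+ 2 != 0) ->
  (forall t, I t ->
     M_of g v1 v2 t * (derive1 (A_of g v1 v2)) t
     - (derive1 (M_of g v1 v2)) t * A_of g v1 v2 t = 0) ->
  (forall t, I t -> A_of g v1 v2 t ^+ 2 < M_of g v1 v2 t ^+ 2) ->
  (forall t, I t -> N_of g v1 v2 t != 0) ->
  forall t0 theta0 : R, I t0 ->
  singular_point (Fd2 g v1 v2) (rv2 t0 theta0) ->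
  is_cuspidal_edge [set x | I (cu x)] (Fd2 g v1 v2) (rv2 t0 theta0) /\
  ~ is_cuspidal_crosscap [set x | I (cu x)] (Fd2 g v1 v2) (rv2 t0 theta0).
Proof.
move=> oI _ fc ab0 MA0 MA N0 t0 th It sing.
have th0 : th = 0 by exact: (dual_surface_singular oI fc ab0 MA0 MA N0 It sing).
have ce : is_cuspidal_edge [set x | I (cu x)] (Fd2 g v1 v2) (rv2 t0 th).
  by rewrite th0; exact: (dual_surface_cuspidal_edge oI fc ab0 MA0 MA N0 It).
by split=> //; exact: cuspidal_edge_not_crosscap ce.
Qed.
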